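(* Let $G:\mathbb{R}^s\to\mathbb{R}$ be a function for which there exist constants $B>0$ and $M$ with $0<M<1/4$ such that for every $u\subseteq\{1,\dots,s\}$, $$|\partial^u G(z)|\le B\exp\{M\|z\|^2\},\qquad \|z\|^2=z_1^2+\dots+z_s^2 .$$ Then $G$ belongs to the reproducing kernel Hilbert space $\mathcal{F}$ equipped with the standard normal density function $\phi$ and the weight function $\psi(t)=\exp(-t^2/(2\alpha))$ with $\alpha>2$, and a randomly shifted lattice rule $\hat I_s(G\circ\Phi^{-1})$ with $N$ points can be constructed by a CBC algorithm with a root mean squared error $\sqrt{\mathbb{E}^\Delta|I_{s,\phi}(G)-\hat I_s(G\circ\Phi^{-1})|^2}$ of $O(N^{-1+2M+\epsilon})$ for arbitrarily small $\epsilon>0$.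
   Context: Notation: $1{:}s=\{1,\dots,s\}$; for $u\subseteq 1{:}s$, $z_u=(z_j)_{j\in u}$, $z_{-u}=(z_j)_{j\notin u}$, and $\partial^uG=\frac{\partial^{|u|}}{\prod_{j\in u}\partial z_j}G$ is the mixed first-order partial derivative (with $\partial^\emptyset G=G$). $\phi(t)=(2\pi)^{-1/2}e^{-t^2/2}$ is the standard normal density, $\Phi$ its distribution function, $\Phi^{-1}$ its quantile function (applied componentwise to vectors). Write $\phi_u(z)=\prod_{j\in u}\phi(z_j)$, $\psi_u(z)=\prod_{j\in u}\psi(z_j)$, $\phi_{-u}=\phi_{1:s\setminus u}$, $\phi(z)=\phi_{1:s}(z)$. Weights $\gamma_u>0$, $u\subseteq 1{:}s$, are given. The space $\mathcal{F}$ consists of the real functions $G$ on $\mathbb{R}^s$ with mixed first derivatives for which the following norm is finite: $$\|G\|_{\mathcal F}^2=\sum_{u\subseteq 1:s}\frac1{\gamma_u}\int_{\mathbb{R}^{|u|}}\Big(\int_{\mathbb{R}^{s-|u|}}\partial^uG(z)\,\phi_{-u}(z)\,dz_{-u}\Big)^2\psi_u(z)^2\,dz_u .$$ $I_{s,\phi}(G)=\int_{\mathbb{R}^s}G(z)\phi(z)\,dz$. The randomly shifted (rank-1) lattice rule with generating vector $z^*\in\mathbb{N}^s$ is $$\hat I_s(G\circ\Phi^{-1})=\frac1N\sum_{k=0}^{N-1}G\Big(\Phi^{-1}\big(\{kz^*/N+\Delta\}\big)\Big),$$ where $\{\cdot\}$ is the componentwise fractional part and $\Delta$ is uniform on $(0,1)^s$;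 $\mathbb{E}^\Delta$ is expectation over $\Delta$. CBC (component-by-component) algorithm: for $d\le s$ put $$e_d^{\rm sh}(z_1^*,\dots,z_d^* )^2=\sum_{\emptyset\ne u\subseteq 1:d}\frac{\gamma_u}{N}\sum_{k=0}^{N-1}\prod_{j\in u}\theta(\{kz_j^*/N\}),$$ $$\theta(c)=\int_{-\infty}^\infty\frac{\max(\Phi(t)-c,0)+\max(\Phi(t)-1+c,0)-\Phi(t)^2}{\psi(t)^2}\,dt .$$ Set $z_1^*=1$; for $d=2,\dots,s$, with $z_1^*,\dots,z_{d-1}^*$ fixed, choose $z_d^*\in\{0,\dots,N-1\}$ with $\gcd(z_d^*,N)=1$ minimizing $e_d^{\rm sh}(z_1^*,\dots,z_d^* )$. *)

(* Defs.v *)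
From HB Require Import structures.
From mathcomp Require Import all_boot all_order all_algebra.
From mathcomp Require Import all_classical all_reals all_analysis.

Set Implicit Arguments.
Unset Strict Implicit.
Unset Printing Implicit Defensive.
Import Order.TTheory GRing.Theory Num.Theory.
Import numFieldNormedType.Exports.

Local Open Scope classical_set_scope.
Local Open Scope ring_scope.

(* R^n is n.-tuple R with the library's product sigma-algebra.  The library has
   no n-dimensional Lebesgue measure; it is built here by recursion on n, from
   the Dirac mass on R^0 and the image of the product of the one-dimensional
   Lebesgue measure with the measure on R^n under (x, t) |-> x :: t. *)
Section lebesgue_tuple.
Variable R : realType.

Definition consp n (p : measurableTypeR R * n.-tuple R) : n.+1.-tuple R :=
  [tuple of p.1 :: p.2].

Lemma measurable_consp n : measurable_fun setT (@consp n).
Proof.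
apply: (@measurable_cons _ _ _ _
  (fun p : measurableTypeR R * n.-tuple R => p.1 : R)).
  by move=> _ Y mY; exact: (measurable_fst measurableT _ mY).
exact: measurable_snd.
Qed.

HB.instance Definition _ n := isMeasurableFun.Build _ _ _ _
  (@consp n) (@measurable_consp n).

Section step.
Variables (n : nat) (m : {sigma_finite_measure set (n.-tuple R) -> \bar R}).

Definition leb_step : set (n.+1.-tuple R) -> \bar R :=
  pushforward (@lebesgue_measure R \x m)%E (@consp n).

Let leb_step0 : leb_step set0 = 0%E.
Proof. exact: measure0. Qed.

Let leb_step_ge0 A : (0 <= leb_step A)%E.
Proof. exact: measure_ge0. Qed.

Let leb_step_sigma_additive : semi_sigma_additive leb_step.
Proof. exact: measure_semi_sigma_additive. Qed.

HB.instance Definition _ := isMeasure.Build _ _ _ leb_step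
  leb_step0 leb_step_ge0 leb_step_sigma_additive.

Let leb_step_sigma_finite : sigma_finite setT leb_step.
Proof.
have /sigma_finiteP[F [TF ndF Foo]] := sigma_finiteT (@lebesgue_measure R).
have /sigma_finiteP[G [TG ndG Goo]] := sigma_finiteT m.
pose g (t : n.+1.-tuple R) := (thead t : measurableTypeR R, [tuple of behead t]).
have mg : measurable_fun setT g.
  apply/measurable_fun_pairP; split.
    by move=> _ Y mY; exact: (measurable_tnth ord0 measurableT mY).
  exact: measurable_behead.
exists (fun i => g @^-1` (F i `*` G i)).
  rewrite predeqE => t; split => // _.
  have [i _ Fi] : (\bigcup_i F i) (thead t) by rewrite -TF.
  have [j _ Gj] : (\bigcup_i G i) [tuple of behead t] by rewrite -TG.
  exists (maxn i j) => //; split => /=.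
  - by move: Fi; exact/subsetPset/ndF/leq_maxl.
  - by move: Gj; exact/subsetPset/ndG/leq_maxr.
move=> i; have [mF Fi] := Foo i; have [mG Gi] := Goo i; split.
  by rewrite -[X in measurable X]setTI; apply: mg => //; exact: measurableX.
rewrite /leb_step /pushforward -comp_preimage (_ : g \o @consp n = id).
  by rewrite preimage_id product_measure1E// lte_mul_pinfty// ge0_fin_numE.
by apply/funext => -[x t]; rewrite /g /consp /=; congr pair; apply/val_inj.
Qed.

HB.instance Definition _ := Measure_isSigmaFinite.Build _ _ _ leb_step
  leb_step_sigma_finite.

End step.

Definition leb_zero : set (0.-tuple R) -> \bar R := @dirac _ _ [tuple] R.
HB.instance Definition _ := Measure.on leb_zero.
HB.instance Definition _ := Measure_isSigmaFinite.Build _ _ _ leb_zero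
  (@sigma_finiteT _ _ _ (@dirac _ (0.-tuple R) [tuple] R)).

Fixpoint lebesgue_tuple n : {sigma_finite_measure set (n.-tuple R) -> \bar R} :=
  if n is n'.+1 return {sigma_finite_measure set (n.-tuple R) -> \bar R}
  then leb_step (lebesgue_tuple n') else leb_zero.

End lebesgue_tuple.

Section mixed_derivatives.
Variables (R : realType) (s : nat).
Implicit Types (G : s.-tuple R -> R) (u : {set 'I_s}).

Definition upd (T : Type) (z : s.-tuple T) (j : 'I_s) (t : T) : s.-tuple T :=
  [tuple if i == j then t else tnth z i | i < s].

Definition partial (j : 'I_s) G (z : s.-tuple R) : R :=
  derive1 (fun t : R => G (upd z j t)) (tnth z j).

Definition has_partial (j : 'I_s) G :=
  forall z : s.-tuple R, derivable (fun t : R => G (upd z j t)) (tnth z j) 1.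

(* enum u is increasing, so for u = {j1 < ... < jk} this is the iterated
   derivative d/dz_j1 (d/dz_j2 (... (d/dz_jk G))). *)
Definition mixed_partial u G : s.-tuple R -> R := foldr partial G (enum u).

(* Every one-variable derivative taken in forming the mixed_partial u G exists
   everywhere; derive1 alone is total and would not say so. *)
Definition has_mixed_partials G :=
  forall u (j : 'I_s), (forall i, i \in u -> (j < i)%N) ->
    has_partial j (mixed_partial u G).

End mixed_derivatives.

Section gaussian.
Variable R : realType.

Definition phi : R -> R := normal_pdf 0 1.

Definition Phi (t : R) : R := fine (normal_prob 0 1 `]-oo, t]).

Definition quantile (p : R) : R := inf [set t : R | p <= Phi t].

Definition gauss_weight (alpha t : R) : R := expR (- (t ^+ 2 / (2 * alpha))).

End gaussian.

Section space.
Variables (R : realType) (s : nat) (gamma : {set 'I_s} -> R) (psi : R -> R).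
Implicit Types (G : s.-tuple R -> R) (u : {set 'I_s}).

(* The point z with z_u = x and z_{-u} = y, coordinates in increasing order. *)
Definition glue u (x : #|u|.-tuple R) (y : #|~: u|.-tuple R) : s.-tuple R :=
  [tuple if i \in u then nth 0 x (index i (enum u))
         else nth 0 y (index i (enum (~: u))) | i < s].

Definition prodf (f : R -> R) n (x : n.-tuple R) : R := \prod_(i < n) f (tnth x i).

Definition inner_integrand u G (x : #|u|.-tuple R) (y : #|~: u|.-tuple R) : R :=
  mixed_partial u G (glue x y) * prodf (@phi R) y.

Definition inner_integral u G (x : #|u|.-tuple R) : \bar R :=
  (\int[lebesgue_tuple R #|~: u|]_y (inner_integrand G x y)%:E)%E.

Definition sqnormF G : \bar R :=
  (\sum_(u : {set 'I_s}) ((gamma u)^-1)%:E *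
     \int[lebesgue_tuple R #|u|]_x
        (inner_integral G x ^+ 2 * (prodf psi x ^+ 2)%:E))%E.

(* The integral of the library is total, hence the explicit requirement that
   the inner integrals entering the norm make sense. *)
Definition inF G :=
  [/\ has_mixed_partials G,
      forall u, measurable_fun setT (mixed_partial u G),
      forall u, {ae lebesgue_tuple R #|u|, forall x,
        (lebesgue_tuple R #|~: u|).-integrable setT
          (fun y => (inner_integrand G x y)%:E)} &
      (sqnormF G < +oo)%E].

End space.

Section lattice.
Variables (R : realType) (s : nat).
Implicit Types (G : s.-tuple R -> R) (z : s.-tuple nat).

Definition frac (x : R) : R := x - (Num.floor x)%:~R.

Definition Iphi G : R :=
  \int[lebesgue_tuple R s]_x (G x * prodf (@phi R) x).

Definition lattice_node (N : nat) z (k : nat) (Delta : s.-tuple R) : s.-tuple R :=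
  [tuple quantile (frac (k%:R * (tnth z i)%:R / N%:R + tnth Delta i)) | i < s].

Definition lattice_rule (N : nat) z G (Delta : s.-tuple R) : R :=
  N%:R^-1 * \sum_(k < N) G (lattice_node N z k Delta).

Definition open_cube : set (s.-tuple R) :=
  [set Delta | forall i, 0 < tnth Delta i < 1].

Definition rmse (N : nat) z G : \bar R :=
  sqrte (\int[lebesgue_tuple R s]_(Delta in open_cube)
           (`|Iphi G - lattice_rule N z G Delta| ^+ 2)%:E)%E.

End lattice.

Section cbc.
Variables (R : realType) (s : nat) (gamma : {set 'I_s} -> R) (psi : R -> R).
Implicit Types z : s.-tuple nat.

Definition theta (c : R) : R :=
  \int[lebesgue_measure]_t
    ((Num.max (Phi t - c) 0 + Num.max (Phi t - 1 + c) 0 - Phi t ^+ 2)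
       / psi t ^+ 2).

(* Only the first d coordinates of z are used. *)
Definition esh (N d : nat) z : R :=
  Num.sqrt (\sum_(u : {set 'I_s} | (u != finset.set0) && [forall i in u, (i < d)%N])
    gamma u / N%:R *
      \sum_(k < N) \prod_(j in u) theta (frac (k%:R * (tnth z j)%:R / N%:R))).

(* z is a possible output of the component-by-component algorithm (ties in the
   minimization are broken arbitrarily); coordinate j : 'I_s is z_(j+1). *)
Definition cbc_vector (N : nat) z :=
  (forall j : 'I_s, nat_of_ord j = 0 -> tnth z j = 1)%N /\
  (forall j : 'I_s, (0 < j)%N ->
     [/\ (tnth z j < N)%N, coprime (tnth z j) N &
        forall c : nat, (c < N)%N -> coprime c N ->
          esh N j.+1 z <= esh N j.+1 (upd z j c)]).

End cbc.

(* Main.v *)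
(* On each coordinate, g(x) = int g phi + int g'(t) (Phi t - 1[x <= t]) dt for
   every g with |g|, |g'| <= B exp(M t^2).  Iterating over the coordinates writes
   G(x) as a sum over u of integrals of (d^u G)(t) against a product kernel, so
   that I(G) - Q(G) = - sum_(u <> 0) int (d^u G)(t) h_u(t) dt, where h_u is the
   average of the kernel over the N nodes.  Cauchy-Schwarz with the weight
   psi_u^2 phi_(-u) (finite moments because 2 M < 1 / alpha) and integration over
   the shift bound the mean square error by a constant times the sum over u <> 0
   of the means over k of prod_(j in u) theta(k z_j / N), since theta is the
   autocovariance of the indicators x |-> 1[Phi^-1 x <= t] integrated against
   psi^-2.

   The discrete Fourier coefficients of theta on the grid Z / N are nonnegative
   and decay like |h|^(2 eta - 2) for every eta > 1 / alpha.  For 0 < lam <= 1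
   with lam (2 - 2 eta) > 1, subadditivity of x |-> x^lam and averaging over the
   admissible choices of z_d show that the increment of the error in each
   component-by-component step is at most (K / totient N)^(1 / lam).  With
   1 / alpha close to 2 M, eta close to 1 / alpha, lam close to 1 / (2 - 2 eta),
   and totient N >= c N^(1 - delta), the squared error is
   O(N^(-2 (1 - 2 M - eps))). *)
From HB Require Import structures.
Require Import Defs.
From mathcomp Require Import all_boot all_order all_algebra.
From mathcomp Require Import all_classical all_reals all_analysis.
From mathcomp Require Import measurable_realfun.
From mathcomp Require Import ring lra zify.
Set Implicit Arguments.
Unset Strict Implicit.
Unset Printing Implicit Defensive.
Import Order.TTheory GRing.Theory Num.Theory.
Import numFieldNormedType.Exports.
Local Open Scope classical_set_scope.
Local Open Scope ring_scope.

(** * Power sums and a lower bound for the totient *)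

(** The exponents come from one interpolation. At p = Phi t the transform of the autocovariance is
    of order at most p^2 and, at frequency h, at most 1 / h^2. Weighting the two bounds by eta and 1
    - eta gives up some decay but retains p^(2 eta), and it is this power of a Gaussian tail that
    beats psi^-2 = exp(t^2 / alpha); hence eta > 1 / alpha. Finite moments confine alpha to 2 <
    alpha < 1 / (2 M), so M enters the rate, and alpha has to be chosen after eps. The transform on
    Z / N replaces Fourier series on the circle because it is exact for each N: at grid points the
    autocovariance interpolates between counts of pairs in integer intervals, whose transforms are
    squared moduli of geometric sums, and no infinite series has to converge. N is arbitrary, so
    frequencies sharing a factor with N must be counted. The partial derivatives of G are only known
    to exist and to obey the growth bound. Neither joint continuity of G nor continuity of a
    derivative is available, which dictates the form of the fundamental theorem of calculus and of
    the measurability lemmas. *)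

Section power_sums.
Variable R : realType.
Implicit Types (x y l : R).

(** The ratios x / (x + y) and y / (x + y) sum to 1, and a number in [0, 1] does not decrease when
    raised to a power l <= 1. *)
Lemma powR_subadd l x y : 0 < l <= 1 -> 0 <= x -> 0 <= y ->
  (x + y) `^ l <= x `^ l + y `^ l.
Proof.
move=> /andP[l0 l1] x0 y0; have [s0|s0] := leP (x + y) 0.
  have -> : x + y = 0 by apply/eqP; rewrite eq_le s0 addr_ge0.
  by rewrite powR0 ?gt_eqF// addr_ge0// powR_ge0.
have key t : 0 <= t -> t <= x + y -> t / (x + y) * (x + y) `^ l <= t `^ l.
  move=> t0 ts; have -> : t `^ l = (t / (x + y)) `^ l * (x + y) `^ l.
    by rewrite -powRM ?divr_ge0 ?(ltW s0)// divfK// gt_eqF.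
  rewrite ler_wpM2r ?powR_ge0//.
  have [->|tn0] := eqVneq t 0; first by rewrite mul0r powR_ge0.
  have t1 : 0 < t by rewrite lt_def tn0.
  by apply: ger1_powR l1; rewrite divr_gt0//= ler_pdivrMr// mul1r.
have -> : (x + y) `^ l = x / (x + y) * (x + y) `^ l + y / (x + y) * (x + y) `^ l.
  by rewrite -mulrDl -mulrDl divff ?mul1r// gt_eqF.
by rewrite lerD// key// ?lerDl ?lerDr.
Qed.

Lemma powR_sum_le (I : Type) (r : seq I) (P : pred I) (F : I -> R) l :
  0 < l <= 1 -> (forall i, P i -> 0 <= F i) ->
  (\sum_(i <- r | P i) F i) `^ l <= \sum_(i <- r | P i) F i `^ l.
Proof.
move=> l01 F0.
suff [] : 0 <= \sum_(i <- r | P i) F i /\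
  (\sum_(i <- r | P i) F i) `^ l <= \sum_(i <- r | P i) F i `^ l by [].
apply: (big_ind2 (fun a b => 0 <= a /\ a `^ l <= b)).
- by case/andP: l01 => l0 _; rewrite powR0 ?gt_eqF.
- move=> a b c d [a0 ab] [c0 cd]; split; first exact: addr_ge0.
  by apply: le_trans (powR_subadd l01 a0 c0) _; exact: lerD.
- by move=> i Pi; split; [exact: F0|].
Qed.

Lemma sum_powRN_le (k : R) n : 1 < k ->
  \sum_(i < n) i.+1%:R `^ (- k) <= k / (k - 1).
Proof.
move=> k1; have k10 : 0 < k - 1 by rewrite subr_gt0.
case: n => [|n].
  by rewrite big_ord0 divr_ge0 ?(ltW k10)// (le_trans ler01)// ltW.
(* The subtracted term is the integral of x^(-k) from n + 1 to infinity; with it the bound can be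
   proved by induction. *)
suff : \sum_(i < n.+1) i.+1%:R `^ (- k) <=
    k / (k - 1) - n.+1%:R `^ (1 - k) / (k - 1).
  by move=> /le_trans; apply; rewrite gerBl divr_ge0 ?powR_ge0 ?ltW.
elim: n => [|n IH].
  by rewrite big_ord_recl big_ord0 addr0 !powR1 -mulrBl divff// gt_eqF.
rewrite big_ord_recr/=; apply: le_trans (lerD IH (lexx _)) _.
rewrite -addrA lerD2l -lerBrDl opprK addrC -mulrBl ler_pdivlMr//.
set a : R := n.+1%:R; set b : R := n.+2%:R.
have a0 : 0 < a by rewrite ltr0n. have b0 : 0 < b by rewrite ltr0n.
have ab : a / b = 1 + - b^-1.
  by rewrite -[X in X - _](divff (lt0r_neq0 b0)) -[in X in _ - X](mul1r b^-1) -mulrBl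
     /a /b -(natr1 n.+1) addrK.
have b1 : b^-1 < 1 by rewrite invf_lt1// ltr1n.
have -> : a `^ (1 - k) = b `^ (1 - k) * (a / b) `^ (1 - k).
  by rewrite -powRM ?divr_ge0 ?ltW// mulrC divfK// gt_eqF.
have -> : b `^ (- k) = b `^ (1 - k) * b^-1.
  by rewrite -(powR_inv1 (ltW b0)) -powRD; [congr (_ `^ _); ring|rewrite (gt_eqF b0) implybT].
rewrite -[X in _ <= _ - X]mulr1 -mulrBr -mulrA ler_wpM2l ?powR_ge0//.
rewrite lerBrDl /powR gt_eqF ?divr_gt0//.
(* Bernoulli's inequality (a / b)^(1 - k) >= 1 + (k - 1) / b, from exp y >= 1 + y and ln (1 - 1 / b)
   <= - 1 / b. *)
have := expR_ge1Dx ((1 - k) * ln (a / b)); apply: le_trans.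
rewrite lerD2l ab.
have := le_ln1Dx (_ : -1 < - b^-1); rewrite ltrN2 => /(_ b1) lnb.
rewrite mulrC -[in leRHS]opprB mulNr -mulrN ler_wpM2l ?(ltW k10)//.
by rewrite lerNr.
Qed.

End power_sums.

Section totient_bound.
Variable R : realType.

Lemma prod_powR (I : Type) (r : seq I) (F : I -> R) l : (forall i, 0 <= F i) ->
  (\prod_(i <- r) F i) `^ l = \prod_(i <- r) F i `^ l.
Proof.
move=> F0; elim: r => [|i r IH]; first by rewrite !big_nil powR1.
by rewrite !big_cons powRM ?IH// prodr_ge0.
Qed.

(** A prime power satisfies totient (p^e) >= p^e / 2, and the factor 1 / 2 is absorbed by (p^e)^(-d)
    once p^d >= 2, which holds for p >= [D]. At most [D] primes lie below this threshold, and
    together they cost at most 2^(-D). *)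
Lemma totient_ge (d : R) : 0 < d -> exists2 c : R, 0 < c &
  forall N, (0 < N)%N -> c * N%:R `^ (1 - d) <= (totient N)%:R.
Proof.
move=> d0; pose D := (Num.truncn (2 `^ d^-1 : R)).+1.
have D2 (p : nat) : (D <= p)%N -> 2 <= (p%:R : R) `^ d.
  move=> Dp; have : (2 `^ d^-1 : R) <= p%:R.
    by apply: le_trans (ltW (truncnS_gt _)) _; rewrite ler_nat.
  move=> /(ge0_ler_powR (ltW d0)); rewrite !nnegrE powR_ge0 ler0n => /(_ isT isT).
  by rewrite -powRrM mulVf ?gt_eqF// powRr1.
exists (2^-1 ^+ D); first by rewrite exprn_gt0.
move=> N N0; rewrite totientE//.
have NE : N = (\prod_(p <- primes N) p ^ logn p N)%N.
  by rewrite [LHS]prod_prime_decomp// prime_decompE big_map.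
pose w (p : nat) : R := if (p < D)%N then 2^-1 else 1.
rewrite {1}NE !natr_prod prod_powR; last by move=> p; rewrite ler0n.
have w_ge : 2^-1 ^+ D <= \prod_(p <- primes N) w p.
  rewrite -big_mkcond/= -big_filter big_const_seq count_predT iter_mulr_1.
  apply: ler_wiXn2l; [by []|by rewrite invf_le1// ler1n|].
  rewrite -[leqRHS](size_iota 0); apply: uniq_leq_size.
    by rewrite filter_uniq// primes_uniq.
  by move=> p; rewrite mem_filter mem_iota add0n/= => /andP[].
apply: le_trans (ler_wpM2r _ w_ge) _.
  by apply: prodr_ge0 => p _; exact: powR_ge0.
rewrite -big_split/= big_seq [leRHS]big_seq; apply: ler_prod => p.
rewrite mem_primes => /and3P[pp _ pN].
apply/andP; split.
  by rewrite mulr_ge0 ?powR_ge0// /w; case: ifP.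
have e0 : (0 < logn p N)%N by rewrite logn_gt0 mem_primes pp N0.
have p2 := prime_gt1 pp; case: (logn p N) e0 => // e _ /=.
have half : 2^-1 * (p ^ e.+1)%:R <= (p.-1 * p ^ e)%:R :> R.
  rewrite ler_pdivrMl// -natrM ler_nat expnS mulnA leq_mul2r; apply/orP; right.
  by case: p p2 {pp pN} => // -[|p]// _; rewrite /= !mulSn; lia.
apply: le_trans half.
have P1 : 1 <= (p ^ e.+1)%:R :> R by rewrite ler1n expn_gt0 prime_gt0.
have P0 := lt_le_trans ltr01 P1.
rewrite powRB; last by rewrite (gt_eqF P0) implybT.
rewrite powRr1 ?(ltW P0)// /w; case: ltnP => pD.
  rewrite ler_wpM2l// ler_piMr ?(ltW P0)// invf_le1 ?powR_gt0//.
  by rewrite -[leLHS](powRr0 (p ^ e.+1)%:R) ler_powR// ltW.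
rewrite mul1r mulrC ler_wpM2r ?(ltW P0)// lef_pV2 ?posrE ?powR_gt0//.
apply: le_trans (D2 _ pD) _; apply: ge0_ler_powR; rewrite ?nnegrE ?ler0n ?(ltW d0)//.
by rewrite ler_nat expnS leq_pmulr// expn_gt0 prime_gt0.
Qed.

End totient_bound.

(** * Discrete cosine transform *)

Section cosines.
Variable R : realType.

(** The real part of exp(2 i pi m / N), a character of Z / N. *)
Definition cosm (N m : nat) : R := cos (2 * pi * m%:R / N%:R).

Lemma cosm0 N : cosm N 0 = 1.
Proof. by rewrite /cosm mulr0 mul0r cos0. Qed.

Lemma cosm_le1 N m : cosm N m <= 1. Proof. exact: cos_le1. Qed.

Lemma sinD_natpi n (x : R) : sin (x + n%:R * pi) = (-1) ^+ n * sin x.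
Proof.
elim: n => [|n IH]; first by rewrite mul0r addr0 mul1r.
rewrite -natr1 mulrDl mul1r addrA -[X in _ + X]mulr1n sinDpi.
by rewrite IH exprS mulN1r mulNr.
Qed.

Lemma sin_natpi n : sin (n%:R * pi : R) = 0.
Proof. by rewrite -[X in sin X]add0r sinD_natpi sin0 mulr0. Qed.

Lemma cosD_nat2pi n (x : R) : cos (x + n%:R * (2 * pi)) = cos x.
Proof.
elim: n => [|n IH]; first by rewrite mul0r addr0.
by rewrite -natr1 mulrDl mul1r addrA [X in cos (_ + X)]mulr_natl -[X in _ + X]mulr1n cosD2pi.
Qed.

Section fixed_N.
Variables (N : nat) (N_gt0 : (0 < N)%N).

Let N0 : N%:R != 0 :> R. Proof. by rewrite pnatr_eq0 -lt0n. Qed.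

Lemma cosm_add_mul m q : cosm N (m + q * N) = cosm N m.
Proof.
rewrite /cosm natrD mulrDr mulrDl natrM -[RHS](cosD_nat2pi q).
by congr cos; field.
Qed.

Lemma cosm_modn m : cosm N (m %% N) = cosm N m.
Proof. by rewrite {2}(divn_eq m N) addnC cosm_add_mul. Qed.

(** The product-to-sum formula; [N.-1 * n] stands for -n modulo N, frequencies being natural
    numbers. *)
Lemma cosm_mul m n :
  cosm N m * cosm N n = (cosm N (m + n) + cosm N (m + N.-1 * n)) / 2.
Proof.
have -> : cosm N (m + N.-1 * n) = cos (2 * pi * m%:R / N%:R - 2 * pi * n%:R / N%:R).
  rewrite -[RHS](cosD_nat2pi n) /cosm; congr cos.
  have -> : (m + N.-1 * n)%:R = m%:R + (N%:R - 1) * n%:R :> R.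
    by rewrite natrD natrM -subn1 natrB.
  by field.
rewrite cosB; have -> : cosm N (m + n) =
  cos (2 * pi * m%:R / N%:R + 2 * pi * n%:R / N%:R).
  by rewrite /cosm natrD mulrDr mulrDl.
by rewrite cosD /cosm; field.
Qed.

(** The Dirichlet sum in closed form, multiplied by sin x so that the zeros of the sine need no
    separate case. *)
Lemma sin_sum_cos n (x : R) :
  sin x * \sum_(k < n) cos (2 * k%:R * x) = sin (n%:R * x) * cos (n%:R * x - x).
Proof.
elim: n => [|n IH]; first by rewrite big_ord0 mulr0 mul0r sin0 mul0r.
rewrite big_ord_recr/= mulrDr IH.
have -> : n.+1%:R * x - x = n%:R * x by rewrite -natr1; ring.
have -> : n.+1%:R * x = n%:R * x + x by rewrite -natr1; ring.
have -> : 2 * n%:R * x = (n%:R * x) *+ 2 by rewrite mulr2n; ring.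
rewrite cosB sinD cos_mulr2n.
have := cos2Dsin2 (n%:R * x); set a := cos _; set b := sin _ => ab.
have -> : b * (a * cos x + b * sin x) + sin x * (a ^+ 2 *+ 2 - 1) =
  (b * cos x + a * sin x) * a + sin x * (a ^+ 2 + b ^+ 2 - 1) by ring.
by rewrite ab subrr mulr0 addr0.
Qed.

Lemma sin_sum_sin n (x : R) :
  sin x * \sum_(k < n) sin (2 * k%:R * x) = sin (n%:R * x) * sin (n%:R * x - x).
Proof.
elim: n => [|n IH]; first by rewrite big_ord0 mulr0 mul0r sin0 mul0r.
rewrite big_ord_recr/= mulrDr IH.
have -> : n.+1%:R * x - x = n%:R * x by rewrite -natr1; ring.
have -> : n.+1%:R * x = n%:R * x + x by rewrite -natr1; ring.
have -> : 2 * n%:R * x = (n%:R * x) *+ 2 by rewrite mulr2n; ring.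
rewrite sinB sin_mulr2n sinD mulr2n; ring.
Qed.

(** Orthogonality of characters. If N does not divide r, then x = pi (r mod N) / N lies strictly
    between 0 and pi, so sin x is nonzero while sin (N x) vanishes. *)
Lemma sum_cosm r : \sum_(k < N) cosm N (k * r) = if (N %| r)%N then N%:R else 0.
Proof.
case: ifPn => [/dvdnP[q ->]|Nr].
  rewrite (eq_bigr (fun=> 1)) ?sumr_const ?card_ord// => k _.
  by rewrite mulnA -[(_ * N)%N]add0n cosm_add_mul cosm0.
pose x : R := pi * (r %% N)%:R / N%:R.
have x0pi : 0 < x < pi.
  have r0 : (0 < r %% N)%N by rewrite lt0n; exact: Nr.
  rewrite /x divr_gt0 ?mulr_gt0 ?pi_gt0 ?ltr0n//= ltr_pdivrMr ?ltr0n//.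
  by rewrite ltr_pM2l ?pi_gt0// ltr_nat ltn_mod.
have := sin_sum_cos N x.
have -> : N%:R * x = (r %% N)%:R * pi by rewrite /x; field.
rewrite sin_natpi mul0r => /eqP; rewrite mulf_eq0 gt_eqF ?sin_gt0_pi//= => /eqP S0.
rewrite -[RHS]S0.
apply: eq_bigr => k _; rewrite -cosm_modn -modnMmr cosm_modn /cosm /x natrM.
by congr cos; field.
Qed.

(* The functions transformed are even on Z / N, so cosines suffice. *)
Definition dft (f : nat -> R) (h : nat) : R :=
  N%:R^-1 * \sum_(m < N) f m * cosm N (h * m).

(** The product formula and orthogonality leave half of the value at m and half of the value at -m
    modulo N; evenness identifies the two. *)
Lemma dft_inversion (f : nat -> R) m : (m < N)%N ->
  (forall i, (0 < i < N)%N -> f (N - i)%N = f i) ->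
  f m = \sum_(h < N) dft f h * cosm N (h * m).
Proof.
move=> mN feven.
transitivity (\sum_(i < N) f i * (2^-1 * ((N %| i + m)%N%:R + (N %| i + N.-1 * m)%N%:R))); last first.
  under [RHS]eq_bigr => h _ do rewrite /dft mulr_sumr mulr_suml.
  rewrite exchange_big/=; apply: eq_bigr => i _.
  under eq_bigr => h _ do rewrite -!mulrA cosm_mul -(mulnDr h) mulrCA (mulnCA N.-1) -mulnDr.
  rewrite -mulr_sumr; congr (_ * _); rewrite -mulr_sumr -mulr_suml big_split/= !sum_cosm.
  by case: ifP; case: ifP => _ _ /=; field.
have sel j (g : nat -> R) : (j < N)%N ->
    \sum_(i < N) g i * (val i == j)%:R = g j.
  move=> jN; rewrite (bigD1 (Ordinal jN))//= eqxx mulr1 big1 ?addr0// => k.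
  by rewrite -val_eqE/= => /negbTE->; rewrite mulr0.
have e1 i : (i < N)%N -> (N %| i + N.-1 * m)%N = (i == m).
  move=> iN; rewrite -(dvdn_addl _ (dvdnn N)).
  have [im|mi] := leqP m i.
    have -> : (i + N.-1 * m + N = (i - m) + m.+1 * N)%N.
      case: N N_gt0 => // N' _ /=; rewrite mulSn mulnS; nia.
    rewrite dvdn_addl ?dvdn_mull// /dvdn modn_small; last by lia.
    by apply/eqP/eqP; lia.
  have -> : (i + N.-1 * m + N = (N + i - m) + m * N)%N.
    case: N N_gt0 mN iN => // N' _ mN' iN' /=; rewrite mulnS; nia.
  rewrite dvdn_addl ?dvdn_mull// /dvdn modn_small; last by lia.
  by apply/eqP/eqP; lia.
have e2 i : (i < N)%N -> (N %| i + m)%N = (i == (N - m) %% N)%N.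
  move=> iN; have [->|m0] := eqVneq m 0%N.
    by rewrite addn0 subn0 modnn /dvdn modn_small.
  rewrite modn_small; last by lia.
  have [im|im] := ltnP (i + m) N.
    by rewrite /dvdn modn_small//; apply/eqP/eqP; lia.
  have -> : (i + m = (i + m - N) + N)%N by lia.
  by rewrite dvdn_addl// /dvdn modn_small; [apply/eqP/eqP; lia|lia].
under eq_bigr => i _ do rewrite e1 ?e2// mulrDr mulrDr.
rewrite big_split/=.
under eq_bigr => i _ do rewrite mulrA.
rewrite (sel _ (fun i => f i * 2^-1)) ?ltn_mod//.
under eq_bigr => i _ do rewrite mulrA.
rewrite (sel _ (fun i => f i * 2^-1))//.
have -> : f ((N - m) %% N)%N = f m.
  have [->|m0] := eqVneq m 0%N; first by rewrite subn0 modnn.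
  by rewrite modn_small; [apply: feven; lia|lia].
by field.
Qed.

End fixed_N.
End cosines.

(** * Exponential sums *)

Section autocorrelation.
Variable R : realType.

(* The number of pairs (k, k') in [0, n)^2 with k = k' + m modulo N. *)
Definition cyclic_diffs (N n m : nat) : nat := (n - m) + (n + m - N).

(** When n grows by one, the new pairs are (n, j) with j <= n, whose differences fill [0, n], and
    (k, n) with k < n, whose differences modulo N fill [N - n, N). *)
Lemma sum_cyclic_diffs (N n : nat) (F : nat -> R) : (n <= N)%N ->
  (forall i, F (i + N)%N = F i) ->
  \sum_(m < N) (cyclic_diffs N n m)%:R * F m = \sum_(k < n) \sum_(j < n) F (k + N - j)%N.
Proof.
move=> nN FN; elim: n nN => [|n IH] nN.
  rewrite big_ord0 big1// => m _; rewrite /cyclic_diffs sub0n add0n.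
  by rewrite (eqP (ltnW (ltn_ord m))) mul0r.
rewrite big_ord_recr/=.
under [in RHS]eq_bigr => k _ do rewrite big_ord_recr/=.
rewrite big_split/= -IH 1?ltnW// big_ord_recr/= -addrA.
have cycS m : (m < N)%N ->
    cyclic_diffs N n.+1 m = (cyclic_diffs N n m + ((m <= n)%N + (N - n <= m)%N))%N.
  by move=> mN; rewrite /cyclic_diffs; case: leqP; case: leqP; lia.
under eq_bigr => m _ do rewrite cycS// natrD mulrDl natrD mulrDl.
rewrite !big_split/=; congr (_ + _).
have cutl (g : nat -> R) q : (q <= N)%N ->
    \sum_(m < N) (m < q)%N%:R * g m = \sum_(m < q) g m.
  move=> qN; rewrite -(subnKC qN) big_split_ord/= [X in _ + X]big1 ?addr0.
    by apply: eq_bigr => i _; rewrite ltn_ord mul1r.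
  by move=> i _; rewrite ltnNge leq_addr mul0r.
have cutr (g : nat -> R) p q :
    \sum_(m < p + q) (p <= m)%N%:R * g m = \sum_(m < q) g (p + m)%N.
  rewrite big_split_ord/= [X in X + _]big1 ?add0r.
    by apply: eq_bigr => i _; rewrite leq_addr mul1r.
  by move=> i _; rewrite leqNgt ltn_ord mul0r.
have := cutr F (N - n)%N n; rewrite subnK ?(ltnW nN)// => ->.
rewrite (cutl F n.+1 nN) addrC; congr (_ + _).
  by apply: eq_bigr => k _; congr F; have := ltn_ord k; lia.
rewrite -(big_ord_recr n (idx := 0) (fun j : 'I_n.+1 => F (n + N - j)%N)).
rewrite (reindex_inj rev_ord_inj)/=; apply: eq_bigr => j _.
by rewrite -FN; congr F; have := ltn_ord j; lia.
Qed.

(* The squared modulus of the sum of exp(2 i k pi h / N) over k < n. *)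
Definition exp_sum_sqr (N n h : nat) : R :=
  (\sum_(k < n) cos (2 * k%:R * (pi * h%:R / N%:R))) ^+ 2 +
  (\sum_(k < n) sin (2 * k%:R * (pi * h%:R / N%:R))) ^+ 2.

Section fixed_N.
Variables (N : nat) (N_gt0 : (0 < N)%N).

Let N0 : N%:R != 0 :> R. Proof. by rewrite pnatr_eq0 -lt0n. Qed.

(** The autocorrelation of an interval transforms into the squared modulus of the transform of its
    indicator, which is the source of all positivity below. *)
Lemma sum_cyclic_diffs_cosm n h : (n <= N)%N ->
  \sum_(m < N) (cyclic_diffs N n m)%:R * cosm R N (h * m) = exp_sum_sqr N n h.
Proof.
move=> nN; rewrite (@sum_cyclic_diffs _ _ (fun m => cosm R N (h * m) : R))//; last first.
  by move=> i; rewrite mulnDr cosm_add_mul.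
rewrite /exp_sum_sqr !expr2 !mulr_suml -big_split/=; apply: eq_bigr => k _.
rewrite !mulr_sumr -big_split/=; apply: eq_bigr => j _.
rewrite -cosB /cosm -[RHS](cosD_nat2pi h); congr cos.
rewrite -addnBA; last by rewrite (leq_trans (ltnW (ltn_ord j))).
rewrite natrM natrD natrB; last by rewrite (leq_trans (ltnW (ltn_ord j))).
by field.
Qed.

Lemma exp_sum_sqr_ge0 n h : 0 <= exp_sum_sqr N n h.
Proof. by rewrite addr_ge0 ?sqr_ge0. Qed.

Lemma exp_sum_sqr_le_sqr n h : (n <= N)%N -> exp_sum_sqr N n h <= n%:R ^+ 2.
Proof.
move=> nN; rewrite -sum_cyclic_diffs_cosm//.
apply: (@le_trans _ _ (\sum_(m < N) (cyclic_diffs N n m)%:R * 1)).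
  by apply: ler_sum => m _; rewrite ler_wpM2l ?ler0n// cosm_le1.
rewrite (@sum_cyclic_diffs N n (fun=> 1))//.
under eq_bigr => k _ do rewrite sumr_const card_ord.
by rewrite sumr_const card_ord -[leLHS]mulr_natr expr2.
Qed.

Lemma exp_sum_sqr0 n : exp_sum_sqr N n 0 = n%:R ^+ 2.
Proof.
rewrite /exp_sum_sqr mulr0 mul0r.
under eq_bigr => k _ do rewrite mulr0 cos0.
under [X in _ + X ^+ 2]eq_bigr => k _ do rewrite mulr0 sin0.
by rewrite [X in _ + X ^+ 2]big1// sumr_const card_ord expr0n addr0.
Qed.

(** A crude form of Jordan's inequality: sin x = 2 sin (x / 2) cos (x / 2), and on [0, pi / 4] the
    cosine is at least 1 / 2, which bounds both the last factor and the mean value slope of the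
    sine. *)
Lemma sin_ge_quarter (x : R) : 0 <= x <= pi / 2 -> x / 4 <= sin x.
Proof.
move=> /andP[x0 xpi].
have x2 : x = (x / 2) *+ 2 by rewrite mulr2n; field.
have pi4 := @pihalf_lt2 R.
have cosge (y : R) : 0 <= y <= pi / 4 -> 2^-1 <= cos y.
  move=> /andP[y0 ypi].
  have c0 : 0 <= cos y.
    by apply: cos_ge0_pihalf; apply/andP; split; have := @pi_gt0 R; lra.
  have : 0 <= cos (y *+ 2).
    by apply: cos_ge0_pihalf; rewrite [y *+ 2]mulr2n; apply/andP; split; have := @pi_gt0 R; lra.
  by rewrite cos_mulr2n mulr2n; nra.
have x20 : 0 <= x / 2 by rewrite divr_ge0.
have [c cI] : exists2 c : R, c \in `[0, x / 2] &
    sin (x / 2) - sin 0 = cos c * (x / 2 - 0).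
  apply: MVT_segment => //.
  by apply: continuous_subspaceT => y; exact: continuous_sin.
rewrite sin0 !subr0 => sx.
move: cI; rewrite in_itv/= => /andP[c0 cx].
have cc : 2^-1 <= cos c by apply: cosge; apply/andP; split => //; lra.
have cx2 : 2^-1 <= cos (x / 2) by apply: cosge; apply/andP; split; lra.
rewrite [in leRHS]x2 sin_mulr2n sx [leRHS]mulr2n.
have ab : 4^-1 <= cos (x / 2) * cos c by nra.
by have := ler_wpM2r x20 ab; lra.
Qed.

(** At x = pi h / N the Dirichlet formulas give sin^2 x times the squared modulus as sin^2 (n x) <=
    1, and sin x >= g / (2 N), after reflecting x to pi - x when h > N / 2. *)
Lemma exp_sum_sqr_le_inv n h : (0 < h < N)%N ->
  exp_sum_sqr N n h <= 4 * N%:R ^+ 2 / (minn h (N - h))%:R ^+ 2.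
Proof.
move=> /andP[h0 hN].
have Ngt : 0 < N%:R :> R by rewrite ltr0n.
set x : R := pi * h%:R / N%:R; set g : nat := minn h (N - h).
have g0 : 0 < g%:R :> R by rewrite ltr0n /g; lia.
have sin_ge : g%:R / (2 * N%:R) <= sin x.
  have aux (y : R) : y = pi * g%:R / N%:R -> g%:R / (2 * N%:R) <= sin y.
    move=> ->; apply: le_trans (sin_ge_quarter _); last first.
      rewrite divr_ge0 ?mulr_ge0 ?pi_ge0//=.
      rewrite -mulrA ler_wpM2l ?pi_ge0// ler_pdivrMr// mulrC ler_pdivlMr// -natrM.
      by rewrite ler_nat /g; lia.
    have -> : g%:R / (2 * N%:R) = g%:R / N%:R * 2^-1 :> R by field.
    have -> : pi * g%:R / N%:R / 4 = g%:R / N%:R * (pi / 4) :> R by field.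
    rewrite ler_wpM2l ?divr_ge0//; have := @pi_ge2 R; lra.
  have [hg|hg] := leqP h (N - h).
    by apply: aux; rewrite /x /g (minn_idPl hg).
  have -> : sin x = sin (pi - x) by rewrite sinB sinpi cospi; ring.
  apply: aux; rewrite /x /g (minn_idPr (ltnW hg)) natrB; last by rewrite ltnW.
  by field.
have s0 : 0 < sin x by apply: lt_le_trans sin_ge; rewrite divr_gt0 ?mulr_gt0.
have : sin x ^+ 2 * exp_sum_sqr N n h <= 1.
  rewrite /exp_sum_sqr -/x mulrDr -!exprMn sin_sum_cos sin_sum_sin !exprMn -mulrDr.
  rewrite cos2Dsin2 mulr1 sin2cos2 gerBl sqr_ge0//.
rewrite -ler_pdivlMl ?exprn_gt0// mulr1 => /le_trans; apply.
have -> : 4 * N%:R ^+ 2 / g%:R ^+ 2 = ((g%:R / (2 * N%:R)) ^+ 2)^-1 :> R.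
  by field; rewrite N0 gt_eqF.
rewrite lef_pV2 ?posrE ?exprn_gt0 ?divr_gt0 ?mulr_gt0//.
by rewrite ler_sqr ?nnegrE ?(ltW s0)// divr_ge0 ?mulr_ge0.
Qed.

End fixed_N.
End autocorrelation.

(** * Autocovariance of an arc of the circle *)

Section dft_autoc.
Variable R : realType.

(* The covariance, on the circle R / Z, of the indicators of two arcs of length p
   that differ by a rotation by c; theta integrates it at p = Phi t. *)
Definition autoc (p c : R) : R :=
  Num.max (p - c) 0 + Num.max (p - 1 + c) 0 - p ^+ 2.

(** Complementary arcs have the same covariance. This lets p be replaced by 1 - p, so that both
    tails of the normal distribution are treated alike. *)
Lemma autoc_sym p c : autoc (1 - p) c = autoc p c.
Proof.
rewrite /autoc; have -> : 1 - p - 1 + c = c - p by ring.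
have -> : p - 1 + c = - (1 - p - c) by ring.
rewrite -[c - p]opprB.
have maxN (x : R) : Num.max (- x) 0 = Num.max x 0 - x.
  by case: (leP x 0) => x0; case: (leP (- x) 0); lra.
by rewrite !maxN; ring.
Qed.

Lemma autoc_refl p c : autoc p (1 - c) = autoc p c.
Proof.
rewrite /autoc; have -> : p - (1 - c) = p - 1 + c by ring.
have -> : p - 1 + (1 - c) = p - c by ring.
by congr (_ - _); exact: addrC.
Qed.

Lemma autoc_norm_le p c : 0 <= p <= 1 -> 0 <= c <= 1 -> `|autoc p c| <= p.
Proof.
move=> /andP[p0 p1] /andP[c0 c1]; rewrite /autoc ler_norml.
by case: (leP (p - c) 0) => h1; case: (leP (p - 1 + c) 0) => h2; apply/andP; split; nra.
Qed.

(* The distance from h to N Z, with the junk value 0 at h = 0 replaced by N. *)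
Definition cdist (N h : nat) : nat := if h == 0%N then N else minn h (N - h).

Lemma cdist_gt0 N h : (h < N)%N -> (0 < cdist N h)%N.
Proof. by rewrite /cdist; case: eqVneq; lia. Qed.

Lemma cdist_le N h : (h < N)%N -> (cdist N h <= N)%N.
Proof. by rewrite /cdist; case: eqVneq; lia. Qed.

Section fixed.
Variables (N : nat) (N_gt0 : (0 < N)%N) (p : R) (p01 : 0 < p < 1).

Let N0 : N%:R != 0 :> R. Proof. by rewrite pnatr_eq0 -lt0n. Qed.
Let Ngt : 0 < N%:R :> R. Proof. by rewrite ltr0n. Qed.

Let P : R := N%:R * p.
Let n : nat := Num.truncn P.
Let rho : R := P - n%:R.

Let P0 : 0 < P. Proof. by rewrite mulr_gt0//; case/andP: p01. Qed.

Let rho01 : 0 <= rho < 1.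
Proof.
rewrite /rho subr_ge0 ltrBlDl natr1 truncnS_gt andbT.
by rewrite truncn_le ltW.
Qed.

Let nN : (n < N)%N.
Proof.
rewrite -(ltr_nat R); apply: le_lt_trans (_ : P < _); first by rewrite truncn_le ltW.
by rewrite /P gtr_pMr//; case/andP: p01.
Qed.

(** As a function of N p the overlap of two arcs is linear between consecutive integers when the
    rotation is a multiple of 1 / N. It therefore interpolates, with weights 1 - rho and rho, the
    pair counts of intervals of n and n + 1 points. *)
Lemma autoc_cyc m : (m < N)%N -> autoc p (m%:R / N%:R) =
  ((1 - rho) * (cyclic_diffs N n m)%:R + rho * (cyclic_diffs N n.+1 m)%:R) / N%:R - p ^+ 2.
Proof.
move=> mN; rewrite /autoc; congr (_ - _).
apply: (mulIf N0); rewrite [RHS]divfK// mulrDl !maxr_pMl ?(ltW Ngt)// mul0r.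
have -> : (p - m%:R / N%:R) * N%:R = n%:R + rho - m%:R.
  by rewrite /rho /P; field.
have -> : (p - 1 + m%:R / N%:R) * N%:R = n%:R + rho - (N - m)%:R.
  by rewrite /rho /P natrB 1?ltnW//; field.
have trunc_max k : Num.max (n%:R + rho - k%:R) 0 =
    (1 - rho) * (n - k)%N%:R + rho * (n.+1 - k)%N%:R.
  have /andP[r0 r1] := rho01; have [kn|nk] := leqP k n.
    rewrite !natrB ?(leq_trans kn)// -natr1.
    have : k%:R <= n%:R :> R by rewrite ler_nat.
    by move=> ?; rewrite max_l; [ring|lra].
  have -> : (n - k = 0)%N by lia.
  have -> : (n.+1 - k = 0)%N by lia.
  have : n.+1%:R <= k%:R :> R by rewrite ler_nat.
  by rewrite -natr1 => ?; rewrite max_r; [ring|lra].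
rewrite !trunc_max /cyclic_diffs !natrD.
have -> : (n - (N - m) = n + m - N)%N by lia.
have -> : (n.+1 - (N - m) = n.+1 + m - N)%N by lia.
by ring.
Qed.

Lemma dft_autocE h : dft N (fun m => autoc p (m%:R / N%:R)) h =
  ((1 - rho) * exp_sum_sqr R N n h + rho * exp_sum_sqr R N n.+1 h) / N%:R ^+ 2
  - (if (N %| h)%N then p ^+ 2 else 0).
Proof.
rewrite /dft.
rewrite (eq_bigr (fun m : 'I_N => (1 - rho) / N%:R * ((cyclic_diffs N n m)%:R * cosm R N (h * m))
  + rho / N%:R * ((cyclic_diffs N n.+1 m)%:R * cosm R N (h * m)) - p ^+ 2 * cosm R N (m * h))).
  rewrite sumrB big_split/= -!mulr_sumr !sum_cyclic_diffs_cosm ?(ltnW nN)//.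
  by rewrite sum_cosm//; case: ifP => _; field.
by move=> m _; rewrite autoc_cyc// (mulnC m h); field.
Qed.

(** For h > 0 only squared moduli remain. At h = 0 the subtracted p^2 is the square of a mean, and
    the difference is the variance rho (1 - rho) divided by N^2. *)
Lemma dft_autoc_ge0 h : (h < N)%N ->
  0 <= dft N (fun m => autoc p (m%:R / N%:R)) h.
Proof.
move=> hN; have /andP[r0 r1] := rho01; rewrite dft_autocE.
have [->|h0] := eqVneq h 0%N.
  rewrite dvdn0 !exp_sum_sqr0 -natr1.
  have -> : p = (n%:R + rho) / N%:R by rewrite /rho /P; field.
  rewrite expr_div_n -mulrBl divr_ge0 ?exprn_ge0//.
  have -> : (1 - rho) * n%:R ^+ 2 + rho * (n%:R + 1) ^+ 2 - (n%:R + rho) ^+ 2 =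
    rho * (1 - rho) by ring.
  by rewrite mulr_ge0// subr_ge0 ltW.
rewrite gtnNdvd ?lt0n// subr0 divr_ge0 ?exprn_ge0 ?(ltW Ngt)//.
by rewrite addr_ge0// mulr_ge0 ?exp_sum_sqr_ge0// subr_ge0 ltW.
Qed.

(** The averaged squared modulus [G] is bounded by P^2 + Y and by Z = 4 N^2 / g^2; the interpolation
    (P^2)^eta Z^(1 - eta) yields the power of p and the decay in h at once. The constant 5 is 4 >=
    4^(1 - eta) from [Z] plus 1 from [Y]. *)
Lemma dft_autoc_le (eta : R) h : 0 < eta < 2^-1 -> (h < N)%N ->
  dft N (fun m => autoc p (m%:R / N%:R)) h <=
  5 * p `^ (2 * eta) * (cdist N h)%:R `^ (- (2 - 2 * eta)).
Proof.
move=> /andP[e0 e1] hN; have /andP[r0 r1] := rho01.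
have /andP[p0 p1] := p01.
set q : R := 2 - 2 * eta.
have q1 : 0 <= q by rewrite /q; lra.
(* P^2 and Y = rho (1 - rho) are the bias and variance parts of the squared
   length of an interval that is n or n + 1 long with mean length P *)
set Y := rho * (1 - rho).
(* For P <= 1 either n = 0, so that Y <= rho = P, or P = 1 and Y = 0; then P <= P^(2 eta) because 2
   eta < 1. For P > 1, Y <= 1 <= P^(2 eta). *)
have YP : Y <= P `^ (2 * eta).
  have [P1|P1] := leP P 1.
    apply: (@le_trans _ _ P); last by apply: ger1_powR; [rewrite P0|lra].
    have [n0|n0] := posnP n.
      rewrite /Y -[P](_ : rho = _); last by rewrite /rho n0 subr0.
      by rewrite ler_piMr//; lra.
    have : 1 <= P by apply: le_trans (_ : n%:R <= _); [rewrite ler1n|rewrite truncn_le ltW].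
    by rewrite /Y; nra.
  apply: (@le_trans _ _ 1); first by rewrite /Y; nra.
  apply: (@le_trans _ _ (1 `^ (2 * eta))); first by rewrite powR1.
  by apply: ge0_ler_powR; rewrite ?nnegrE ?(ltW P0) ?(ltW P1)//; lra.
have YN : Y / N%:R ^+ 2 <= p `^ (2 * eta) * N%:R `^ (- q).
  rewrite ler_pdivrMr ?exprn_gt0//; apply: le_trans YP _.
  rewrite /P powRM ?(ltW Ngt)// ?(ltW p0)// mulrC -mulrA ler_wpM2l ?powR_ge0//.
  rewrite -powR_mulrn ?(ltW Ngt)// -powRD; last by rewrite (gt_eqF Ngt) implybT.
  by rewrite /q; have -> : - (2 - 2 * eta) + 2 = 2 * eta by ring.
have Nd : N%:R `^ (- q) <= (cdist N h)%:R `^ (- q) :> R.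
  rewrite !powRN lef_pV2 ?posrE ?powR_gt0 ?ltr0n ?cdist_gt0//.
  by apply: ge0_ler_powR; rewrite ?nnegrE ?ler0n// ler_nat cdist_le.
have mean : (1 - rho) * n%:R ^+ 2 + rho * n.+1%:R ^+ 2 = P ^+ 2 + Y.
  by rewrite -natr1 /Y /rho; ring.
have pe0 := powR_ge0 p (2 * eta).
rewrite dft_autocE; have [h0|h0] := eqVneq h 0%N.
  rewrite h0 dvdn0 !exp_sum_sqr0 mean mulrDl.
  have -> : P ^+ 2 / N%:R ^+ 2 = p ^+ 2 by rewrite /P; field.
  rewrite addrC addKr; apply: le_trans YN _.
  rewrite /cdist/= -mulrA ler_peMl ?mulr_ge0 ?powR_ge0//; lra.
rewrite gtnNdvd ?lt0n// subr0; rewrite /cdist (negbTE h0) in Nd *.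
have hh : (0 < h < N)%N by rewrite lt0n h0.
set g := (minn h (N - h))%:R in Nd *.
have g0 : 0 < g by rewrite /g ltr0n; lia.
set G := (1 - rho) * _ + _.
set Z := 4 * N%:R ^+ 2 / g ^+ 2.
have Z0 : 0 < Z by rewrite divr_gt0 ?mulr_gt0 ?exprn_gt0.
have GZ : G <= Z.
  have a1 := exp_sum_sqr_le_inv R N_gt0 n hh; have a2 := exp_sum_sqr_le_inv R N_gt0 n.+1 hh.
  by rewrite /G /Z /g; nra.
have GP : G <= P ^+ 2 + Y.
  rewrite -mean lerD// ler_wpM2l ?exp_sum_sqr_le_sqr ?(ltnW nN)//; lra.
have e1e : 0 <= 1 - eta by lra.
have P20 : 0 < P ^+ 2 by rewrite exprn_gt0.
have GI : G <= (P ^+ 2) `^ eta * Z `^ (1 - eta) + Y.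
  have spl (x : R) : 0 < x -> x = x `^ eta * x `^ (1 - eta).
    move=> x0; rewrite -powRD; last by rewrite (gt_eqF x0) implybT.
    by rewrite addrC subrK powRr1// ltW.
  have Y0 : 0 <= Y by rewrite mulr_ge0// subr_ge0 ltW.
  have [PZ|PZ] := leP (P ^+ 2) Z.
    apply: le_trans GP _; rewrite lerD2r [leLHS]spl// ler_wpM2l ?powR_ge0//.
    by apply: ge0_ler_powR; rewrite ?nnegrE ?(ltW P20) ?(ltW Z0).
  apply: (@le_trans _ _ Z) => //; apply: ler_wpDr => //.
  rewrite [leLHS]spl// ler_wpM2r ?powR_ge0//.
  by apply: ge0_ler_powR; rewrite ?nnegrE ?(ltW P20) ?(ltW Z0) ?(ltW e0)// ltW.
apply: (@le_trans _ _ (((P ^+ 2) `^ eta * Z `^ (1 - eta) + Y) / N%:R ^+ 2)).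
  by rewrite ler_wpM2r// invr_ge0 exprn_ge0// ltW.
rewrite mulrDl.
have -> : 5 * p `^ (2 * eta) * g `^ (- q) =
  4 * p `^ (2 * eta) * g `^ (- q) + p `^ (2 * eta) * g `^ (- q) by ring.
apply: lerD; last by apply: le_trans YN _; rewrite ler_wpM2l.
rewrite -!powR_mulrn ?(ltW P0) ?(ltW Ngt)// -powRrM.
rewrite /P powRM ?(ltW Ngt) ?(ltW p0)//.
have -> : Z `^ (1 - eta) = 4 `^ (1 - eta) * N%:R `^ q * g `^ (- q).
  rewrite /Z powRM ?mulr_ge0 ?invr_ge0 ?exprn_ge0 ?(ltW Ngt) ?(ltW g0)//.
  rewrite powRM ?exprn_ge0 ?(ltW Ngt)//.
  rewrite -!powR_mulrn ?(ltW g0) ?(ltW Ngt)// -powRN -!powRrM.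
  by rewrite /q; congr (_ * _ `^ _ * _ `^ _); ring.
have four : 4 `^ (1 - eta) <= 4 :> R.
  by rewrite -[leRHS](powRr1 (ler0n _ 4)) ler_powR ?ler1n//; lra.
have Nc : N%:R `^ (2 * eta) * N%:R `^ q / N%:R `^ 2 = 1 :> R.
  rewrite -powRD; last by rewrite (gt_eqF Ngt) implybT.
  by rewrite /q addrC subrK divff// gt_eqF// powR_gt0.
rewrite [leLHS](_ : _ = (N%:R `^ (2 * eta) * N%:R `^ q / N%:R `^ 2) *
  (4 `^ (1 - eta) * p `^ (2 * eta) * g `^ (- q))); last by ring.
by rewrite Nc mul1r ler_wpM2r ?powR_ge0// ler_wpM2r.
Qed.

End fixed.
End dft_autoc.

(** * Sums over residues *)

Section counting.
Variable R : realType.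

(** Each nonzero residue is at distance h or N - h from N Z, so two copies of the zeta sum
    suffice. *)
Lemma sum_cdist_le (N : nat) (k : R) : 1 < k ->
  \sum_(h < N | h != 0%N :> nat) (cdist N h)%:R `^ (- k) <= 2 * (k / (k - 1)).
Proof.
move=> k1; case: N => [|N]; first by rewrite big_ord0 mulr_ge0// divr_ge0//; lra.
have -> : 2 * (k / (k - 1)) = k / (k - 1) + k / (k - 1) by ring.
apply: le_trans (lerD (sum_powRN_le N k1) (sum_powRN_le N k1)).
rewrite big_mkcond big_ord_recl/= add0r.
rewrite [X in _ <= _ + X](reindex_inj rev_ord_inj)/= -big_split/=.
apply: ler_sum => i _; rewrite /cdist/= /bump/= add1n.
have -> : (N.+1 - i.+1 = (N - i.+1).+1)%N by have := ltn_ord i; lia.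
case: (leqP i.+1 (N - i.+1).+1) => hi.
  by rewrite lerDl powR_ge0.
by rewrite lerDr powR_ge0.
Qed.

(** The multiples of g in Z / N form a copy of Z / (N / g) with distances scaled by g, and g g^(-k)
    <= 1. The factor g in front is the number of solutions that a congruence with this gcd can
    have. *)
Lemma sum_multiples_le (N g : nat) (k : R) : 1 < k -> (g %| N)%N -> (0 < N)%N ->
  g%:R * \sum_(h < N | (h != 0%N :> nat) && (g %| h)%N) (cdist N h)%:R `^ (- k)
    <= 2 * (k / (k - 1)).
Proof.
move=> k1 /dvdnP[N' ->]; rewrite muln_gt0 => /andP[N'0 g0].
apply: le_trans (sum_cdist_le N' k1).
have lt_ig (i : 'I_N') : (i * g < N' * g)%N by rewrite ltn_pmul2r.
have lt_di (i : 'I_(N' * g)) : (i %/ g < N')%N by rewrite ltn_divLR.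
rewrite (reindex_onto (fun i => Ordinal (lt_ig i)) (fun i => Ordinal (lt_di i))); last first.
  by move=> i /andP[_ gi]; apply/val_inj; rewrite /= divnK.
rewrite mulr_sumr [leLHS](eq_bigl (fun i : 'I_N' => i != 0%N :> nat)); last first.
  move=> i /=; rewrite dvdn_mull// andbT muln_eq0 negb_or -lt0n -lt0n g0 andbT.
  by rewrite -val_eqE/= mulnK// eqxx andbT.
apply: ler_sum => i i0; rewrite /cdist/= muln_eq0 (negbTE i0) gtn_eqF//=.
rewrite -mulnBl -minnMl natrM powRM// mulrCA ler_piMr ?powR_ge0//.
have g1 : 1 <= g%:R :> R by rewrite ler1n.
rewrite -[X in X * _]powRr1 ?ler0n// -powRD; last by rewrite pnatr_eq0 gtn_eqF// implybT.
by rewrite -[leRHS](powRr0 g%:R) ler_powR//; lra.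
Qed.

(** Two solutions differ by a multiple of N / g, so a solution is determined by its quotient by N /
    g, which takes at most g values. *)
Lemma count_linear_congr (N h r : nat) : (0 < N)%N ->
  (\sum_(c < N) (h * c == r %[mod N]) <= gcdn h N)%N.
Proof.
move=> N0; set g := gcdn h N.
have g0 : (0 < g)%N by rewrite gcdn_gt0 N0 orbT.
have gN : (N %/ g * g = N)%N by rewrite divnK// dvdn_gcdr.
have M0 : (0 < N %/ g)%N by rewrite divn_gt0// dvdn_leq// dvdn_gcdr.
rewrite -big_mkcond/= sum1_card.
have lt_cg (c : 'I_N) : (c %/ (N %/ g) < g)%N by rewrite ltn_divLR// mulnC gN.
rewrite -[leqRHS]card_ord.
apply: (@leq_card_in _ _ (fun c => Ordinal (lt_cg c))) => c c' /=.
rewrite !unfold_in => /eqP hc /eqP hc' [cc'].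
have le_case (a b : 'I_N) : (a <= b)%N -> (h * a = r %[mod N])%N ->
    (h * b = r %[mod N])%N -> (a %/ (N %/ g) = b %/ (N %/ g))%N -> a = b.
  move=> ab ha hb qab; apply/val_inj => /=.
  have : (N %| h * (b - a))%N.
    by rewrite mulnBr -eqn_mod_dvd ?leq_mul//; apply/eqP; rewrite ha hb.
  have -> : (h = h %/ g * g)%N by rewrite divnK// dvdn_gcdl.
  rewrite -{1}gN mulnAC dvdn_pmul2r// Gauss_dvdr.
    rewrite -eqn_mod_dvd// => /eqP mab.
    by rewrite (divn_eq a (N %/ g)) (divn_eq b (N %/ g)) qab mab.
  rewrite coprime_sym /coprime -(eqn_pmul2r g0) mul1n muln_gcdl gN divnK ?dvdn_gcdl//.
have [le|/ltnW le] := leqP c c'; first exact: le_case le hc hc' cc'.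
by apply/esym; apply: le_case le hc' hc (esym cc').
Qed.

(** For a unit c the congruence forces gcd (h, N) = gcd (r, N) = g. So h is a multiple of g and is
    hit by at most g values of c, and the sparsity of such h pays for this multiplicity. The
    frequency h = 0 may be hit N times; the value N of [cdist] at 0 compensates and accounts for the
    summand 1. *)
Lemma sum_unit_congr_le (N r : nat) (b : nat -> R) (k D : R) : (0 < N)%N -> 1 < k ->
  (forall h, (h < N)%N -> 0 <= b h <= D * (cdist N h)%:R `^ (- k)) ->
  \sum_(c < N | coprime c N) \sum_(h < N) b h * (h * c == r %[mod N])%N%:R
    <= D * (1 + 2 * (k / (k - 1))).
Proof.
move=> N0 k1 bD; rewrite exchange_big/=.
have D0 : 0 <= D.
  have /andP[b0 bd] := bD _ N0; have := le_trans b0 bd.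
  by rewrite pmulr_lge0// powR_gt0// ltr0n cdist_gt0.
set g := gcdn r N.
have gh (h c : nat) : coprime c N -> (h * c == r %[mod N])%N -> gcdn h N = g.
  move=> cN /eqP e; rewrite /g -(gcdn_modl r) -e gcdn_modl.
  by rewrite [RHS]gcdnC Gauss_gcdl; [exact: gcdnC|rewrite coprime_sym].
have inner (h : 'I_N) : \sum_(c < N | coprime c N) b h * (h * c == r %[mod N])%N%:R
    <= b h * (if gcdn h N == g then g%:R else 0).
  have /andP[b0 _] := bD h (ltn_ord h).
  rewrite -mulr_sumr ler_wpM2l//.
  case: eqP => [<-|hg].
    rewrite -natr_sum ler_nat; apply: leq_trans (count_linear_congr h r N0).
    by rewrite [leqRHS](bigID (fun c : 'I_N => coprime c N))/= leq_addr.
  rewrite big1// => c cN; case: eqP => // /eqP /(gh _ _ cN) //.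
apply: le_trans (ler_sum _ (fun h _ => inner h)) _.
rewrite (bigD1 (Ordinal N0))//= mulrDr mulr1; apply: lerD.
  have /andP[b0 bd] := bD _ N0; apply: (@le_trans _ _ (b 0%N * N%:R)).
    by rewrite ler_wpM2l//; case: ifP => // _; rewrite ler_nat dvdn_leq// dvdn_gcdr.
  apply: le_trans (ler_wpM2r (ler0n _ _) bd) _; rewrite -mulrA ler_piMr// /cdist eqxx.
  have N1 : 1 <= N%:R :> R by rewrite ler1n.
  rewrite -[X in _ * X]powRr1 ?ler0n// -powRD; last by rewrite pnatr_eq0 gtn_eqF// implybT.
  by rewrite -[leRHS](powRr0 N%:R) ler_powR//; lra.
apply: le_trans (ler_wpM2l D0 (sum_multiples_le k1 (dvdn_gcdr r N) N0)).
rewrite -/g !mulr_sumr big_mkcond [leRHS]big_mkcond/=; apply: ler_sum => h _.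
rewrite -val_eqE/=; case: eqVneq => //= h0.
have /andP[b0 bd] := bD h (ltn_ord h).
case: eqP => [e|_]; last first.
  by rewrite mulr0; case: ifP => // _; rewrite !mulr_ge0 ?powR_ge0.
by rewrite -e dvdn_gcdl e mulrCA mulrC ler_wpM2l.
Qed.

End counting.

(** * Component-by-component construction *)

Section component_by_component.
Variables (R : realType) (N : nat) (N_gt0 : (0 < N)%N).
Variables (ah : nat -> R) (tau A lam : R).
Hypothesis ah_bd : forall h, (h < N)%N ->
  0 <= ah h <= A * (cdist N h)%:R `^ (- tau).
Hypothesis lam01 : 0 < lam <= 1.
Hypothesis lamtau : 1 < tau * lam.

Definition theta_grid (m : nat) : R := \sum_(h < N) ah h * cosm R N (h * m).

(** Bounds the sum of the lam-powers of all coefficients and also, by [sum_unit_congr_le], their sum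
    over the solutions of one congruence with c ranging over the units. *)
Let S : R := A `^ lam * (1 + 2 * (tau * lam / (tau * lam - 1))).

Let N0 : N%:R != 0 :> R. Proof. by rewrite pnatr_eq0 -lt0n. Qed.

Let A_ge0 : 0 <= A.
Proof.
have /andP[b0 bd] := ah_bd N_gt0; have := le_trans b0 bd.
by rewrite pmulr_lge0// powR_gt0// ltr0n cdist_gt0.
Qed.

Let ah_ge0 h : (h < N)%N -> 0 <= ah h. Proof. by move=> /ah_bd/andP[]. Qed.

Let ahl_bd h : (h < N)%N ->
  0 <= ah h `^ lam <= A `^ lam * (cdist N h)%:R `^ (- (tau * lam)).
Proof.
move=> hN; have /andP[b0 bd] := ah_bd hN; rewrite powR_ge0/=.
rewrite -mulNr powRrM -powRM ?powR_ge0//; apply: ge0_ler_powR => //.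
- by case/andP: lam01 => /ltW.
- by rewrite nnegrE mulr_ge0 ?powR_ge0.
Qed.

Let sum_ahl : \sum_(h < N) ah h `^ lam <= S.
Proof.
rewrite /S mulrDr mulr1.
rewrite (bigD1 (Ordinal N_gt0))//=; apply: lerD.
  have /andP[_ le0] := ahl_bd N_gt0; apply: le_trans le0 _.
  rewrite ler_piMr ?powR_ge0// /cdist eqxx.
  rewrite -[leRHS](powRr0 N%:R) ler_powR ?ler1n//; move: lamtau; lra.
apply: le_trans (ler_wpM2l (powR_ge0 _ _) (sum_cdist_le N lamtau)).
rewrite mulr_sumr; apply: ler_sum => h _.
by have /andP[] := ahl_bd (ltn_ord h).
Qed.

Let S_ge0 : 0 <= S.
Proof. by apply: le_trans sum_ahl; apply: sumr_ge0 => h _; exact: powR_ge0. Qed.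

(** Products of nonnegative cosine polynomials are again such, by the product-to-sum formula. Each
    factor multiplies the sum of lam-powers by at most the sum for [ah], and by 2 because every
    product of cosines splits in two; the bound does not depend on the components [js]. *)
Lemma prod_theta_grid (js : seq nat) : exists (I : finType) (w : I -> R) (r : I -> nat),
  [/\ forall i, 0 <= w i,
      forall k, \prod_(j <- js) theta_grid (k * j) = \sum_i w i * cosm R N (k * r i) &
      \sum_i w i `^ lam <= (2 * S) ^+ size js].
Proof.
elim: js => [|j js [I [w [r [w0 wr ws]]]]].
  exists unit, (fun=> 1), (fun=> 0%N); split => // [k|].
    by rewrite big_nil big_const card_unit/= muln0 cosm0 mulr1 addr0.
  by rewrite big_const card_unit/= powR1 addr0.
pose J : finType := (I * 'I_N * bool)%type.
exists J, (fun x : I * 'I_N * bool => w x.1.1 * ah x.1.2 / 2),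
  (fun x : I * 'I_N * bool => if x.2 then (x.1.2 * j + r x.1.1)%N else (x.1.2 * j + N.-1 * r x.1.1)%N).
have pairs (F : J -> R) : \sum_x F x =
    \sum_i \sum_(h < N) (F (i, h, true) + F (i, h, false)).
  rewrite pair_bigA/=.
  under [RHS]eq_bigr => p _ do
    rewrite -(big_bool _ (fun b => F (p.1, p.2, b))).
  by rewrite pair_bigA/=; apply: eq_bigr => -[[i h] b].
split.
- by move=> [[i h] b] /=; rewrite divr_ge0 ?mulr_ge0 ?w0 ?ah_ge0.
- move=> k; rewrite big_cons wr mulrC pairs mulr_suml; apply: eq_bigr => i _.
  rewrite /theta_grid mulr_sumr; apply: eq_bigr => h _ /=.
  have := cosm_mul R N_gt0 (h * (k * j)) (k * r i) => cc.
  have -> : (k * (h * j + r i) = h * (k * j) + k * r i)%N by ring.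
  have -> : (k * (h * j + N.-1 * r i) = h * (k * j) + N.-1 * (k * r i))%N by ring.
  rewrite [LHS](_ : _ = w i * ah h * (cosm R N (h * (k * j)) * cosm R N (k * r i))).
    by rewrite cc; field.
  by ring.
- rewrite pairs/= exprS.
  apply: (@le_trans _ _ (\sum_i \sum_(h < N) 2 * (ah h `^ lam * w i `^ lam))).
    apply: ler_sum => i _; apply: ler_sum => h _.
    have : (w i * ah h / 2) `^ lam <= ah h `^ lam * w i `^ lam.
      rewrite -powRM ?ah_ge0// mulrC mulrA; apply: ge0_ler_powR.
      - by case/andP: lam01 => /ltW.
      - by rewrite nnegrE !mulr_ge0 ?ah_ge0.
      - by rewrite nnegrE mulr_ge0 ?ah_ge0.
      - have := mulr_ge0 (ah_ge0 (ltn_ord h)) (w0 i); lra.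
    lra.
  under eq_bigr => i _ do rewrite -mulr_sumr -mulr_suml.
  rewrite -mulr_sumr -mulr_sumr -mulrA ler_wpM2l// ler_pM//.
  + by apply: sumr_ge0 => h _; exact: powR_ge0.
  + by apply: sumr_ge0 => h _; exact: powR_ge0.
Qed.

(** With [js] the components of z indexed by u, this is the u-term of the squared error criterion
    divided by its weight; see [eshE]. *)
Definition grid_mean (js : seq nat) : R :=
  N%:R^-1 * \sum_(k < N) \prod_(j <- js) theta_grid (k * j).

Let dvd_addl x r : (N %| x + r)%N = (x == N.-1 * r %[mod N])%N.
Proof.
rewrite -(eqn_modDr r) -mulSnr prednK// modnMr.
by [].
Qed.

Let dvd_addr x r : (N %| x + N.-1 * r)%N = (x == r %[mod N])%N.
Proof.
by rewrite -(eqn_modDr (N.-1 * r)) -mulSn prednK// modnMr.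
Qed.

(** Averaging over k keeps only the frequencies in the dual lattice, here h c = r or h c = -r modulo
    N. The dependence on the new component c is thereby reduced to congruences that can be
    counted. *)
Lemma grid_mean_cons (js : seq nat) : exists (I : finType) (w : I -> R) (r r' : I -> nat),
  [/\ forall i, 0 <= w i,
      forall c, grid_mean (c :: js) = \sum_i \sum_(h < N) w i * ah h / 2 *
         ((h * c == r i %[mod N])%N%:R + (h * c == r' i %[mod N])%N%:R)  &
      \sum_i w i `^ lam <= (2 * S) ^+ size js].
Proof.
have [I [w [r [w0 wr ws]]]] := prod_theta_grid js.
exists I, w, r, (fun i => N.-1 * r i)%N; split => // c; rewrite /grid_mean.
under eq_bigr => k _ do rewrite big_cons wr mulrC mulr_suml.
rewrite exchange_big/= mulr_sumr; apply: eq_bigr => i _.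
under eq_bigr => k _ do rewrite /theta_grid mulr_sumr.
rewrite exchange_big/= mulr_sumr; apply: eq_bigr => h _.
rewrite (eq_bigr (fun k : 'I_N => w i * ah h / 2 * (cosm R N (k * (h * c + N.-1 * r i)) +
    cosm R N (k * (h * c + r i))))).
  rewrite -mulr_sumr big_split/= !sum_cosm// dvd_addr dvd_addl.
  by case: ifP; case: ifP => _ _ /=; field.
move=> k _; have cc := cosm_mul R N_gt0 (h * (k * c)) (k * r i).
have -> : (k * (h * c + r i) = h * (k * c) + k * r i)%N by ring.
have -> : (k * (h * c + N.-1 * r i) = h * (k * c) + N.-1 * (k * r i))%N by ring.
rewrite [LHS](_ : _ = w i * ah h * (cosm R N (h * (k * c)) * cosm R N (k * r i))).
  by rewrite cc; field.
by ring.
Qed.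

Lemma grid_mean_ge0 js : 0 <= grid_mean js.
Proof.
case: js => [|c js].
  rewrite /grid_mean mulr_ge0 ?invr_ge0//; apply: sumr_ge0 => k _.
  by rewrite big_nil.
have [I [w [r [r' [w0 -> _]]]]] := grid_mean_cons js.
apply: sumr_ge0 => i _; apply: sumr_ge0 => h _.
by rewrite !mulr_ge0 ?invr_ge0 ?w0 ?ah_ge0 ?addr_ge0.
Qed.

(** The right-hand side does not depend on N, so the mean over the totient N units is of order 1 /
    totient N. The lam-power is taken inside the sum first, so that the decay of the coefficients is
    used with exponent tau lam > 1. *)
Lemma grid_mean_average js :
  \sum_(c < N | coprime c N) grid_mean (val c :: js) `^ lam <= (2 * S) ^+ (size js).+1.
Proof.
have [I [w [r [r' [w0 gE ws]]]]] := grid_mean_cons js.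
have [l0 l1] := andP lam01.
apply: (@le_trans _ _ (\sum_(c < N | coprime c N) \sum_i w i `^ lam *
    (\sum_(h < N) ah h `^ lam * (h * c == r i %[mod N])%N%:R +
     \sum_(h < N) ah h `^ lam * (h * c == r' i %[mod N])%N%:R))).
  apply: ler_sum => c _; rewrite gE; apply: le_trans.
    apply: (powR_sum_le _ lam01) => i _; apply: sumr_ge0 => h _.
    by rewrite !mulr_ge0 ?invr_ge0 ?w0 ?ah_ge0 ?addr_ge0.
  apply: ler_sum => i _; apply: le_trans.
    apply: (powR_sum_le _ lam01) => h _.
    by rewrite !mulr_ge0 ?invr_ge0 ?w0 ?ah_ge0 ?addr_ge0.
  rewrite -big_split/= mulr_sumr; apply: ler_sum => h _.
  have wa0 := mulr_ge0 (w0 i) (ah_ge0 (ltn_ord h)).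
  rewrite -mulrDr mulrA -powRM ?ah_ge0//.
  have half : (w i * ah h / 2) `^ lam <= (w i * ah h) `^ lam.
    by apply: ge0_ler_powR; rewrite ?nnegrE ?divr_ge0// ?(ltW l0)//; lra.
  have p0 := powR_ge0 (w i * ah h) lam.
  case: eqP => _; case: eqP => _ /=; rewrite ?(addr0, add0r, mulr1, mulr0)//.
    rewrite (_ : w i * ah h / 2 * (1 + 1) = w i * ah h); last by field.
    by rewrite ler_peMr//; lra.
  by rewrite powR0// gt_eqF.
rewrite exchange_big/= exprSr.
apply: (@le_trans _ _ (\sum_i w i `^ lam * (2 * S))); last first.
  by rewrite -mulr_suml ler_wpM2r// mulr_ge0.
apply: ler_sum => i _; rewrite -mulr_sumr ler_wpM2l ?powR_ge0// big_split/=.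
have -> : 2 * S = S + S by ring.
by apply: lerD; exact: (@sum_unit_congr_le R N _ (fun h => ah h `^ lam) _ _ N_gt0 lamtau ahl_bd).
Qed.

(** Multiplication by a unit permutes Z / N, so all candidates for the first component tie and the
    prescribed choice 1 is a minimizer. *)
Lemma grid_mean1 c : coprime c N -> grid_mean [:: c] = ah 0.
Proof.
move=> cN; rewrite /grid_mean.
under eq_bigr => k _ do rewrite big_seq1 /theta_grid.
rewrite exchange_big/= mulr_sumr (bigD1 (Ordinal N_gt0))//= [X in _ + X]big1 ?addr0.
  under eq_bigr => k _ do rewrite mul0n cosm0 mulr1.
  by rewrite sumr_const card_ord -[ah 0%N *+ N]mulr_natl mulrA mulVf ?mul1r.
move=> h; rewrite -val_eqE/= => h0.
under eq_bigr => k _ do rewrite mulnCA.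
rewrite -mulr_sumr sum_cosm// Gauss_dvdl 1?coprime_sym//.
by rewrite gtnNdvd ?lt0n// !mulr0.
Qed.

End component_by_component.

Section fractional_part.
Variable R : realType.
Implicit Types x : R.

Lemma frac_id x : 0 <= x < 1 -> Defs.frac x = x.
Proof.
move=> /andP[x0 x1]; rewrite /Defs.frac (_ : Num.floor x = 0) ?subr0//.
by apply: floor_def; rewrite x0.
Qed.

Lemma fracDn x n : Defs.frac (x + n%:R) = Defs.frac x.
Proof.
have nZ : n%:R = (n : int)%:~R :> R by [].
by rewrite /Defs.frac nZ floorDrz ?rpred_int// rmorphD/= intrKfloor; ring.
Qed.

Lemma frac_ratio (N m : nat) : (0 < N)%N ->
  Defs.frac (m%:R / N%:R) = (m %% N)%:R / N%:R :> R.
Proof.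
move=> N0; have Nn : N%:R != 0 :> R by rewrite pnatr_eq0 -lt0n.
rewrite {1}(divn_eq m N) natrD natrM mulrDl mulfK// addrC fracDn frac_id//.
by rewrite divr_ge0//= ltr_pdivrMr ?ltr0n// mul1r ltr_nat ltn_mod.
Qed.

End fractional_part.

Section update.
Variables (s : nat) (T : Type).
Implicit Types z : s.-tuple T.

Lemma tnth_upd z j t i : tnth (upd z j t) i = if i == j then t else tnth z i.
Proof. by rewrite tnth_mktuple. Qed.

Lemma upd_tnth z j : upd z j (tnth z j) = z.
Proof. by apply: eq_from_tnth => i; rewrite tnth_upd; case: eqP => [->|]. Qed.

Lemma upd_upd z j t t' : upd (upd z j t) j t' = upd z j t'.
Proof. by apply: eq_from_tnth => i; rewrite !tnth_upd; case: eqP. Qed.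

End update.

(** * Existence and error bound of the vectors built component by component *)

Section cbc_vectors.
Variables (R : realType) (s : nat) (gamma : {set 'I_s} -> R) (psi : R -> R).
Variables (N : nat) (N_gt0 : (0 < N)%N).

Lemma eq_esh d (z z' : s.-tuple nat) :
  (forall i : 'I_s, (i < d)%N -> tnth z i = tnth z' i) ->
  esh gamma psi N d z = esh gamma psi N d z'.
Proof.
move=> zz'; rewrite /esh; congr Num.sqrt; apply: eq_bigr => u /andP[_ /forall_inP ud].
by congr (_ * _); apply: eq_bigr => k _; apply: eq_bigr => j /ud jd; rewrite zz'.
Qed.

(** Choosing a further component cannot disturb the earlier minimality conditions, because [esh] at
    stage d reads only the first d components. *)
Lemma cbc_vector_exists : exists z, cbc_vector gamma psi N z.
Proof.
pose good (z : s.-tuple nat) (j : 'I_s) :=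
  ((nat_of_ord j = 0 -> tnth z j = 1) /\
  ((0 < j)%N -> [/\ (tnth z j < N)%N, coprime (tnth z j) N &
    forall c : nat, (c < N)%N -> coprime c N ->
      (esh gamma psi N j.+1 z <= esh gamma psi N j.+1 (upd z j c))%R]))%N.
suff [z zP] : exists z, forall j : 'I_s, (j < s)%N -> good z j.
  by exists z; split=> j; have [] := zP j (ltn_ord j).
suff H d : (d <= s)%N -> exists z, forall j : 'I_s, (j < d)%N -> good z j by exact: H.
elim: d => [_|d IH ds]; first by exists [tuple of nseq s 0%N] => j.
have [z zP] := IH (ltnW ds); pose j0 := Ordinal ds.
have keep c (j : 'I_s) : (j < d)%N -> good z j -> good (upd z j0 c) j.
  move=> jd [h0 h1]; have jj0 : (j == j0) = false by apply/eqP => e; rewrite e ltnn in jd.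
  rewrite /good tnth_upd jj0; split => // /h1 [a1 a2 a3]; split=> // c' cN cc.
  rewrite (@eq_esh _ _ z); last first.
    by move=> i ij; rewrite tnth_upd; case: eqP => // e; move: ij; rewrite e/=; lia.
  rewrite [leRHS](@eq_esh _ _ (upd z j c')); first exact: a3.
  move=> i ij; rewrite !tnth_upd; case: eqP => // _; case: eqP => // e.
  by move: ij; rewrite e/=; lia.
have [d0|d0] := posnP d.
  exists (upd z j0 1%N) => j; rewrite ltnS leq_eqVlt => /orP[/eqP jd|jd].
    have -> : j = j0 by apply/val_inj.
    by split => /=; [rewrite tnth_upd eqxx|rewrite d0].
  exact/keep/zP.
(* The residue rather than 1 itself: for N = 1 the only candidate is 0, which is coprime to 1. *)
have c0N : (1 %% N < N)%N by rewrite ltn_mod.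
have c0c : coprime (Ordinal c0N) N by rewrite /= coprime_modl coprime1n.
pose F (c : 'I_N) := esh gamma psi N d.+1 (upd z j0 c).
have [c cc cmin] := @arg_minP _ R 'I_N (Ordinal c0N) (fun c => coprime c N) F c0c.
exists (upd z j0 c) => j; rewrite ltnS leq_eqVlt => /orP[/eqP jd|jd]; last exact/keep/zP.
have -> : j = j0 by apply/val_inj.
split => /=; first by move=> e; rewrite e in d0.
move=> _; split; rewrite ?tnth_upd ?eqxx// => c' cN c'c.
by rewrite upd_upd; exact: (cmin (Ordinal cN)).
Qed.

Hypothesis gamma_gt0 : forall u, 0 < gamma u.
Hypothesis theta_refl : forall c, theta psi (1 - c) = theta psi c.
Variables (tau A lam : R).
Local Notation ah := (dft N (fun m => theta psi (m%:R / N%:R))).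
Hypothesis ah_bd : forall h, (h < N)%N ->
  0 <= ah h <= A * (cdist N h)%:R `^ (- tau).
Hypothesis lam01 : 0 < lam <= 1.
Hypothesis lamtau : 1 < tau * lam.

Let K : R := \sum_(u : {set 'I_s}) gamma u `^ lam *
  (2 * (A `^ lam * (1 + 2 * (tau * lam / (tau * lam - 1))))) ^+ #|u|.

Lemma theta_gridE m : theta psi (Defs.frac (m%:R / N%:R)) = theta_grid N ah m.
Proof.
rewrite frac_ratio// /theta_grid.
rewrite (@dft_inversion R N N_gt0 (fun m => theta psi (m%:R / N%:R))) ?ltn_mod//.
  by apply: eq_bigr => h _; rewrite -cosm_modn// modnMmr cosm_modn.
move=> i /andP[i0 iN]; rewrite -theta_refl; congr theta.
rewrite natrB ?(ltnW iN)//; field.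
by rewrite pnatr_eq0 -lt0n.
Qed.

Definition esh_sqr d (z : s.-tuple nat) : R :=
  \sum_(u : {set 'I_s} | (u != finset.set0) && [forall i in u, (i < d)%N])
    gamma u * grid_mean N ah [seq tnth z j | j <- enum u].

Lemma eshE d z : esh gamma psi N d z = Num.sqrt (esh_sqr d z).
Proof.
rewrite /esh /esh_sqr; congr Num.sqrt; apply: eq_bigr => u _.
rewrite /grid_mean -mulrA; congr (_ * (_ * _)); apply: eq_bigr => k _.
rewrite big_map big_enum/=; apply: eq_bigr => j _.
by rewrite -natrM theta_gridE.
Qed.

(** The sets containing j: the only part of the criterion at this stage that depends on the
    candidate c. *)
Let inc (j : 'I_s) (z : s.-tuple nat) c : R :=
  \sum_(u : {set 'I_s} | [forall i in u, (i < j.+1)%N] && (j \in u))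
    gamma u * grid_mean N ah (c :: [seq tnth z i | i <- enum (u :\ j)%SET]).

Let esh_sqrS (j : 'I_s) z c : esh_sqr j.+1 (upd z j c) = esh_sqr j z + inc j z c.
Proof.
rewrite /esh_sqr (bigID (fun u : {set 'I_s} => j \in u))/= addrC; congr (_ + _).
  apply: eq_big => [u|u /andP[_ ju]].
    rewrite -andbA; congr (_ && _); apply/andP/forall_inP.
      move=> [/forall_inP uj ju] i iu; have := uj i iu; rewrite ltnS leq_eqVlt.
      by case/orP => // /eqP ij; move: ju; rewrite -(val_inj ij) iu.
    move=> uj; split; first by apply/forall_inP => i /uj ij; rewrite ltnS ltnW.
    by apply/negP => /uj; rewrite ltnn.
  congr (_ * grid_mean _ _ _); apply/eq_in_map => i; rewrite mem_enum => iu.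
  by rewrite tnth_upd; case: eqP => // ij; move: ju; rewrite -ij iu.
apply: eq_big => [u|u /andP[_ ju]].
  rewrite -andbA; case: (boolP (j \in u)) => ju; rewrite ?andbF//= !andbT.
  by case: eqP => // u0; move: ju; rewrite u0 inE.
congr (_ * _); rewrite /grid_mean; congr (_ * _); apply: eq_bigr => k _.
apply: perm_big; rewrite (_ : c :: _ = [seq tnth (upd z j c) i | i <- j :: enum (u :\ j)%SET]).
  apply: perm_map; apply: uniq_perm; rewrite ?enum_uniq//=.
    by rewrite mem_enum !inE eqxx enum_uniq.
  move=> i; rewrite in_cons !mem_enum !inE.
  by case: eqP => [->|].
rewrite /= tnth_upd eqxx; congr (_ :: _); apply/eq_in_map => i.
by rewrite mem_enum !inE tnth_upd => /andP[/negbTE->].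
Qed.

Let inc_ge0 j z c : 0 <= inc j z c.
Proof.
apply: sumr_ge0 => u _; rewrite mulr_ge0 ?(ltW (gamma_gt0 u))//.
exact: (@grid_mean_ge0 R N N_gt0 ah tau A lam).
Qed.

Let esh_sqr_ge0 d z : 0 <= esh_sqr d z.
Proof.
apply: sumr_ge0 => u _; rewrite mulr_ge0 ?(ltW (gamma_gt0 u))//.
exact: (@grid_mean_ge0 R N N_gt0 ah tau A lam).
Qed.

(** The lam-power of a minimum is at most the mean of the lam-powers over the totient N candidates,
    whose sum is bounded by [K]. For the first component no minimization takes place, and
    [grid_mean1] replaces it. *)
Let inc_le z (j : 'I_s) : cbc_vector gamma psi N z ->
  inc j z (tnth z j) <= (K / (totient N)%:R) `^ lam^-1.
Proof.
move=> [z0 z1].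
have [l0 l1] := andP lam01.
have min c : (c < N)%N -> coprime c N -> inc j z (tnth z j) <= inc j z c.
  move=> cN cc; have [j0|j0] := posnP j.
    have sing (u : {set 'I_s}) : [forall i in u, (i < j.+1)%N] -> (u :\ j)%SET = finset.set0.
      move=> /forall_inP uj; apply/setP => i; rewrite !inE; apply/andP => -[ij /uj].
      rewrite j0 ltnS leqn0 => /eqP i0; case/eqP: ij; apply/val_inj.
      by rewrite /= i0 j0.
    rewrite /inc; apply: ler_sum => u /andP[/sing -> _]; rewrite enum_set0/=.
    by rewrite !(grid_mean1 N_gt0)// z0 ?coprime1n.
  have [_ _ /(_ _ cN cc)] := z1 _ j0; rewrite !eshE ler_sqrt//.
  by rewrite -{1}(upd_tnth z j) !esh_sqrS lerD2l.
have T0 : 0 < (totient N)%:R :> R by rewrite ltr0n totient_gt0.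
have S0 : 0 <= 2 * (A `^ lam * (1 + 2 * (tau * lam / (tau * lam - 1)))) :> R.
  rewrite !mulr_ge0 ?powR_ge0// addr_ge0// mulr_ge0// divr_ge0//; move: lamtau; lra.
suff le_l : inc j z (tnth z j) `^ lam <= K / (totient N)%:R.
  have -> : inc j z (tnth z j) = (inc j z (tnth z j) `^ lam) `^ lam^-1.
    by rewrite -powRrM divff ?powRr1// gt_eqF.
  apply: (ge0_ler_powR _ _ _ le_l); rewrite ?nnegrE ?invr_ge0 ?(ltW l0) ?powR_ge0//.
  rewrite divr_ge0 ?(ltW T0)//; apply: sumr_ge0 => u _.
  by rewrite mulr_ge0 ?powR_ge0 ?exprn_ge0.
rewrite ler_pdivlMr//.
have -> : (totient N)%:R = \sum_(c < N | coprime c N) 1 :> R.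
  rewrite totient_count_coprime big_mkord natr_sum [RHS]big_mkcond/=.
  by apply: eq_bigr => c _; rewrite coprime_sym; case: coprime.
rewrite mulr_sumr.
apply: (@le_trans _ _ (\sum_(c < N | coprime c N) inc j z c `^ lam)).
  apply: ler_sum => c cc; rewrite mulr1; apply: ge0_ler_powR; rewrite ?nnegrE ?(ltW l0)//.
  exact: min.
apply: (@le_trans _ _ (\sum_(c < N | coprime c N)
  \sum_(u : {set 'I_s} | [forall i in u, (i < j.+1)%N] && (j \in u))
    gamma u `^ lam * grid_mean N ah (val c :: [seq tnth z i | i <- enum (u :\ j)%SET]) `^ lam)).
  apply: ler_sum => c _; apply: le_trans.
    apply: (powR_sum_le _ lam01) => u _; rewrite mulr_ge0 ?(ltW (gamma_gt0 u))//.
    exact: (@grid_mean_ge0 R N N_gt0 ah tau A lam).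
  apply: ler_sum => u _; rewrite powRM// ?(ltW (gamma_gt0 u))//.
  exact: (@grid_mean_ge0 R N N_gt0 ah tau A lam).
rewrite exchange_big/= big_mkcond/= /K; apply: ler_sum => u _.
case: ifP => [/andP[_ ju]|_]; last by rewrite mulr_ge0 ?powR_ge0 ?exprn_ge0.
rewrite -mulr_sumr ler_wpM2l ?powR_ge0//.
apply: le_trans (@grid_mean_average R N N_gt0 ah tau A lam ah_bd lam01 lamtau _) _.
by rewrite size_map -cardE (cardsD1 j u) ju.
Qed.

Lemma cbc_esh_sum_le z d : cbc_vector gamma psi N z -> (d <= s)%N ->
  esh_sqr d z <= d%:R * (K / (totient N)%:R) `^ lam^-1.
Proof.
move=> zP; elim: d => [_|d IH ds].
  rewrite mul0r /esh_sqr big1// => u /andP[/set0Pn[i iu] /forall_inP /(_ i iu)].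
  by rewrite ltn0.
rewrite -(upd_tnth z (Ordinal ds)) (esh_sqrS (Ordinal ds)) -natr1 mulrDl mul1r.
by apply: lerD; [exact: IH (ltnW ds)|exact: inc_le].
Qed.

End cbc_vectors.

(** * Gaussian distribution and quantile function *)

Section gaussian_facts.
Variable R : realType.
Local Notation mu := (@lebesgue_measure R).
Local Notation phi := (@phi R).
Local Notation Phi := (@Phi R).

Lemma phiE t : phi t = normal_peak 1 * expR (- (t ^+ 2 / 2)).
Proof.
rewrite /Defs.phi normal_pdfE ?oner_neq0// /normal_fun subr0.
by rewrite expr1n mulNr.
Qed.

Lemma phi_gt0 t : 0 < phi t.
Proof. by rewrite phiE mulr_gt0 ?expR_gt0 ?normal_peak_gt0 ?oner_neq0. Qed.

Lemma measurable_phi : measurable_fun setT phi.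
Proof. exact: measurable_normal_pdf. Qed.

Lemma integrable_phi : mu.-integrable setT (EFin \o phi).
Proof. exact: integrable_normal_pdf. Qed.

Lemma Rintegral_phi : \int[mu]_x phi x = 1.
Proof. by rewrite /Rintegral integral_normal_pdf. Qed.

Lemma continuous_phi : continuous phi.
Proof. by apply: continuous_normal_pdf; exact: oner_neq0. Qed.

Lemma measurable_expR_sqr (b : R) : measurable_fun setT (fun x : R => expR (b * x ^+ 2)).
Proof.
apply: measurableT_comp; first exact: measurable_expR.
by apply: measurable_funM => //; exact: measurable_funX.
Qed.

Lemma integrable_expR_sqr (b : R) : 0 < b ->
  mu.-integrable setT (EFin \o (fun x => expR (- b * x ^+ 2))).
Proof.
move=> b0; set sg := (Num.sqrt (2 * b))^-1.
have sg0 : sg != 0 by rewrite invr_eq0 gt_eqF// sqrtr_gt0 mulr_gt0.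
have pk := normal_peak_gt0 sg0.
have := integrableZl measurableT (normal_peak sg)^-1 (integrable_normal_pdf 0 sg).
apply: eq_integrable => // x _ /=; rewrite -EFinM; congr EFin.
rewrite normal_pdfE// /normal_fun mulKf ?gt_eqF// subr0; congr expR.
rewrite /sg exprVn sqr_sqrtr ?mulr_ge0 ?(ltW b0)// -mulr_natr.
field; exact: lt0r_neq0.
Qed.

Lemma PhiE t : Phi t = \int[mu]_(x in `]-oo, t]) phi x.
Proof. by []. Qed.

Let int_phi A : measurable A -> mu.-integrable A (EFin \o phi).
Proof. by move=> mA; apply: integrableS integrable_phi. Qed.

Lemma onem_PhiE t : 1 - Phi t = \int[mu]_(x in `]t, +oo[) phi x.
Proof.
rewrite -Rintegral_phi -(setUv `]-oo, t]%classic) Rintegral_setU//.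
- by rewrite PhiE addrC addKr setCitvl.
- exact: measurableC.
- by rewrite setUv; exact: integrable_phi.
- by apply/disj_set2P; rewrite setICr.
Qed.

Lemma is_derive_Phi (t : R) : is_derive t 1 Phi (phi t).
Proof.
have tt1 : t < t + 1 by rewrite ltrDl.
have := @continuous_FTC1 R phi -oo%O t (t + 1) tt1 (int_phi (measurable_itv _)).
move=> /= H; have [||d1 d2] := H.
- by rewrite ?bnd_simp ?ltNyr.
- exact: continuous_phi.
by apply: DeriveDef => //; rewrite -derive1E.
Qed.

Lemma continuous_Phi : continuous Phi.
Proof.
move=> t; apply: differentiable_continuous; apply/derivable1_diffP.
by have [] := is_derive_Phi t.
Qed.

Lemma measurable_Phi : measurable_fun setT Phi.
Proof. by apply: continuous_measurable_fun; exact: continuous_Phi. Qed.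

Lemma Phi_lt : {homo Phi : x y / x < y}.
Proof.
move=> x y xy.
have [c _ /eqP] := MVT xy (fun z _ => is_derive_Phi z)
  (continuous_subspaceT continuous_Phi).
by rewrite subr_eq => /eqP ->; rewrite ltrDr mulr_gt0 ?phi_gt0 ?subr_gt0.
Qed.

Lemma Phi_le : {homo Phi : x y / x <= y}.
Proof. by move=> x y; rewrite le_eqVlt => /predU1P[->//|/Phi_lt/ltW]. Qed.

Lemma Phi_gt0 t : 0 < Phi t.
Proof.
apply: (@le_lt_trans _ _ (Phi (t - 1))); last by apply: Phi_lt; lra.
by rewrite PhiE; apply: Rintegral_ge0 => x _; exact/ltW/phi_gt0.
Qed.

Lemma Phi_lt1 t : Phi t < 1.
Proof.
apply: (@lt_le_trans _ _ (Phi (t + 1))); first by apply: Phi_lt; lra.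
rewrite -subr_ge0 onem_PhiE.
by apply: Rintegral_ge0 => x _; exact/ltW/phi_gt0.
Qed.

Lemma Phi01 t : 0 < Phi t < 1. Proof. by rewrite Phi_gt0 Phi_lt1. Qed.

Section tails.
Variables (a : R) (a01 : 0 < a < 1).

Definition tail_cst : R := \int[mu]_x (phi x * expR (a / 2 * x ^+ 2)).

Lemma integrable_tail : mu.-integrable setT
  (EFin \o (fun x => phi x * expR (a / 2 * x ^+ 2))).
Proof.
have b0 : 0 < (1 - a) / 2 by case/andP: a01 => a0 a1; lra.
have := integrableZl measurableT (normal_peak 1) (integrable_expR_sqr b0).
apply: eq_integrable => // x _ /=; rewrite -EFinM phiE; congr EFin.
rewrite -[RHS]mulrA -expRD; congr (_ * expR _).
by field.
Qed.

(** Markov's inequality for exp(a x^2 / 2): on A the factor exp(a (x^2 - t^2) / 2) is at least 1. *)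
Let tail_le (A : set (measurableTypeR R)) (t : R) :
  measurable A -> (forall x, A x -> t ^+ 2 <= x ^+ 2) ->
  \int[mu]_(x in A) phi x <= tail_cst * expR (- (a / 2 * t ^+ 2)).
Proof.
move=> mA At; have [a0 a1] := andP a01.
apply: (@le_trans _ _ (\int[mu]_(x in A)
   (phi x * expR (a / 2 * x ^+ 2) * expR (- (a / 2 * t ^+ 2))))).
  apply: le_Rintegral => //; first exact: int_phi.
    apply: integrableS (_ : mu.-integrable setT _) => //.
    have := integrableZr measurableT (expR (- (a / 2 * t ^+ 2))) integrable_tail.
    by apply: eq_integrable => // x _ /=; rewrite -EFinM.
  move=> x /At tx; rewrite -[leRHS]mulrA -expRD ler_peMr ?(ltW (phi_gt0 x))//.
  rewrite -[leLHS]expR0 ler_expR -mulrBr mulr_ge0 ?subr_ge0//; lra.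
rewrite RintegralZr//; last by apply: integrableS integrable_tail.
rewrite ler_wpM2r ?expR_ge0// /tail_cst Rintegral_mkcond.
apply: le_Rintegral => //.
- have := (integrable_mkcond _ mA).1
    (integrableS measurableT mA (@subsetT _ _) integrable_tail).
  by rewrite -restrict_EFin.
- exact: integrable_tail.
- move=> x _; rewrite patchE; case: ifP => // _.
  by rewrite mulr_ge0 ?expR_ge0 ?(ltW (phi_gt0 x)).
Qed.

Lemma Phi_tail t : t <= 0 -> Phi t <= tail_cst * expR (- (a / 2 * t ^+ 2)).
Proof.
move=> t0; rewrite PhiE; apply: tail_le => // x /=; rewrite in_itv/= => xt.
nra.
Qed.

Lemma onem_Phi_tail t : 0 <= t -> 1 - Phi t <= tail_cst * expR (- (a / 2 * t ^+ 2)).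
Proof.
move=> t0; rewrite onem_PhiE; apply: tail_le => // x /=; rewrite in_itv/= andbT => xt.
nra.
Qed.

Lemma tail_cst_ge0 : 0 <= tail_cst.
Proof. by apply: Rintegral_ge0 => x _; rewrite mulr_ge0 ?expR_ge0 ?(ltW (phi_gt0 x)). Qed.

End tails.
End gaussian_facts.

Section quantile_facts.
Variable R : realType.
Local Notation mu := (@lebesgue_measure R).
Local Notation phi := (@phi R).
Local Notation Phi := (@Phi R).

Lemma tail_small (e : R) : 0 < e -> exists2 t : R, 0 <= t &
  Phi (- t) < e /\ 1 - Phi t < e.
Proof.
move=> e0; have a01 : 0 < (2^-1 : R) < 1 by apply/andP; split; lra.
set C := tail_cst (2^-1 : R); have C0 : 0 <= C by exact: tail_cst_ge0.
(* From exp y >= 1 + y one gets t <= 4 exp(t^2 / 4), so the tail bound is at most 4 C / t, which is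
   below e for this t. *)
exists (1 + 4 * C / e); first by rewrite addr_ge0// divr_ge0 ?(ltW e0) ?mulr_ge0.
set t := 1 + _.
have t1 : 1 <= t by rewrite lerDl divr_ge0 ?(ltW e0) ?mulr_ge0.
have small : C * expR (- (2^-1 / 2 * t ^+ 2)) < e.
  have te : t <= expR (2^-1 / 2 * t ^+ 2) * 4.
    have := expR_ge1Dx (2^-1 / 2 * t ^+ 2); nra.
  have tC : 4 * C / e < t by rewrite /t; lra.
  rewrite expRN ltr_pdivrMr ?expR_gt0//.
  move: tC; rewrite ltr_pdivrMr// => tC.
  have := ler_wpM2r (ltW e0) te; lra.
split.
  by apply: le_lt_trans (Phi_tail a01 _) _; [lra|rewrite sqrrN].
by apply: le_lt_trans (onem_Phi_tail a01 _) _; [lra|].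
Qed.

(** The Galois connection between [quantile] and [Phi], through which events about nodes become
    events about uniform variables. *)
Lemma quantile_le (x t : R) : 0 < x < 1 -> (quantile x <= t) = (x <= Phi t).
Proof.
move=> /andP[x0 x1]; rewrite /quantile; set A := [set _ | _].
have [T1 _ [PT1 _]] := tail_small x0.
have x10 : 0 < 1 - x by rewrite subr_gt0.
have [T2 _ [_ PT2]] := tail_small x10.
have A0 : A !=set0 by exists T2; rewrite /A/=; lra.
have lbA : lbound A (- T1).
  move=> y /= xy; rewrite leNgt; apply/negP => /ltW /(@Phi_le R) yT.
  by have := le_lt_trans (le_trans xy yT) PT1; rewrite ltxx.
apply/idP/idP => [infle|xt]; last by apply: ge_inf => //; exists (- T1).
rewrite leNgt; apply/negP => tx.
(* If Phi t < x, continuity keeps Phi below x a little beyond t, and the infimum would exceed t. *)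
have /nbhs_ballP[e /= e0 be] : \forall y \near t, Phi y < x.
  exact: (@cvgr_lt _ _ _ (nbhs_filter (t : R)) Phi (Phi t) (@continuous_Phi R t) x tx).
have : t + e / 2 <= inf A.
  apply: lb_le_inf => // y /= xy; rewrite leNgt; apply/negP => /ltW /(@Phi_le R) yt.
  have : Phi (t + e / 2) < x.
    apply: be; rewrite /ball/= opprD addNKr normrN gtr0_norm; lra.
  by move=> /(le_lt_trans yt) /(le_lt_trans xy); rewrite ltxx.
by move=> /le_trans /(_ infle); lra.
Qed.

(** Outside (0, 1) the defining set is empty or unbounded below, and [inf] returns its default value
    0. *)
Lemma quantile_out (x : R) : ~~ (0 < x < 1) -> quantile x = 0.
Proof.
move=> x01; rewrite /quantile; apply: inf_out => -[[y /= xy] [m lbm]].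
have [x0|x0] := leP x 0.
  have : m <= m - 1 by apply: lbm => /=; exact: le_trans x0 (ltW (Phi_gt0 _)).
  lra.
move: x01; rewrite x0/= -leNgt => x1.
by have := lt_le_trans (Phi_lt1 y) (le_trans x1 xy); rewrite ltxx.
Qed.

Lemma measurable_quantile : measurable_fun setT (@quantile R).
Proof.
move=> _; apply: (measurability _ (RGenOInfty.measurableE R)) => //.
move=> /= _ [_ [a ->] <-]; rewrite setTI.
(* The complement of (0, 1) is sent to the default value 0, hence belongs to the preimage exactly
   when a < 0. *)
have -> : @quantile R @^-1` `]a, +oo[ =
    (`]0, 1[ `&` `]Phi a, +oo[) `|` (if a < 0 then ~` `]0, 1[ else set0).
  apply/seteqP; split => x /=; rewrite !in_itv/= !andbT.
    have [x01|x01] := boolP (0 < x < 1); first by left; rewrite ltNge -quantile_le// -ltNge.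
    rewrite quantile_out// => a0; right; rewrite a0/= in_itv/=; exact/negP.
  move=> [[x01]|]; first by rewrite !ltNge -quantile_le.
  case: ifP => // a0 /=; rewrite in_itv/= => /negP x01.
  by rewrite quantile_out.
apply: measurableU; first by apply: measurableI; exact: measurable_itv.
by case: ifP => // _; apply: measurableC; exact: measurable_itv.
Qed.

End quantile_facts.

Section real_integrals.
Context d (T : measurableType d) (R : realType) (m : {measure set T -> \bar R}).

Lemma integrable_rsum (I : Type) (r : seq I) (P : pred I) (f : I -> T -> R) :
  (forall i, m.-integrable setT (EFin \o f i)) ->
  m.-integrable setT (EFin \o (fun t => \sum_(i <- r | P i) f i t)).
Proof.
move=> fi; have := integrable_sum measurableT r (P := P) (fun i _ => fi i).
by apply: eq_integrable => // t _ /=; rewrite sumEFin.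
Qed.

Lemma Rintegral_sum (I : Type) (r : seq I) (P : pred I) (f : I -> T -> R) :
  (forall i, m.-integrable setT (EFin \o f i)) ->
  \int[m]_t (\sum_(i <- r | P i) f i t) = \sum_(i <- r | P i) \int[m]_t f i t.
Proof.
move=> fi; elim: r => [|i r IH].
  rewrite big_nil; under eq_Rintegral do rewrite big_nil.
  by rewrite Rintegral_cst// mul0r.
under eq_Rintegral do rewrite big_cons.
rewrite big_cons; case: ifP => // _.
by rewrite RintegralD ?IH//; exact: integrable_rsum.
Qed.

End real_integrals.

(** * Fourier coefficients of theta *)

Section theta_facts.
Variable R : realType.
Local Notation mu := (@lebesgue_measure R).
Local Notation Phi := (@Phi R).

Lemma gauss_weight_sqrV (alpha t : R) : alpha != 0 ->
  (gauss_weight alpha t ^+ 2)^-1 = expR (alpha^-1 * t ^+ 2).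
Proof.
move=> a0; rewrite /gauss_weight -expRM_natr -expRN; congr expR.
by field.
Qed.

Lemma measurable_autoc_Phi (c : R) : measurable_fun setT (fun t => autoc (Phi t) c).
Proof.
rewrite /autoc; apply: measurable_funB; last by apply: measurable_funX; exact: measurable_Phi.
apply: measurable_funD; apply: measurable_maxr => //.
  by apply: measurable_funB => //; exact: measurable_Phi.
apply: measurable_funD => //; apply: measurable_funB => //; exact: measurable_Phi.
Qed.

Section fixed_alpha.
Variables (alpha : R) (alpha2 : 2 < alpha).
Local Notation psi := (gauss_weight alpha).

Let alpha0 : alpha != 0. Proof. by apply: lt0r_neq0; apply: lt_trans alpha2. Qed.

Let alphaV : 0 < alpha^-1 < 2^-1.
Proof.
have a0 : 0 < alpha := lt_trans (ltr0Sn _ 1) alpha2.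
by rewrite invr_gt0 a0 ltf_pV2 ?posrE.
Qed.

Lemma thetaE c : theta psi c =
  \int[mu]_t (autoc (Phi t) c * expR (alpha^-1 * t ^+ 2)).
Proof.
by apply: eq_Rintegral => t _; rewrite gauss_weight_sqrV.
Qed.

Lemma theta_refl c : theta psi (1 - c) = theta psi c.
Proof. by rewrite !thetaE; apply: eq_Rintegral => t _; rewrite autoc_refl. Qed.

Lemma autoc_Phi_tail (a c t : R) : 0 < a < 1 -> 0 <= c <= 1 ->
  `|autoc (Phi t) c| <= tail_cst a * expR (- (a / 2 * t ^+ 2)).
Proof.
move=> a01 c01; have /andP[p0 p1] := Phi01 t.
have [t0|/ltW t0] := leP t 0.
  by apply: le_trans (Phi_tail a01 t0); apply: autoc_norm_le => //; apply/andP; split; lra.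
apply: le_trans (onem_Phi_tail a01 t0); rewrite -autoc_sym.
by apply: autoc_norm_le => //; apply/andP; split; lra.
Qed.

Lemma integrable_theta c : 0 <= c <= 1 ->
  mu.-integrable setT (EFin \o (fun t => autoc (Phi t) c * expR (alpha^-1 * t ^+ 2))).
Proof.
(* The midpoint of 2 / alpha and 1: below 1 for the tail bound, above 2 / alpha so that the tail
   beats exp(t^2 / alpha). *)
move=> c01; pose a := alpha^-1 + 2^-1.
have a01 : 0 < a < 1 by have /andP[? ?] := alphaV; rewrite /a; apply/andP; split; lra.
have b0 : 0 < a / 2 - alpha^-1 by have /andP[? ?] := alphaV; rewrite /a; lra.
apply: le_integrable (integrableZl measurableT (tail_cst a) (integrable_expR_sqr b0)) => //.
  apply/measurable_EFinP; apply: measurable_funM; first exact: measurable_autoc_Phi.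
  exact: measurable_expR_sqr.
move=> t _ /=; rewrite lee_fin normrM (ger0_norm (expR_ge0 _)) [leRHS]ger0_norm; last first.
  by rewrite mulr_ge0 ?expR_ge0 ?tail_cst_ge0.
apply: le_trans (ler_wpM2r (expR_ge0 _) (autoc_Phi_tail _ a01 c01)) _.
rewrite -[leLHS]mulrA -expRD le_eqVlt; apply/orP; left; apply/eqP.
by congr (_ * expR _); field; exact: alpha0.
Qed.

Section dft_theta.
Variables (N : nat) (N_gt0 : (0 < N)%N).

Let grid01 (m : 'I_N) : 0 <= (m%:R : R) / N%:R <= 1.
Proof.
rewrite divr_ge0//= ler_pdivrMr ?ltr0n// mul1r ler_nat; exact: ltnW.
Qed.

Lemma dft_thetaE h : dft N (fun m => theta psi (m%:R / N%:R)) h =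
  \int[mu]_t (dft N (fun m => autoc (Phi t) (m%:R / N%:R)) h * expR (alpha^-1 * t ^+ 2)).
Proof.
pose f (m : 'I_N) (t : R) := N%:R^-1 * cosm R N (h * m) *
  (autoc (Phi t) (m%:R / N%:R) * expR (alpha^-1 * t ^+ 2)).
transitivity (\int[mu]_t (\sum_(m < N) f m t)).
  rewrite Rintegral_sum => [|m].
    rewrite /dft mulr_sumr; apply: eq_bigr => m _.
    rewrite /f RintegralZl//; last exact: integrable_theta.
    by rewrite thetaE mulrAC mulrA.
  have := integrableZl measurableT (N%:R^-1 * cosm R N (h * m)) (integrable_theta (grid01 m)).
  by apply: eq_integrable.
apply: eq_Rintegral => t _; rewrite /dft mulr_sumr mulr_suml.
by apply: eq_bigr => m _; rewrite /f; ring.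
Qed.

Lemma dft_theta_ge0 h : (h < N)%N ->
  0 <= dft N (fun m => theta psi (m%:R / N%:R)) h.
Proof.
move=> hN; rewrite dft_thetaE; apply: Rintegral_ge0 => t _.
by rewrite mulr_ge0 ?expR_ge0// dft_autoc_ge0// Phi01.
Qed.

(** Where p <= C exp(- a t^2 / 2), the power p^(2 eta) contributes exp(- eta a t^2), which is
    integrable against exp(t^2 / alpha) because 1 / alpha < eta a. For t > 0 the same argument is
    applied to 1 - Phi t. *)
Lemma dft_theta_le (eta a : R) h : 0 < eta < 2^-1 -> 0 < a < 1 ->
    alpha^-1 < eta * a -> (h < N)%N ->
  dft N (fun m => theta psi (m%:R / N%:R)) h <=
  5 * tail_cst a `^ (2 * eta) * (\int[mu]_t expR (- (eta * a - alpha^-1) * t ^+ 2)) *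
    (cdist N h)%:R `^ (- (2 - 2 * eta)).
Proof.
move=> eta01 a01 aeta hN; have /andP[e0 e1] := eta01; have /andP[a0 a1] := a01.
have b0 : 0 < eta * a - alpha^-1 by lra.
set q := 2 - 2 * eta; set C := tail_cst a.
rewrite dft_thetaE mulrAC -RintegralZl//; last exact: integrable_expR_sqr.
apply: le_Rintegral => //.
- pose f (m : 'I_N) (t : R) := N%:R^-1 * cosm R N (h * m) *
    (autoc (Phi t) (m%:R / N%:R) * expR (alpha^-1 * t ^+ 2)).
  have := @integrable_rsum _ _ _ mu _ (index_enum 'I_N) predT f (fun m =>
    integrableZl measurableT (N%:R^-1 * cosm R N (h * m)) (integrable_theta (grid01 m))).
  apply: eq_integrable => // t _ /=; congr EFin.
  by rewrite /dft mulr_sumr mulr_suml; apply: eq_bigr => m _; rewrite /f; ring.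
- have := integrableZl measurableT (5 * C `^ (2 * eta) * (cdist N h)%:R `^ (- q))
    (integrable_expR_sqr b0).
  by apply: eq_integrable => // t _.
move=> t _; have /andP[p0 p1] := Phi01 t.
have C0 : 0 <= C := tail_cst_ge0 a.
have key p : 0 < p < 1 -> p <= C * expR (- (a / 2 * t ^+ 2)) ->
    dft N (fun m => autoc p (m%:R / N%:R)) h * expR (alpha^-1 * t ^+ 2) <=
    5 * C `^ (2 * eta) * (cdist N h)%:R `^ (- q) * expR (- (eta * a - alpha^-1) * t ^+ 2).
  move=> p01 pC; apply: le_trans (ler_wpM2r (expR_ge0 _) (dft_autoc_le N_gt0 p01 eta01 hN)) _.
  have -> : expR (- (eta * a - alpha^-1) * t ^+ 2) =
      expR (- (a / 2 * t ^+ 2)) `^ (2 * eta) * expR (alpha^-1 * t ^+ 2).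
    rewrite -expRM -expRD; congr expR; field; exact: alpha0.
  rewrite mulrA ler_wpM2r ?expR_ge0// [leRHS]mulrAC ler_wpM2r ?powR_ge0//.
  rewrite -[leRHS]mulrA ler_wpM2l// -powRM ?expR_ge0//.
  apply: ge0_ler_powR; rewrite ?nnegrE//; [lra|by case/andP: p01 => /ltW|].
  by rewrite mulr_ge0 ?expR_ge0.
have [t0|/ltW t0] := leP t 0; first by apply: key; [rewrite p0|exact: Phi_tail].
have -> : (fun m : nat => autoc (Phi t) (m%:R / N%:R)) =
    (fun m => autoc (1 - Phi t) (m%:R / N%:R)).
  by apply/funext => m; rewrite autoc_sym.
apply: key; last exact: onem_Phi_tail.
by apply/andP; split; lra.
Qed.

End dft_theta.
End fixed_alpha.
End theta_facts.

(** * Integration on R^n *)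

Section tensor.
Context d1 d2 (T1 : measurableType d1) (T2 : measurableType d2) (R : realType).
Variables (m1 : {sigma_finite_measure set T1 -> \bar R})
          (m2 : {sigma_finite_measure set T2 -> \bar R}).
Variables (f : T1 -> R) (g : T2 -> R).
Hypotheses (intf : m1.-integrable setT (EFin \o f))
           (intg : m2.-integrable setT (EFin \o g)).

Let mf : measurable_fun setT f.
Proof. exact/measurable_EFinP/(measurable_int m1). Qed.

Let mg : measurable_fun setT g.
Proof. exact/measurable_EFinP/(measurable_int m2). Qed.

Lemma integrable_tensor :
  (m1 \x m2)%E.-integrable setT (EFin \o (fun p => f p.1 * g p.2)).
Proof.
apply/integrable12ltyP.
  apply/measurable_EFinP; apply: measurable_funM.
    by apply: measurableT_comp => //; exact: measurable_fst.
  by apply: measurableT_comp => //; exact: measurable_snd.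
have /integrableP[_ fy] := intf; have /integrableP[_ gy] := intg.
under eq_integral => x _.
  under eq_integral => y _ do rewrite /= normrM EFinM.
  rewrite ge0_integralZl//; last first.
    by apply: measurableT_comp => //; apply: measurableT_comp.
  over.
rewrite ge0_integralZr//.
- by rewrite lte_mul_pinfty// ?integral_ge0// ge0_fin_numE// integral_ge0.
- by apply: measurableT_comp => //; apply: measurableT_comp.
- exact: integral_ge0.
Qed.

Lemma Rintegral_tensor :
  \int[(m1 \x m2)%E]_p (f p.1 * g p.2) = \int[m1]_x f x * \int[m2]_y g y.
Proof.
rewrite /Rintegral -(integral12_prod_meas1 integrable_tensor) /fubini_F /=.
under eq_integral => x _.
  under eq_integral => y _ do rewrite EFinM.
  rewrite integralZl//.
  have -> : (\int[m2]_y (EFin \o g) y = (\int[m2]_y g y)%:E)%E.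
    by rewrite /Rintegral fineK//; exact: integrable_fin_num.
  rewrite -EFinM; over.
exact: RintegralZr.
Qed.

End tensor.

Section tuples.
Variable R : realType.
Local Notation mu := (@lebesgue_measure R).
Local Notation leb := (lebesgue_tuple R).
Implicit Types n : nat.

Lemma measurable_consp2 n (x : R) :
  measurable_fun setT (fun z : n.-tuple R => consp (x, z)).
Proof. exact: (measurable_fun_pair2 (f := @consp R n) x (@measurable_consp R n)). Qed.

Lemma measurable_tnthR n (i : 'I_n) :
  measurable_fun setT (fun z : n.-tuple R => tnth z i).
Proof. exact: measurable_tnth. Qed.

Lemma ge0_integral_tuple0 (f : 0.-tuple R -> \bar R) : measurable_fun setT f ->
  (\int[leb 0]_z f z = f [tuple])%E.
Proof.
move=> mf; rewrite (_ : \int[leb 0]_z f z = \int[\d_[tuple]]_z f z)%E//.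
by rewrite integral_dirac// diracT mul1e.
Qed.

Lemma ge0_integral_tupleS n (f : n.+1.-tuple R -> \bar R) :
  measurable_fun setT f -> (forall z, 0 <= f z)%E ->
  (\int[leb n.+1]_z f z = \int[(mu \x leb n)%E]_p f (consp p))%E.
Proof.
move=> mf f0; exact: (ge0_integral_pushforward (@measurable_consp R n)).
Qed.

Lemma integrable_tupleS n (f : n.+1.-tuple R -> \bar R) :
  measurable_fun setT f -> (mu \x leb n)%E.-integrable setT (f \o @consp R n) ->
  (leb n.+1).-integrable setT f.
Proof.
move=> mf intf; exact: (integrable_pushforward (@measurable_consp R n)).
Qed.

Lemma integral_tupleS n (f : n.+1.-tuple R -> \bar R) :
  measurable_fun setT f -> (mu \x leb n)%E.-integrable setT (f \o @consp R n) ->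
  (\int[leb n.+1]_z f z = \int[(mu \x leb n)%E]_p f (consp p))%E.
Proof.
move=> mf intf; exact: (integral_pushforward (@measurable_consp R n)).
Qed.

Lemma tnth_consp0 n (x : R) (z : n.-tuple R) : tnth (consp (x, z)) ord0 = x.
Proof. by []. Qed.

Lemma tnth_consp n (x : R) (z : n.-tuple R) i : tnth (consp (x, z)) (lift ord0 i) = tnth z i.
Proof. exact: tnthS. Qed.

Lemma measurable_prod_tnth n (f : 'I_n -> R -> R) :
  (forall i, measurable_fun setT (f i)) ->
  measurable_fun setT (fun z : n.-tuple R => \prod_(i < n) f i (tnth z i)).
Proof.
move=> mf; apply: measurable_prod => i _.
by apply: measurableT_comp => //; exact: measurable_tnthR.
Qed.

(** Integrands on R^n are dominated below by such products, which reduces their integrability to one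
    variable. *)
Lemma prod_tnth n (f : 'I_n -> R -> R) : (forall i, mu.-integrable setT (EFin \o f i)) ->
  (leb n).-integrable setT (EFin \o (fun z => \prod_(i < n) f i (tnth z i))) /\
  \int[leb n]_z (\prod_(i < n) f i (tnth z i)) = \prod_(i < n) \int[mu]_x f i x.
Proof.
have meas k (g : 'I_k -> R -> R) : (forall i, mu.-integrable setT (EFin \o g i)) ->
    measurable_fun setT (fun z : k.-tuple R => \prod_(i < k) g i (tnth z i)).
  move=> gi; apply: measurable_prod_tnth => i.
  by move=> _ Y mY; have /measurable_EFinP/(_ measurableT _ mY) := measurable_int mu (gi i).
elim: n f => [|n IH] f fi.
  split.
    apply/integrableP; split; first by apply/measurable_EFinP; exact: meas.
    rewrite ge0_integral_tuple0 ?big_ord0 /= ?ltry//.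
    by apply: measurableT_comp => //; apply: measurableT_comp => //; exact: meas.
  rewrite /Rintegral ge0_integral_tuple0 ?big_ord0//.
  apply/measurable_EFinP; exact: meas.
have [intg valg] := IH (fun i => f (lift ord0 i)) (fun i => fi (lift ord0 i)).
have tens := integrable_tensor (fi ord0) intg.
have E : (EFin \o (fun z : n.+1.-tuple R => \prod_(i < n.+1) f i (tnth z i))) \o @consp R n =
    EFin \o (fun p => f ord0 p.1 * \prod_(i < n) f (lift ord0 i) (tnth p.2 i)).
  apply/funext => -[x z] /=; rewrite big_ord_recl; congr ((_ * _)%:E).
  by apply: eq_bigr => i _; rewrite tnth_consp.
have me : measurable_fun setT
    (EFin \o (fun z : n.+1.-tuple R => \prod_(i < n.+1) f i (tnth z i))).
  apply/measurable_EFinP; exact: meas.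
split; first by apply: integrable_tupleS => //; rewrite E.
rewrite /Rintegral integral_tupleS//; last by rewrite E.
rewrite big_ord_recl -valg -(Rintegral_tensor (fi ord0) intg).
rewrite /Rintegral; congr fine; apply: eq_integral => p _.
exact: (congr1 (fun F => F p) E).
Qed.

End tuples.

(** * Gaussian representation of a function of one variable *)

Section differentiation.
Variable R : realType.
Local Notation mu := (@lebesgue_measure R).
Implicit Types (f g : R -> R).

Lemma dq_cvg f x : derivable f x 1 ->
  n.+1%:R * (f (x + n.+1%:R^-1) - f x) @[n --> \oo] --> derive1 f x.
Proof.
move=> df; have h0 : (n.+1%:R^-1 : R) @[n --> \oo] --> (0 : R)^'.
  move=> A A0; have P : nbhs (0 : R) (fun y => y != 0 -> A y) := A0.
  apply: (@filterS nat \oo _ (@harmonic R @^-1` (fun y => y != 0 -> A y)));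
    last exact: cvg_harmonic P.
  by move=> n; apply; apply: lt0r_neq0; rewrite invr_gt0.
have := cvg_comp _ _ h0 df; rewrite -/(derive f x 1) -derive1E.
apply: cvg_trans; apply: near_eq_cvg; near=> n => /=.
by rewrite invrK /GRing.scale/= mulr1 [_ + x]addrC.
Unshelve. all: by end_near. Qed.

Lemma derivable_continuous f : (forall x, derivable f x 1) -> continuous f.
Proof.
by move=> df x; apply: differentiable_continuous; apply/derivable1_diffP.
Qed.

Lemma measurable_derive1 f : (forall x, derivable f x 1) ->
  measurable_fun setT (derive1 f : measurableTypeR R -> R).
Proof.
move=> df; have mf : measurable_fun setT f.
  by apply: continuous_measurable_fun; exact: derivable_continuous.
apply: (@measurable_fun_cvg _ (measurableTypeR R) R setT (fun n x => n.+1%:R * (f (x + n.+1%:R^-1) - f x))).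
  move=> n; apply: measurable_funM => //; apply: measurable_funB => //.
  by apply: measurableT_comp => //; exact: measurable_funD.
by move=> x _; exact: dq_cvg.
Qed.

Lemma le_derive1_lip f (a b L : R) : a <= b -> (forall x, derivable f x 1) ->
  (forall x, a <= x <= b -> `|derive1 f x| <= L) ->
  `|f b - f a| <= L * (b - a).
Proof.
move=> ab df fL.
have isd (x : R) : is_derive x 1 f (derive1 f x) by rewrite derive1E; exact: derivableP.
have [c cI ->] := MVT_segment ab (fun x _ => isd x)
  (continuous_subspaceT (derivable_continuous df)).
by rewrite normrM (ger0_norm (_ : 0 <= b - a)) ?subr_ge0// ler_wpM2r ?subr_ge0// fL.
Qed.

(* The derivative is not assumed continuous: the difference quotients of f are,
   they are dominated by L, and their integrals telescope. *)
Lemma FTC2_bounded f (a b L : R) : a < b -> (forall x, derivable f x 1) ->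
  (forall x, a <= x <= b + 1 -> `|derive1 f x| <= L) ->
  \int[mu]_(x in `[a, b]) derive1 f x = f b - f a.
Proof.
move=> ab df fL; have cf := derivable_continuous df.
have intf c d : mu.-integrable `[c, d] (EFin \o f).
  apply: continuous_compact_integrable; first exact: segment_compact.
  exact: continuous_subspaceT.
(* Integration starts at a - 1 so that the primitive is differentiable at a itself. *)
pose F (x : R) := \int[mu]_(t in `[a - 1, x]) f t.
have dF (x : R) : a - 1 < x -> is_derive x 1 F (f x).
  move=> ax; have [d1 d2] := continuous_FTC1_closed (ltr_pwDr ltr01 (lexx x))
    (intf (a - 1) (x + 1)) ax (cf x).
  by apply: DeriveDef => //; rewrite -derive1E.
have dFs (x h : R) : a - 1 < x -> 0 < h ->
    is_derive x 1 (fun t => F (t + h) - F t) (f (x + h) - f x).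
  move=> ax h0.
  have axh : a - 1 < x + h by rewrite (lt_trans ax)// ltrDl.
  have d1 : is_derive x 1 (F \o shift h) (f (x + h) * 1).
    exact: (@is_derive1_comp R F (shift h) x (f (x + h)) 1 (dF _ axh) (is_derive_shift x 1 h)).
  rewrite mulr1 in d1.
  exact: (is_deriveB d1 (dF x ax)).
pose h n : R := n.+1%:R^-1.
have h0 n : 0 < h n by rewrite invr_gt0.
have intq n : \int[mu]_(x in `[a, b]) (n.+1%:R * (f (x + h n) - f x)) =
    n.+1%:R * (F (b + h n) - F b) - n.+1%:R * (F (a + h n) - F a).
  have cq : continuous (fun x => f (x + h n) - f x).
    move=> x; apply: cvgB; last exact: cf.
    by apply: (@continuous_comp _ _ _ (fun x => x + h n) f);
      [apply: cvgD; [exact: cvg_id|exact: cvg_cst]|exact: cf].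
  rewrite RintegralZl//; last first.
    apply: continuous_compact_integrable; first exact: segment_compact.
    exact: continuous_subspaceT.
  rewrite -mulrBr; congr (_ * _); rewrite /Rintegral.
  pose Fs x := F (x + h n) - F x.
  have cFs x : a <= x -> {for x, continuous Fs}.
    move=> ax; have a1 : a - 1 < x by lra.
    apply: differentiable_continuous; apply/derivable1_diffP.
    by have [] := dFs x (h n) a1 (h0 n).
  rewrite (@continuous_FTC2 R (fun x => f (x + h n) - f x) Fs a b ab).
  - by rewrite -EFinB.
  - exact: continuous_subspaceT.
  - split.
    + move=> x; rewrite in_itv/= => /andP[ax _]; have a1 : a - 1 < x by lra.
      by have [] := dFs x (h n) a1 (h0 n).
    + by apply: cvg_at_right_filter; exact: cFs.
    + by apply: cvg_at_left_filter; apply: cFs; exact: ltW.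
  - move=> x; rewrite in_itv/= => /andP[ax _]; have a1 : a - 1 < x by lra.
    by rewrite derive1E; have [_ ->] := dFs x (h n) a1 (h0 n).
have lim1 : \int[mu]_(x in `[a, b]) (n.+1%:R * (f (x + h n) - f x)) @[n --> \oo]
    --> f b - f a.
  under eq_cvg do rewrite intq.
  have cF x : a <= x -> n.+1%:R * (F (x + h n) - F x) @[n --> \oo] --> f x.
    move=> ax; have a1 : a - 1 < x by lra.
    have [d1 d2] := dF x a1; rewrite -d2 -derive1E; exact: dq_cvg.
  by apply: cvgB; apply: cF => //; exact: ltW.
have mab : measurable (`[a, b]%classic : set (measurableTypeR R)) by exact: measurable_itv.
have L0 : 0 <= L.
  by apply: le_trans (fL a _) => //; rewrite lexx; lra.
have [] := @dominated_convergence _ _ R mu _ mab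
  (fun n x => (n.+1%:R * (f (x + h n) - f x))%:E) (EFin \o derive1 f) (cst L%:E).
- move=> n; apply/measurable_EFinP; apply: measurable_funTS.
  apply: measurable_funM => //; apply: measurable_funB; last first.
    exact: continuous_measurable_fun.
  apply: measurableT_comp; first exact: continuous_measurable_fun.
  exact: measurable_funD.
- apply/measurable_EFinP; apply: measurable_funTS; exact: measurable_derive1.
- by apply: aeW => x _; apply: cvg_EFin; [exact: nearW|exact: dq_cvg].
- apply: continuous_compact_integrable; first exact: segment_compact.
  by apply: continuous_subspaceT => x; exact: cvg_cst.
- apply: aeW => x n; rewrite /= in_itv/= => /andP[ax xb].
  rewrite lee_fin normrM ger0_norm// -ler_pdivlMl//.
  (* The difference quotients look ahead by at most 1; hence the derivative bound is assumed up to b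
     + 1. *)
  have hn1 : h n <= 1 by rewrite invf_le1// ler1n.
  have := @le_derive1_lip f x (x + h n) L (ltW (ltr_pwDr (h0 n) (lexx x))) df.
  rewrite addrAC subrr add0r mulrC; apply => y /andP[xy yh].
  by apply: fL; rewrite (le_trans ax xy)/=; lra.
move=> intD _ lim2.
have lim3 : \int[mu]_(x in `[a, b]) (n.+1%:R * (f (x + h n) - f x)) @[n --> \oo]
    --> \int[mu]_(x in `[a, b]) derive1 f x.
  apply: fine_cvg; rewrite /Rintegral fineK; first exact: lim2.
  exact: integrable_fin_num.
exact: (cvg_unique _ lim3 lim1).
Qed.

End differentiation.

Section gaussian_representation.
Variable R : realType.
Local Notation mu := (@lebesgue_measure R).
Local Notation phi := (@phi R).
Local Notation Phi := (@Phi R).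

(** The Peano kernel of z evaluation minus the Gaussian mean: its derivative in t is phi, it jumps
    by -1 at t = z, and it vanishes at both infinities. *)
Definition anova_kernel (t z : R) : R := Phi t - (z <= t)%R%:R.

Lemma anova_kernel_norm_le1 t z : `|anova_kernel t z| <= 1.
Proof.
rewrite /anova_kernel; have /andP[p0 p1] := Phi01 t.
by rewrite ler_norml; case: (z <= t) => /=; apply/andP; split; lra.
Qed.

(** Either the kernel is a one-sided Gaussian tail, or t lies between 0 and z, and then the bound 1
    is at most exp(a (z^2 - t^2) / 2). *)
Lemma anova_kernel_tail (a t z : R) : 0 < a < 1 ->
  `|anova_kernel t z| <= (tail_cst a + expR (a / 2 * z ^+ 2)) * expR (- (a / 2 * t ^+ 2)).
Proof.
move=> a01; have /andP[a0 a1] := a01.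
have C0 := tail_cst_ge0 a; have e0 := expR_gt0 (a / 2 * z ^+ 2).
have e1 := expR_gt0 (- (a / 2 * t ^+ 2)).
have /andP[p0 p1] := Phi01 t.
have big : t ^+ 2 <= z ^+ 2 -> `|anova_kernel t z| <=
    (tail_cst a + expR (a / 2 * z ^+ 2)) * expR (- (a / 2 * t ^+ 2)).
  move=> tz; apply: le_trans (anova_kernel_norm_le1 _ _) _; rewrite mulrDl -expRD.
  apply: ler_wpDl; first by rewrite mulr_ge0// ltW.
  by rewrite -[leLHS]expR0 ler_expR -mulrBr mulr_ge0 ?subr_ge0//; lra.
have [zt|tz] := leP z t.
  have [t0|t0] := leP 0 t; last by apply: big; nra.
  have := onem_Phi_tail a01 t0; rewrite /anova_kernel zt /= distrC ger0_norm; last by lra.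
  by move=> /le_trans; apply; rewrite ler_pM2r// lerDl ltW.
have [t0|t0] := leP t 0; last by apply: big; nra.
have := Phi_tail a01 t0; rewrite /anova_kernel (leNgt z t) tz /= subr0 ger0_norm; last exact: ltW.
by move=> /le_trans; apply; rewrite ler_pM2r// lerDl ltW.
Qed.

Lemma measurable_anova_kernel (z : R) :
  measurable_fun setT (fun t : measurableTypeR R => anova_kernel t z).
Proof.
apply: measurable_funB; first exact: measurable_Phi.
apply: (measurableT_comp (f := fun b : bool => b%:R : R)) => //.
exact: measurable_fun_ler.
Qed.

Lemma cvg_expRN_sqr (c : R) : 0 < c -> expR (- (c * n.+1%:R ^+ 2)) @[n --> \oo] --> (0 : R).
Proof.
move=> c0; have h : (c^-1 * n.+1%:R^-1 : R) @[n --> \oo] --> (0 : R).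
  rewrite -[X in _ --> X](mulr0 c^-1); apply: cvgMr; exact: cvg_harmonic.
apply: (squeeze_cvgr _ (cvg_cst 0) h); apply: nearW => n /=.
rewrite expR_ge0/= expRN -invfM lef_pV2 ?posrE ?mulr_gt0 ?expR_gt0//.
apply: le_trans (expR_ge1Dx _); apply: ler_wpDl => //.
by rewrite ler_pM2l// expr2 ler_peMl// ler1n.
Qed.

Section one_variable.
Variables (g : R -> R) (B M : R).
Hypothesis M01 : 0 < M < 2^-1.
Hypothesis dg : forall x, derivable g x 1.
Hypothesis g_le : forall t, `|g t| <= B * expR (M * t ^+ 2).
Hypothesis dg_le : forall t, `|derive1 g t| <= B * expR (M * t ^+ 2).

(** The midpoint of 2 M and 1, so that the tail estimate applies and still beats exp(M t^2), with
    margin [c]. *)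
Let a : R := M + 2^-1.
Let a01 : 0 < a < 1.
Proof. by have /andP[? ?] := M01; rewrite /a; apply/andP; split; lra. Qed.
Let c : R := a / 2 - M.
Let c0 : 0 < c.
Proof. by have /andP[? ?] := M01; rewrite /c /a; lra. Qed.

Let B0 : 0 <= B.
Proof.
have := le_trans (normr_ge0 _) (g_le 0).
by rewrite pmulr_lge0// expR_gt0.
Qed.

Let meas_g : measurable_fun setT (g : measurableTypeR R -> R).
Proof. by apply: continuous_measurable_fun; exact: derivable_continuous. Qed.

Lemma integrable_mul_phi : mu.-integrable setT (EFin \o (fun t => g t * phi t)).
Proof.
have b0 : 0 < 2^-1 - M by have /andP[? ?] := M01; lra.
apply: le_integrable (integrableZl measurableT (B * normal_peak 1) (integrable_expR_sqr b0)) => //.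
  by apply/measurable_EFinP; apply: measurable_funM => //; exact: measurable_phi.
have np : 0 <= normal_peak (1 : R) by exact: normal_peak_ge0.
move=> t _ /=; rewrite lee_fin normrM [leRHS]ger0_norm; last first.
  by rewrite !mulr_ge0 ?expR_ge0.
rewrite (gtr0_norm (phi_gt0 t)) phiE.
apply: le_trans (ler_wpM2r _ (g_le t)) _; first by rewrite mulr_ge0 ?expR_ge0.
rewrite mulrACA -expRD le_eqVlt; apply/orP; left; apply/eqP.
by congr (_ * expR _); field.
Qed.

Lemma integrable_mul_anova_kernel z :
  mu.-integrable setT (EFin \o (fun t => derive1 g t * anova_kernel t z)).
Proof.
have C0 := tail_cst_ge0 a.
apply: le_integrable (integrableZl measurableT
  (B * (tail_cst a + expR (a / 2 * z ^+ 2))) (integrable_expR_sqr c0)) => //.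
  apply/measurable_EFinP; apply: measurable_funM; first exact: measurable_derive1.
  exact: measurable_anova_kernel.
move=> t _ /=; rewrite lee_fin normrM [leRHS]ger0_norm; last first.
  by rewrite !mulr_ge0 ?addr_ge0 ?expR_ge0.
apply: le_trans (ler_pM _ _ (dg_le t) (anova_kernel_tail t z a01)) _ => //.
rewrite mulrACA -expRD le_eqVlt; apply/orP; left; apply/eqP.
by rewrite /c; congr (_ * expR _); field.
Qed.

Let isd (x : R) : is_derive x 1 g (derive1 g x).
Proof. by rewrite derive1E; exact: derivableP. Qed.

Let bounded_on (x y : R) : exists L, forall t, x <= t <= y ->
  `|derive1 g t| <= L /\ `|g t| <= L.
Proof.
exists (B * expR (M * (x ^+ 2 + y ^+ 2))) => t /andP[xt ty].
have le : B * expR (M * t ^+ 2) <= B * expR (M * (x ^+ 2 + y ^+ 2)).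
  have /andP[M0 _] := M01.
  rewrite ler_wpM2l// ler_expR ler_pM2l//.
  by have [t0|t0] := leP 0 t; nra.
by split; apply: le_trans le; [exact: dg_le|exact: g_le].
Qed.

Let phi_le1 t : phi t <= normal_peak 1.
Proof. by rewrite normal_pdf_ub// oner_neq0. Qed.

Let left_part (x z : R) : x < z ->
  \int[mu]_(t in `[x, z]) (derive1 g t * Phi t + g t * phi t) = g z * Phi z - g x * Phi x.
Proof.
move=> xz; have d (t : R) : is_derive t 1 (g * Phi) (g t * phi t + Phi t * derive1 g t).
  exact: (is_deriveM (isd t) (is_derive_Phi t)).
have dE t : derive1 (g * Phi) t = g t * phi t + Phi t * derive1 g t.
  by rewrite derive1E; have [_ ->] := d t.
have [L HL] := bounded_on x (z + 1).
rewrite -(@FTC2_bounded R (g * Phi) x z (L * normal_peak 1 + L))//.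
- by apply: eq_Rintegral => t _; rewrite dE; ring.
move=> t /HL[l1 l2]; rewrite dE; apply: le_trans (ler_normD _ _) _.
have /andP[p0 p1] := Phi01 t.
rewrite !normrM (gtr0_norm (phi_gt0 t)) (gtr0_norm p0); apply: lerD.
  by apply: ler_pM => //; exact/ltW/phi_gt0.
rewrite -[leRHS]mul1r; apply: ler_pM => //; exact: ltW.
Qed.

Let right_part (z y : R) : z < y ->
  \int[mu]_(t in `[z, y]) (derive1 g t * (Phi t - 1) + g t * phi t) =
    g y * (Phi y - 1) - g z * (Phi z - 1).
Proof.
move=> zy; pose P1 (t : R) := Phi t - 1.
have dP1 (t : R) : is_derive t 1 P1 (phi t).
  rewrite -[phi t]subr0; apply: is_deriveB; exact: is_derive_Phi.
have d (t : R) : is_derive t 1 (g * P1) (g t * phi t + P1 t * derive1 g t).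
  exact: (is_deriveM (isd t) (dP1 t)).
have dE t : derive1 (g * P1) t = g t * phi t + P1 t * derive1 g t.
  by rewrite derive1E; have [_ ->] := d t.
have [L HL] := bounded_on z (y + 1).
rewrite -(@FTC2_bounded R (g * P1) z y (L * normal_peak 1 + L))//.
- by apply: eq_Rintegral => t _; rewrite dE /P1; ring.
move=> t /HL[l1 l2]; rewrite dE; apply: le_trans (ler_normD _ _) _.
have /andP[p0 p1] := Phi01 t.
rewrite !normrM (gtr0_norm (phi_gt0 t)); apply: lerD.
  by apply: ler_pM => //; exact/ltW/phi_gt0.
rewrite -[leRHS]mul1r; apply: ler_pM => //.
by rewrite /P1 ler_norml; apply/andP; split; lra.
Qed.

Let F z t := g t * phi t + derive1 g t * anova_kernel t z.

Let intF z : mu.-integrable setT (EFin \o F z).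
Proof.
have := integrableD measurableT integrable_mul_phi (integrable_mul_anova_kernel z).
by apply: eq_integrable.
Qed.

Let partial_int (x z y : R) : x < z -> z < y ->
  \int[mu]_(t in `[x, y]) F z t = g z - g x * Phi x + g y * (Phi y - 1).
Proof.
move=> xz zy.
(* The kernel jumps at z and already has its right-hand form at t = z, hence the half-open left
   piece. *)
have -> : `[x, y]%classic = (`[x, z[ `|` `[z, y] : set R)%classic.
  by rewrite -itv_bndbnd_setU ?bnd_simp// ltW.
rewrite Rintegral_setU//; first last.
- by apply/disj_set2P; rewrite -subset0 => t [/=]; rewrite !in_itv/=; lra.
- by apply: integrableS (intF z) => //; apply: measurableU; exact: measurable_itv.
have -> : \int[mu]_(t in `[x, z[) F z t = g z * Phi z - g x * Phi x.
  rewrite -left_part//.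
  transitivity (\int[mu]_(t in `[x, z[) (derive1 g t * Phi t + g t * phi t)).
    apply: eq_Rintegral => t; rewrite inE/= in_itv/= => /andP[_ tz].
    by rewrite /F /anova_kernel (leNgt z t) tz /= subr0 addrC.
  rewrite Rintegral_itv_bndo_bndc//.
  have : mu.-integrable `[x, z[ (EFin \o F z).
    by apply: integrableS (intF z) => //; exact: measurable_itv.
  apply: eq_integrable => // t; rewrite inE/= in_itv/= => /andP[_ tz].
  by rewrite /F /anova_kernel (leNgt z t) tz /= subr0 addrC.
have -> : \int[mu]_(t in `[z, y]) F z t = g y * (Phi y - 1) - g z * (Phi z - 1).
  rewrite -right_part//; apply: eq_Rintegral => t; rewrite inE/= in_itv/= => /andP[zt _].
  by rewrite /F /anova_kernel zt addrC.
by ring.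
Qed.

(** The kernel is Phi to the left of z and Phi - 1 to the right, so the integrand is the derivative
    of g Phi and of g (Phi - 1) respectively. The boundary terms at z add up to g z, and those at
    infinity vanish because the Gaussian tail beats exp(M t^2). *)
Lemma gaussian_representation z :
  g z = \int[mu]_t (g t * phi t) + \int[mu]_t (derive1 g t * anova_kernel t z).
Proof.
rewrite -RintegralD//; [|exact: integrable_mul_phi|exact: integrable_mul_anova_kernel].
rewrite -/(F z).
pose x n : R := - n.+1%:R. pose y n : R := n.+1%:R.
have lim1 : \int[mu]_(t in `[x n, y n]) F z t @[n --> \oo] --> g z.
  have C0 := tail_cst_ge0 a.
  have bnd (n : nat) (u v : R) : u ^+ 2 = n.+1%:R ^+ 2 ->
      `|v| <= tail_cst a * expR (- (a / 2 * u ^+ 2)) ->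
      `|g u * v| <= B * tail_cst a * expR (- (c * n.+1%:R ^+ 2)).
    move=> un vt; rewrite normrM; apply: le_trans (ler_pM _ _ (g_le u) vt) _ => //.
    rewrite mulrACA -expRD un le_eqVlt; apply/orP; left; apply/eqP.
    by rewrite /c; congr (_ * expR _); field.
  have tend0 (w : nat -> R) :
      (forall n, `|w n| <= B * tail_cst a * expR (- (c * n.+1%:R ^+ 2))) ->
      w n @[n --> \oo] --> (0 : R).
    move=> wle; apply/norm_cvg0P.
    have h : B * tail_cst a * expR (- (c * n.+1%:R ^+ 2)) @[n --> \oo] --> (0 : R).
      rewrite -[X in _ --> X](mulr0 (B * tail_cst a)); apply: cvgMr; exact: cvg_expRN_sqr.
    by apply: (squeeze_cvgr _ (cvg_cst 0) h); apply: nearW => n; rewrite normr_ge0 wle.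
  pose G n := g z - g (x n) * Phi (x n) + g (y n) * (Phi (y n) - 1).
  have e : \forall n \near \oo, G n = \int[mu]_(t in `[x n, y n]) F z t.
    near=> n; rewrite partial_int//.
    - rewrite /x ltrNl; apply: (@lt_trans _ _ n%:R); last by rewrite ltr_nat.
      by near: n; exact: nbhs_infty_gtr.
    - rewrite /y; apply: (@lt_trans _ _ n%:R); last by rewrite ltr_nat.
      by near: n; exact: nbhs_infty_gtr.
  suff : G n @[n --> \oo] --> g z by apply: cvg_trans; exact: near_eq_cvg e.
  rewrite -[X in _ --> X](addr0 (g z)) -[X in _ --> X + _](subr0 (g z)).
  apply: cvgD; first apply: cvgB; first exact: cvg_cst.
  - apply: tend0 => n; apply: bnd; first by rewrite /x sqrrN.
    by rewrite gtr0_norm ?Phi_gt0//; apply: Phi_tail => //; rewrite oppr_le0.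
  - apply: tend0 => n; apply: bnd => //.
    rewrite distrC ger0_norm ?subr_ge0 ?(ltW (Phi_lt1 _))//.
    exact: onem_Phi_tail.
have lim2 : \int[mu]_(t in `[x n, y n]) F z t @[n --> \oo] --> \int[mu]_t F z t.
  have mI n : measurable (`[x n, y n]%classic : set (measurableTypeR R)) by exact: measurable_itv.
  have mF := measurable_int mu (intF z).
  have [] := @dominated_convergence _ _ R mu _ measurableT
    (fun n => (EFin \o F z) \_ `[x n, y n]) (EFin \o F z) (abse \o (EFin \o F z)).
  - by move=> n; exact: ((measurable_restrictT (EFin \o F z) (mI n)).1
      (measurable_funS measurableT (@subsetT _ _) mF)).
  - exact: mF.
  - apply: aeW => t _.
    apply: (@cvg_trans _ (cst (EFin (F z t)) @ \oo)); last exact: cvg_cst.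
    apply: near_eq_cvg; near=> n; rewrite patchE ifT//.
    rewrite inE/= in_itv/= -ler_norml; apply: (@le_trans _ _ n%:R); last by rewrite ler_nat.
    by near: n; exact: nbhs_infty_ger.
  - exact: integrable_abse.
  - apply: aeW => t n _; rewrite patchE; case: ifP => // _.
    by rewrite abse0 abse_ge0.
  move=> _ _ lim3; apply: fine_cvg; rewrite /Rintegral fineK; last exact: (integrable_fin_num measurableT (intF z)).
  move: lim3; under eq_fun do rewrite -integral_mkcond; exact.
exact: (cvg_unique _ lim1 lim2).
Unshelve. all: by end_near. Qed.

End one_variable.
End gaussian_representation.

(** * Representation of a function of several variables *)

Section tuple_fubini.
Variable R : realType.
Local Notation mu := (@lebesgue_measure R).
Local Notation leb := (lebesgue_tuple R).

Lemma integrable_consp n (f : n.+1.-tuple R -> R) :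
  (leb n.+1).-integrable setT (EFin \o f) ->
  (mu \x leb n)%E.-integrable setT ((EFin \o f) \o @consp R n).
Proof.
move=> /integrableP[mf fy]; apply/integrableP; split.
  by apply: measurableT_comp => //; exact: measurable_consp.
move: fy; rewrite ge0_integral_tupleS//.
by apply: measurableT_comp.
Qed.

Lemma Rintegral_tupleS n (f : n.+1.-tuple R -> R) :
  (leb n.+1).-integrable setT (EFin \o f) ->
  (forall t : n.-tuple R, mu.-integrable setT (EFin \o (fun y => f (consp (y, t))))) ->
  \int[leb n.+1]_s f s = \int[leb n]_t \int[mu]_y f (consp (y, t)).
Proof.
move=> intf intft; have intc := integrable_consp intf.
rewrite {1}/Rintegral integral_tupleS//; last exact: (measurable_int (leb n.+1)).
rewrite -(integral21_prod_meas1 intc) /fubini_G /Rintegral; congr fine.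
apply: eq_integral => t _; rewrite fineK//.
exact: (integrable_fin_num measurableT (intft t)).
Qed.

Lemma sum_sqr_consp n (x : R) (z : n.-tuple R) :
  \sum_(j < n.+1) tnth (consp (x, z)) j ^+ 2 = x ^+ 2 + \sum_(j < n) tnth z j ^+ 2.
Proof.
by rewrite big_ord_recl; congr (_ + _); apply: eq_bigr => j _; rewrite tnth_consp.
Qed.

Lemma upd_consp0 n (x y : R) (z : n.-tuple R) : upd (consp (x, z)) ord0 y = consp (y, z).
Proof.
apply: eq_from_tnth => i; rewrite tnth_upd; case: (unliftP ord0 i) => [j ->|->].
  by rewrite !tnth_consp.
by rewrite eqxx.
Qed.

Lemma upd_consp n (x y : R) (z : n.-tuple R) (j : 'I_n) :
  upd (consp (x, z)) (lift ord0 j) y = consp (x, upd z j y).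
Proof.
apply: eq_from_tnth => i; rewrite tnth_upd; case: (unliftP ord0 i) => [k ->|->].
  by rewrite !tnth_consp tnth_upd (inj_eq lift_inj).
by [].
Qed.

Lemma consp_eta n (z : n.+1.-tuple R) : z = consp (thead z, [tuple of behead z]).
Proof. by rewrite {1}(tuple_eta z); apply/val_inj. Qed.

Lemma big_tuple_cons n (V : nmodType) (F : n.+1.-tuple bool -> V) :
  \sum_v F v = \sum_(w : n.-tuple bool) (F [tuple of false :: w] + F [tuple of true :: w]).
Proof.
transitivity (\sum_(w : n.-tuple bool) \sum_(b : bool) F [tuple of b :: w]).
  rewrite pair_bigA/= (reindex (fun p : n.-tuple bool * bool => [tuple of p.2 :: p.1])).
    by [].
  exists (fun v : n.+1.-tuple bool => ([tuple of behead v], thead v)) => [[w b] _|v _] /=.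
    by congr pair; apply/val_inj.
  by rewrite [RHS]tuple_eta; apply/val_inj.
by apply: eq_bigr => w _; rewrite big_bool addrC.
Qed.

End tuple_fubini.

Section anova_representation.
Variable R : realType.
Local Notation mu := (@lebesgue_measure R).
Local Notation leb := (lebesgue_tuple R).
Local Notation phi := (@phi R).

(** A tuple of booleans encodes a set u: coordinates marked true are differentiated and paired with
    the kernel, the others are averaged against phi. *)
Definition anova_factor (b : bool) (z t : R) : R := if b then anova_kernel t z else phi t.

Definition anova_weight n (v : n.-tuple bool) (t z : n.-tuple R) : R :=
  \prod_(j < n) anova_factor (tnth v j) (tnth z j) (tnth t j).

Lemma measurable_anova_factor b (z : R) :
  measurable_fun setT (anova_factor b z : measurableTypeR R -> R).
Proof.
by case: b; [exact: measurable_anova_kernel|exact: measurable_phi].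
Qed.

Lemma expR_sum_sqr n (M : R) (t : n.-tuple R) :
  expR (M * \sum_(j < n) tnth t j ^+ 2) = \prod_(j < n) expR (M * tnth t j ^+ 2).
Proof. by rewrite mulr_sumr expR_sum. Qed.

Lemma integrable_anova_factor (M : R) b z : 0 < M < 2^-1 ->
  mu.-integrable setT (EFin \o (fun t => expR (M * t ^+ 2) * anova_factor b z t)).
Proof.
move=> M01; have /andP[M0 M1] := M01.
pose a : R := M + 2^-1.
have a01 : 0 < a < 1 by rewrite /a; apply/andP; split; lra.
have c0 : 0 < a / 2 - M by rewrite /a; lra.
have C0 := tail_cst_ge0 a; have np : 0 <= normal_peak (1 : R) by exact: normal_peak_ge0.
have me : measurable_fun setT
    (EFin \o (fun t : measurableTypeR R => expR (M * t ^+ 2) * anova_factor b z t)).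
  apply/measurable_EFinP; apply: measurable_funM; first exact: measurable_expR_sqr.
  exact: measurable_anova_factor.
case: b me => me.
  apply: le_integrable (integrableZl measurableT
    (tail_cst a + expR (a / 2 * z ^+ 2)) (integrable_expR_sqr c0)) => //.
  move=> t _ /=; rewrite lee_fin normrM (ger0_norm (expR_ge0 _)) [leRHS]ger0_norm; last first.
    by rewrite !mulr_ge0 ?addr_ge0 ?expR_ge0.
  apply: le_trans (ler_wpM2l (expR_ge0 _) (anova_kernel_tail t z a01)) _.
  rewrite mulrCA -expRD le_eqVlt; apply/orP; left; apply/eqP.
  by congr (_ * expR _); field.
have b0 : 0 < 2^-1 - M by lra.
apply: le_integrable (integrableZl measurableT (normal_peak 1) (integrable_expR_sqr b0)) => //.
move=> t _ /=; rewrite lee_fin normrM (ger0_norm (expR_ge0 _)) [leRHS]ger0_norm; last first.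
  by rewrite !mulr_ge0 ?expR_ge0.
rewrite (gtr0_norm (phi_gt0 t)) phiE.
rewrite mulrCA -expRD le_eqVlt; apply/orP; left; apply/eqP.
by congr (_ * expR _); field.
Qed.

Lemma measurable_anova_weight n (v : n.-tuple bool) (z : n.-tuple R) :
  measurable_fun setT (fun t => anova_weight v t z).
Proof.
apply: (@measurable_prod_tnth R n (fun j => anova_factor (tnth v j) (tnth z j))) => j _ Y mY.
exact: (measurable_anova_factor _ _ measurableT mY).
Qed.

Lemma integrable_anova_term n (h : n.-tuple R -> R) (B M : R) (v : n.-tuple bool) z :
  0 < M < 2^-1 -> measurable_fun setT h ->
  (forall t, `|h t| <= B * expR (M * \sum_(j < n) tnth t j ^+ 2)) ->
  (leb n).-integrable setT (EFin \o (fun t => h t * anova_weight v t z)).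
Proof.
move=> M01 mh hB.
have [intp _] := prod_tnth (fun j : 'I_n => integrable_anova_factor (tnth v j) (tnth z j) M01).
apply: le_integrable (integrableZl measurableT B intp) => //.
  apply/measurable_EFinP; apply: measurable_funM => //.
  exact: measurable_anova_weight.
move=> t _ /=; rewrite lee_fin big_split/= -expR_sum_sqr mulrA !normrM.
rewrite ler_wpM2r// (ger0_norm (expR_ge0 _)).
apply: le_trans (hB t) _; rewrite ler_wpM2r ?expR_ge0//; exact: ler_norm.
Qed.

(** The derivatives enter as an abstract family [g] indexed by sets, which can be restricted to
    fewer variables in the induction. The condition that all entries up to j are false reflects the
    order of differentiation in [mixed_partial], where larger indices are differentiated first. *)
Theorem anova_representation n (g : n.-tuple bool -> n.-tuple R -> R) (B M : R) :
  0 < M < 2^-1 ->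
  (forall v, measurable_fun setT (g v)) ->
  (forall v t, `|g v t| <= B * expR (M * \sum_(j < n) tnth t j ^+ 2)) ->
  (forall v (j : 'I_n) t, (forall i : 'I_n, (i <= j)%N -> tnth v i = false) ->
     derivable (fun y => g v (upd t j y)) (tnth t j) 1 /\
     derive1 (fun y => g v (upd t j y)) (tnth t j) = g (upd v j true) t) ->
  forall z, g [tuple of nseq n false] z =
    \sum_(v : n.-tuple bool) \int[leb n]_t (g v t * anova_weight v t z).
Proof.
move=> M01; elim: n g B => [|n IH] g B mg gB dg z.
  rewrite (big_pred1 ([tuple] : 0.-tuple bool)); last by move=> v; rewrite (tuple0 v); apply/esym/eqP.
  rewrite {1}/Rintegral ge0_integral_tuple0.
    by rewrite /anova_weight big_ord0 mulr1 (tuple0 z); congr (g _ _); apply/val_inj.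
  apply/measurable_EFinP; apply: measurable_funM => //.
  exact: measurable_anova_weight.
set x := thead z; set z' : n.-tuple R := [tuple of behead z].
have zE : z = consp (x, z') by exact: consp_eta.
have -> : [tuple of nseq n.+1 false] = [tuple of false :: [tuple of nseq n false]] by apply/val_inj.
(* The first coordinate is frozen at x, and its share exp(M x^2) of the bound moves into the
   constant. *)
have := IH (fun w t => g [tuple of false :: w] (consp (x, t))) (B * expR (M * x ^+ 2)).
rewrite {1}zE => -> //; first last.
- move=> w j t wj.
  have [i|d1 d2] := dg [tuple of false :: w] (lift ord0 j) (consp (x, t)).
    case: (unliftP ord0 i) => [k ->|-> //]; rewrite tnthS /= /bump/= !add1n => kj.
    exact: wj.
  have E : (fun y => g [tuple of false :: w] (upd (consp (x, t)) (lift ord0 j) y)) =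
     (fun y => g [tuple of false :: w] (consp (x, upd t j y))).
    by apply/funext => y; rewrite upd_consp.
  rewrite E !tnth_consp in d1 d2; split => //; rewrite d2; congr (g _ _).
  apply: eq_from_tnth => i; rewrite tnth_upd; case: (unliftP ord0 i) => [k ->|-> //].
  by rewrite !tnthS tnth_upd (inj_eq lift_inj).
- by move=> w t; apply: le_trans (gB _ _) _; rewrite sum_sqr_consp mulrDr expRD mulrA.
- by move=> w; apply: measurableT_comp => //; exact: measurable_consp2.
rewrite big_tuple_cons; apply: eq_bigr => w _.
pose w0 := [tuple of false :: w]; pose w1 := [tuple of true :: w].
pose T v s := g v s * anova_weight v s z.
have intT v : (leb n.+1).-integrable setT (EFin \o T v).
  exact: (integrable_anova_term v z M01 (mg v) (gB v)).
have weight b s (t : n.-tuple R) : anova_weight [tuple of b :: w] (consp (s, t)) z =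
    anova_factor b x s * anova_weight w t z'.
  rewrite /anova_weight big_ord_recl zE !tnth_consp0; congr (_ * _).
  by apply: eq_bigr => j _; rewrite !tnth_consp tnthS.
rewrite -RintegralD; [|exact: measurableT|exact: intT|exact: intT].
have rep t y : derivable (fun y => g w0 (consp (y, t))) y 1 /\
    derive1 (fun y => g w0 (consp (y, t))) y = g w1 (consp (y, t)).
  have [i|d1 d2] := dg w0 ord0 (consp (y, t)).
    by rewrite leqn0 => /eqP i0; have -> : i = ord0 by apply/val_inj.
  have E : (fun y' => g w0 (upd (consp (y, t)) ord0 y')) = (fun y' => g w0 (consp (y', t))).
    by apply/funext => y'; rewrite upd_consp0.
  rewrite E in d1 d2; split => //; rewrite d2; congr (g _ _).
  apply: eq_from_tnth => i; rewrite tnth_upd; case: (unliftP ord0 i) => [k ->|-> //].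
  by rewrite !tnthS.
have bnd b (t : n.-tuple R) y : `|g [tuple of b :: w] (consp (y, t))| <=
    B * expR (M * \sum_(j < n) tnth t j ^+ 2) * expR (M * y ^+ 2).
  by apply: le_trans (gB _ _) _; rewrite sum_sqr_consp mulrDr expRD mulrA mulrAC.
have dE t : derive1 (fun y => g w0 (consp (y, t))) = (fun y => g w1 (consp (y, t))).
  by apply/funext => y; have [] := rep t y.
have i0 t : mu.-integrable setT (EFin \o (fun y => g w0 (consp (y, t)) * phi y)).
  by apply: (integrable_mul_phi M01 _ (bnd false t)) => y; have [] := rep t y.
have i1 t : mu.-integrable setT (EFin \o (fun y => g w1 (consp (y, t)) * anova_kernel y x)).
  have := @integrable_mul_anova_kernel R (fun y => g w0 (consp (y, t))) _ M M01.
  rewrite dE; apply; [|exact: bnd false t|exact: bnd true t].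
  by move=> y; have [] := rep t y.
rewrite (@Rintegral_tupleS R n (fun s => T w0 s + T w1 s)); first last.
- move=> t.
  have := integrableZr measurableT (anova_weight w t z') (integrableD measurableT (i0 t) (i1 t)).
  apply: eq_integrable => // y _ /=.
  by rewrite /T !weight -EFinD -EFinM; congr EFin; rewrite /anova_factor; ring.
- have := integrableD measurableT (intT w0) (intT w1).
  by apply: eq_integrable.
apply: eq_Rintegral => t _.
(* The terms of false :: w and true :: w combine, inside the integral over the remaining
   coordinates, into the one-variable formula for the first coordinate. *)
have := @gaussian_representation R (fun y => g w0 (consp (y, t))) _ M M01
  (fun y => (let: conj d _ := rep t y in d)) (bnd false t) _ x.
rewrite dE => /(_ (bnd true t)) ->.
rewrite -RintegralD// -RintegralZr//; last first.
  have := integrableD measurableT (i0 t) (i1 t).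
  by apply: eq_integrable.
by apply: eq_Rintegral => y _; rewrite /T !weight /anova_factor; ring.
Qed.

End anova_representation.

(** * Measurability of mixed partial derivatives *)

Section measurability.
Variable R : realType.

Lemma cvg_floor_grid (x : R) :
  (Num.floor (n.+1%:R * x))%:~R / n.+1%:R @[n --> \oo] --> x.
Proof.
have h : (x - n.+1%:R^-1 : R) @[n --> \oo] --> x.
  by rewrite -[X in _ --> X]subr0; apply: cvgB; [exact: cvg_cst|exact: cvg_harmonic].
apply: (squeeze_cvgr _ h (cvg_cst x)); apply: nearW => n.
have n0 : 0 < n.+1%:R :> R by [].
have /andP[f1 f2] := floor_itv (n.+1%:R * x).
rewrite ler_pdivrMr// [x * _]mulrC f1 andbT ler_pdivlMr// mulrBl mulVf ?gt_eqF//.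
by move: f2; rewrite intrD mulrC => f2; lra.
Qed.

(* A separately continuous function is the limit of the functions obtained by
   rounding its first coordinate down to a grid. *)
Lemma measurable_separately_continuous n (f : n.-tuple R -> R) :
  (forall (j : 'I_n) z, f (upd z j y) @[y --> tnth z j] --> f z) ->
  measurable_fun setT f.
Proof.
elim: n f => [|n IH] f cf.
  have -> : f = cst (f [tuple]) by apply/funext => z; rewrite (tuple0 z)/=; congr f; apply/val_inj.
  exact: measurable_cst.
pose q k (x : R) : R := (Num.floor (k.+1%:R * x))%:~R / k.+1%:R.
apply: (@measurable_fun_cvg _ _ _ _
    (fun k z => f (consp (q k (tnth z ord0), [tuple of behead z])))); last first.
  move=> z _; rewrite [X in _ --> f X]consp_eta.
  set x := thead z; set t := [tuple of behead z].
  have H : f (consp (y, t)) @[y --> x] --> f (consp (x, t)).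
    have E : (fun y => f (upd (consp (x, t)) ord0 y)) = (fun y => f (consp (y, t))).
      by apply/funext => y; rewrite upd_consp0.
    by rewrite -E; exact: (cf ord0 (consp (x, t))).
  exact: (cvg_comp (fun k => q k x) (fun y => f (consp (y, t))) (@cvg_floor_grid x) H).
move=> k _ Y mY; rewrite setTI.
have k0 : 0 < k.+1%:R :> R by [].
(* On each of the countably many grid cells the first coordinate is constant, which leaves a
   function of n variables. *)
have -> : (fun z => f (consp (q k (tnth z ord0), [tuple of behead z]))) @^-1` Y =
  \bigcup_(m : int) ((fun z : n.+1.-tuple R => tnth z ord0) @^-1` `[m%:~R / k.+1%:R, (m + 1)%:~R / k.+1%:R[ `&`
    (fun z : n.+1.-tuple R => f (consp (m%:~R / k.+1%:R, [tuple of behead z]))) @^-1` Y).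
  have fl (x : R) (m : int) : (Num.floor (k.+1%:R * x) == m) =
      (x \in `[m%:~R / k.+1%:R, (m + 1)%:~R / k.+1%:R[).
    by rewrite floor_eq in_itv/= ler_pdivrMr// ltr_pdivlMr// [x * _]mulrC.
  apply/seteqP; split => z /=.
    move=> Yz; exists (Num.floor (k.+1%:R * tnth z ord0)) => //; split => //=.
    by rewrite -fl.
  by move=> [m _ [/=]]; rewrite -fl /q => /eqP ->.
apply: countable_bigcupT_measurable; first exact: countableP.
move=> m; apply: measurableI; rewrite -[X in measurable X]setTI.
  by apply: measurable_tnthR => //; exact: measurable_itv.
apply: (measurableT_comp (f := fun t : n.-tuple R => f (consp (m%:~R / k.+1%:R, t)))) => //.
  apply: IH => j t; set c : R := _ / _.
  have E : (fun y => f (upd (consp (c, t)) (lift ord0 j) y)) = (fun y => f (consp (c, upd t j y))).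
    by apply/funext => y; rewrite upd_consp.
  by have := cf (lift ord0 j) (consp (c, t)); rewrite E tnth_consp.
exact: measurable_behead.
Qed.

Section partial_derivatives.
Variable s : nat.
Implicit Types (G : s.-tuple R -> R) (u : {set 'I_s}).

Lemma measurable_upd (j : 'I_s) (h : s.-tuple R -> R) :
  measurable_fun setT h -> measurable_fun setT (fun z => upd z j (h z)).
Proof.
move=> mh; apply/measurable_fun_tnthP => i.
rewrite (_ : _ \o _ = if i == j then h else (fun z => tnth z i)); last first.
  by apply/funext => z /=; rewrite tnth_upd; case: ifP.
by case: ifP => // _; exact: measurable_tnthR.
Qed.

Lemma measurable_partial (j : 'I_s) G :
  measurable_fun setT G -> has_partial j G -> measurable_fun setT (partial j G).
Proof.
move=> mG dG.
apply: (@measurable_fun_cvg _ (s.-tuple R : measurableType _) R setT (fun n (z : s.-tuple R) =>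
  n.+1%:R * (G (upd z j (tnth z j + n.+1%:R^-1)) - G z)) (partial j G)).
  move=> n; apply: measurable_funM => //; apply: measurable_funB => //.
  apply: measurableT_comp => //; apply: measurable_upd.
  by apply: measurable_funD => //; exact: measurable_tnthR.
move=> z _; have := dq_cvg (dG z).
by under eq_cvg do rewrite upd_tnth.
Qed.

Lemma sorted_enum_set u : sorted (fun i j : 'I_s => (i < j)%N) (enum u).
Proof.
rewrite /enum_mem; apply: sorted_filter; first by move=> a b c; exact: ltn_trans.
have := iota_ltn_sorted 0 s; rewrite -val_enum_ord sorted_map enumT.
by [].
Qed.

Lemma enum_setU1 (j : 'I_s) u : (forall i, i \in u -> (j < i)%N) ->
  enum (j |: u) = j :: enum u.
Proof.
move=> ju; apply: (@irr_sorted_eq _ (fun i j : 'I_s => (i < j)%N)).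
- by move=> a b c; exact: ltn_trans.
- by move=> a; exact: ltnn.
- exact: sorted_enum_set.
- rewrite /= path_min_sorted ?sorted_enum_set//.
  by apply/allP => i; rewrite mem_enum => /ju.
- by move=> i; rewrite in_cons !mem_enum in_setU1.
Qed.

Lemma mixed_partial_setU1 (j : 'I_s) u G : (forall i, i \in u -> (j < i)%N) ->
  mixed_partial (j |: u) G = partial j (mixed_partial u G).
Proof. by move=> ju; rewrite /mixed_partial enum_setU1. Qed.

Lemma mixed_partial0 G : mixed_partial finset.set0 G = G.
Proof. by rewrite /mixed_partial enum_set0. Qed.

(** Existence of the first partial derivatives gives continuity in each variable separately, which
    is enough. *)
Lemma measurable_has_mixed_partials G : has_mixed_partials G -> measurable_fun setT G.
Proof.
move=> dG; apply: measurable_separately_continuous => j z.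
have dGj : has_partial j G by rewrite -[G]mixed_partial0; apply: dG => i; rewrite inE.
rewrite -[X in _ --> G X](upd_tnth z j).
by apply: differentiable_continuous; apply/derivable1_diffP; exact: dGj.
Qed.

Lemma measurable_mixed_partial G u : has_mixed_partials G ->
  measurable_fun setT (mixed_partial u G).
Proof.
move=> dG.
(* The induction runs over increasing lists: a tail of such a list enumerates a set whose elements
   exceed the head, so the next derivative exists by hypothesis. *)
suff H (l : seq 'I_s) : sorted (fun i j : 'I_s => (i < j)%N) l ->
    measurable_fun setT (foldr (@partial R s) G l) /\
    foldr (@partial R s) G l = mixed_partial [set i in l]%SET G.
  by have [] := H _ (sorted_enum_set u).
elim: l => [_|j l IH] /=.
  split; first exact: measurable_has_mixed_partials.
  by rewrite -[LHS]mixed_partial0; congr mixed_partial; apply/setP => i; rewrite !inE.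
rewrite path_sortedE; last by move=> a b c; exact: ltn_trans.
move=> /andP[/allP jl /IH [ml el]].
have jl' i : i \in [set i in l]%SET -> (j < i)%N by rewrite inE => /jl.
split; first by apply: measurable_partial => //; rewrite el; exact: dG.
rewrite el -mixed_partial_setU1//; congr mixed_partial.
by apply/setP => i; rewrite !inE.
Qed.

End partial_derivatives.
End measurability.

(** * Mean square error of a randomly shifted rule *)

Section quadratic_bounds.

Lemma sqr_sum_le (R : realFieldType) (I : finType) (P : pred I) (a : I -> R) :
  (\sum_(i | P i) a i) ^+ 2 <= #|P|%:R * \sum_(i | P i) a i ^+ 2.
Proof.
have e : #|P|%:R * \sum_(i | P i) a i ^+ 2 =
    \sum_(i | P i) \sum_(j | P j) (a i ^+ 2 + a j ^+ 2) / 2.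
  rewrite [RHS](eq_bigr (fun i => 2^-1 * (#|P|%:R * a i ^+ 2 + \sum_(j | P j) a j ^+ 2))).
    by rewrite -mulr_sumr big_split/= -mulr_sumr sumr_const -[X in _ + X]mulr_natl; field.
  by move=> i _; rewrite -mulr_suml big_split/= sumr_const -[a i ^+ 2 *+ _]mulr_natl mulrC.
rewrite e expr2 mulr_suml; apply: ler_sum => i _; rewrite mulr_sumr.
by apply: ler_sum => j _; have := sqr_ge0 (a i - a j); rewrite sqrrB; lra.
Qed.

Context d (T : measurableType d) (R : realType) (m : {measure set T -> \bar R}).

(* Cauchy-Schwarz with the weight w moved to both sides. *)
Lemma sqr_Rintegral_le (f h w : T -> R) (P : R) :
  (forall x, 0 < w x) ->
  m.-integrable setT (EFin \o (fun x => f x ^+ 2 * w x)) ->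
  m.-integrable setT (EFin \o (fun x => h x ^+ 2 / w x)) ->
  m.-integrable setT (EFin \o (fun x => f x * h x)) ->
  0 < P -> \int[m]_x (f x ^+ 2 * w x) <= P ->
  (\int[m]_x (f x * h x)) ^+ 2 <= P * \int[m]_x (h x ^+ 2 / w x).
Proof.
move=> w0 ifw ihw ifh P0 leP.
set I := \int[m]_x (f x * h x); set Q := \int[m]_x (h x ^+ 2 / w x).
(* The minimizer of the quadratic l^2 P + 2 l I + Q, which is nonnegative for every l. *)
pose l := - I / P.
have i1 : m.-integrable setT (EFin \o (fun x => l ^+ 2 * (f x ^+ 2 * w x))).
  by have := integrableZl measurableT (l ^+ 2) ifw; apply: eq_integrable.
have i2 : m.-integrable setT (EFin \o (fun x => 2 * l * (f x * h x))).
  by have := integrableZl measurableT (2 * l) ifh; apply: eq_integrable.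
have i12 : m.-integrable setT
    (EFin \o (fun x => l ^+ 2 * (f x ^+ 2 * w x) + 2 * l * (f x * h x))).
  by have := integrableD measurableT i1 i2; apply: eq_integrable.
have : 0 <= \int[m]_x (l ^+ 2 * (f x ^+ 2 * w x) + 2 * l * (f x * h x) + h x ^+ 2 / w x).
  apply: Rintegral_ge0 => x _.
  rewrite (_ : _ + _ = (l * f x * w x + h x) ^+ 2 / w x).
    by rewrite divr_ge0 ?sqr_ge0// ltW.
  by field; rewrite gt_eqF.
rewrite RintegralD// RintegralD// !RintegralZl// -/I -/Q => ge0.
have : l ^+ 2 * P + 2 * l * I + Q >= 0.
  by apply: le_trans ge0 _; rewrite !lerD2r ler_wpM2l ?sqr_ge0.
have -> : l ^+ 2 * P + 2 * l * I + Q = Q - I ^+ 2 / P.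
  by rewrite /l; field; rewrite gt_eqF.
by rewrite subr_ge0 ler_pdivrMr// mulrC.
Qed.

End quadratic_bounds.

(** * Covariance of the kernels of two nodes under a common uniform shift *)

Section shifted_indicator.
Variable R : realType.
Local Notation mu := (@lebesgue_measure R).
Local Notation Phi := (@Phi R).
Implicit Types a b c p x t : R.

Lemma Rintegral_itv01 c e :
  \int[mu]_(x in `]0, 1[) ((c <= x <= e)%R%:R : R) =
  Num.max 0 (Num.min e 1 - Num.max c 0).
Proof.
set lo := Num.max c 0; set hi := Num.min e 1.
have mA : measurable (`[c, e]%classic : set (measurableTypeR R)) by exact: measurable_itv.
have mB : measurable (`]0, 1[%classic : set (measurableTypeR R)) by exact: measurable_itv.
have -> : \int[mu]_(x in `]0, 1[) ((c <= x <= e)%R%:R : R) = fine (mu (`[c, e] `&` `]0, 1[)).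
  rewrite /Rintegral; congr fine; rewrite -integral_indic//.
  by apply: eq_integral => x _; rewrite indicE mem_setE in_itv.
have inhi x : (x <= e) && (x < 1) -> x <= hi by rewrite /hi le_min => /andP[-> /ltW].
have [hl|lh] := ltP hi lo.
  have -> : (`[c, e] `&` `]0, 1[ = set0 :> set R)%classic.
    rewrite -subset0 => x [/=]; rewrite !in_itv/= => /andP[cx xe] /andP[x0 x1].
    move: hl; rewrite ltNge /lo /hi ge_max !le_min.
    by rewrite (le_trans cx xe) (le_trans cx (ltW x1)) (le_trans (ltW x0) xe) ler01.
  by rewrite measure0 /= max_l// subr_le0 ltW.
rewrite max_r ?subr_ge0//.
have len (b1 b2 : bool) : mu [set` Interval (BSide b1 lo) (BSide b2 hi)] = (hi - lo)%:E.
  rewrite lebesgue_measure_itv/= lte_fin; case: ltP => [_|hl]; first by rewrite EFinB.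
  by congr EFin; apply/esym/eqP; rewrite subr_eq0 eq_le hl lh.
have mS : measurable (`[c, e] `&` `]0, 1[ : set (measurableTypeR R)) by exact: measurableI.
suff -> : mu (`[c, e] `&` `]0, 1[) = (hi - lo)%:E by [].
apply/eqP; rewrite eq_le; apply/andP; split.
  rewrite -(len true false); apply: le_measure; rewrite ?inE//.
  move=> x [/=]; rewrite !in_itv/= => /andP[cx xe] /andP[x0 x1].
  by rewrite ge_max le_min cx xe !ltW.
rewrite -(len false true); apply: le_measure; rewrite ?inE//.
move=> x /=; rewrite !in_itv/= gt_max lt_min => /andP[/andP[cx x0] /andP[xe x1]].
by rewrite !ltW// x0 x1.
Qed.

(** The fractional part of a + x for a in [0, 1) and x in (0, 1), in a form whose measurability is
    immediate. *)
Definition shift01 a x : R := if a + x < 1 then a + x else a + x - 1.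

Lemma shift01_frac a x : 0 <= a < 1 -> 0 < x < 1 -> Defs.frac (a + x) = shift01 a x.
Proof.
move=> /andP[a0 a1] /andP[x0 x1]; rewrite /shift01; case: ltP => ax.
  by rewrite frac_id// ax addr_ge0// ltW.
have := @fracDn R (a + x - 1) 1; rewrite subrK => ->; rewrite frac_id//.
by apply/andP; split; lra.
Qed.

Lemma shift01_le a p x : 0 <= a < 1 -> 0 < p < 1 -> 0 < x < 1 ->
  ((shift01 a x <= p)%R%:R : R) =
  (0 <= x <= p - a)%R%:R + (1 - a <= x <= 1 - a + p)%R%:R.
Proof.
move=> /andP[a0 a1] /andP[p0 p1] /andP[x0 x1]; rewrite /shift01 (ltW x0)/=.
have -> : (x <= p - a) = (a + x <= p) by rewrite lerBrDl.
have -> : (1 - a <= x) = (1 <= a + x) by rewrite lerBlDl.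
have -> : (x <= 1 - a + p) = (a + x - 1 <= p) by apply/idP/idP; lra.
case: ltP => ax /=; first by rewrite addr0.
have -> : (a + x <= p) = false by apply/negbTE; rewrite -ltNge; lra.
by rewrite add0r.
Qed.

Let ind_int c e : mu.-integrable `]0, 1[ (EFin \o (fun x => ((c <= x <= e)%R%:R : R))).
Proof.
have mA : measurable (`[c, e]%classic : set (measurableTypeR R)) by exact: measurable_itv.
have mB : measurable (`]0, 1[%classic : set (measurableTypeR R)) by exact: measurable_itv.
have := integrableS measurableT mB (@subsetT _ _) (integrable_indic_itv c e true false).
by apply: eq_integrable => // x _ /=; rewrite indicE mem_setE in_itv.
Qed.

Lemma Rintegral_shift01_le a p : 0 <= a < 1 -> 0 < p < 1 ->
  mu.-integrable `]0, 1[ (EFin \o (fun x => ((shift01 a x <= p)%R%:R : R))) /\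
  \int[mu]_(x in `]0, 1[) ((shift01 a x <= p)%R%:R : R) = p.
Proof.
move=> a01 p01; have mB : measurable (`]0, 1[%classic : set (measurableTypeR R)) by exact: measurable_itv.
split.
  have := integrableD mB (ind_int 0 (p - a)) (ind_int (1 - a) (1 - a + p)).
  apply: eq_integrable => // x; rewrite inE/= in_itv/= => x01.
  by rewrite shift01_le.
rewrite (eq_Rintegral mu (g := fun x => ((0 <= x <= p - a)%R%:R : R) + (1 - a <= x <= 1 - a + p)%R%:R)).
  rewrite RintegralD// !Rintegral_itv01.
  have /andP[a0 a1] := a01; have /andP[p0 p1] := p01.
  rewrite maxxx subr0 (min_l (_ : p - a <= 1)); last by lra.
  rewrite (max_l (_ : 0 <= 1 - a)); last by lra.
  by case: (leP (1 - a + p) 1) => ?; case: (leP 0 (p - a)) => ?; rewrite max_r; lra.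
by move=> x; rewrite inE/= in_itv/= => x01; rewrite shift01_le.
Qed.

Lemma Rintegral_shift01_le2 a b p : 0 <= a < 1 -> 0 <= b < 1 -> 0 < p < 1 ->
  mu.-integrable `]0, 1[ (EFin \o (fun x => ((shift01 a x <= p)%R%:R * (shift01 b x <= p)%R%:R : R))) /\
  \int[mu]_(x in `]0, 1[) ((shift01 a x <= p)%R%:R * (shift01 b x <= p)%R%:R : R) =
  autoc p `|a - b| + p ^+ 2.
Proof.
move=> a01 b01 p01; have mB : measurable (`]0, 1[%classic : set (measurableTypeR R)) by exact: measurable_itv.
wlog ab : a b a01 b01 / a <= b.
  move=> H; have [ab|/ltW ba] := leP a b; first exact: H.
  have [H1 H2] := H _ _ b01 a01 ba; split.
    by move: H1; apply: eq_integrable => // x _ /=; rewrite mulrC.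
  by rewrite distrC -H2; apply: eq_Rintegral => x _; rewrite mulrC.
have /andP[a0 a1] := a01; have /andP[b0 b1] := b01; have /andP[p0 p1] := p01.
(* For a <= b the three intervals correspond to shifts for which neither point wraps around, only b
   does, or both do. *)
have E x : 0 < x < 1 -> (shift01 a x <= p)%R%:R * (shift01 b x <= p)%R%:R =
   (0 <= x <= p - b)%R%:R + (1 - b <= x <= p - a)%R%:R + (1 - a <= x <= 1 - b + p)%R%:R :> R.
  move=> x01; have /andP[x0 x1] := x01; rewrite !shift01_le//.
  have F (u v : R) : v < u -> (u <= v) = false by move=> uv; apply/negbTE; rewrite -ltNge.
  rewrite (ltW x0) /=; have [xb|bx] := ltP x (1 - b).
    rewrite (F (1 - a) x) ?(F (1 - b) x)//=; last by lra.
    rewrite !addr0; case: (leP x (p - b)) => ?; last by rewrite mulr0.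
    by rewrite mulr1; have -> : x <= p - a by lra.
  rewrite (F x (p - b)) /= ?add0r; last by lra.
  have [xa|ax] := ltP x (1 - a).
    rewrite /= !addr0; case: (leP x (p - a)) => ?; last by rewrite mul0r.
    by rewrite mul1r; have -> : x <= 1 - b + p by lra.
  rewrite (F x (p - a)) /= ?add0r; last by lra.
  case: (leP x (1 - b + p)) => ?; last by rewrite mulr0.
  by rewrite mulr1; have -> : x <= 1 - a + p by lra.
split.
  have := integrableD mB (integrableD mB (ind_int 0 (p - b)) (ind_int (1 - b) (p - a)))
    (ind_int (1 - a) (1 - b + p)).
  by apply: eq_integrable => // x; rewrite inE/= in_itv/= => x01; rewrite E.
rewrite (eq_Rintegral mu (g := fun x => ((0 <= x <= p - b)%R%:R : R) + (1 - b <= x <= p - a)%R%:R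
   + (1 - a <= x <= 1 - b + p)%R%:R)); last first.
  by move=> x; rewrite inE/= in_itv/= => x01; rewrite E.
rewrite RintegralD//; last first.
  have := integrableD mB (ind_int 0 (p - b)) (ind_int (1 - b) (p - a)).
  by apply: eq_integrable.
rewrite RintegralD// !Rintegral_itv01 /autoc subrK distrC ger0_norm ?subr_ge0//.
rewrite maxxx subr0 (min_l (_ : p - a <= 1)); last by lra.
rewrite (min_l (_ : p - b <= 1)); last by lra.
rewrite (max_l (_ : 0 <= 1 - a)); last by lra.
rewrite (max_l (_ : 0 <= 1 - b)); last by lra.
rewrite (_ : p - a - (1 - b) = p - 1 + (b - a)); last by ring.
rewrite [Num.max 0 (p - 1 + _)]maxC addrAC; congr (_ + _); rewrite ?subr0.
have [pb|pb] := leP p b.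
  rewrite max_l ?subr_le0// min_l ?add0r; last by lra.
  by rewrite maxC; congr (Num.max _ 0); ring.
rewrite (max_r (_ : 0 <= p - b)); last by lra.
rewrite (min_r (_ : 1 <= 1 - b + p)); last by lra.
rewrite (max_r (_ : 0 <= 1 - (1 - a))); last by lra.
rewrite (max_l (_ : 0 <= p - (b - a))); last by lra.
by ring.
Qed.

Definition shifted_kernel a t x : R := anova_kernel t (quantile (shift01 a x)).

Lemma shifted_kernel_norm_le1 a t x : `|shifted_kernel a t x| <= 1.
Proof. exact: anova_kernel_norm_le1. Qed.

Lemma measurable_shift01 a : measurable_fun setT (shift01 a).
Proof.
rewrite /shift01; apply: measurable_fun_ifT.
- by apply: measurable_fun_ltr => //; exact: measurable_funD.
- exact: measurable_funD.
- by apply: measurable_funB => //; exact: measurable_funD.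
Qed.

Lemma measurable_quantile_shift01 a : measurable_fun setT (fun x => quantile (shift01 a x)).
Proof.
by apply: measurableT_comp; [exact: measurable_quantile|exact: measurable_shift01].
Qed.

Lemma measurable_shifted_kernel a t :
  measurable_fun setT (shifted_kernel a t : measurableTypeR R -> R).
Proof.
apply: measurable_funB => //.
apply: (measurableT_comp (f := fun b : bool => b%:R : R)) => //.
apply: measurable_fun_ler => //; exact: measurable_quantile_shift01.
Qed.

Let mB : measurable (`]0, 1[%classic : set (measurableTypeR R)).
Proof. exact: measurable_itv. Qed.

Let cst_int (k : R) : mu.-integrable `]0, 1[ (EFin \o (fun=> k)).
Proof.
have := integrableZl mB k (ind_int 0 1).
apply: eq_integrable => // x; rewrite inE/= in_itv/= => /andP[x0 x1].
by rewrite /= (ltW x0) (ltW x1) /= ?mulr1 ?mule1.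
Qed.

Lemma integrable_shifted_kernel a b t :
  mu.-integrable `]0, 1[ (EFin \o (fun x => shifted_kernel a t x * shifted_kernel b t x)).
Proof.
apply: le_integrable (cst_int 1) => //.
  apply/measurable_EFinP; apply: measurable_funTS.
  by apply: measurable_funM; exact: measurable_shifted_kernel.
move=> x _ /=; rewrite lee_fin normr1 normrM.
by rewrite mulr_ile1// shifted_kernel_norm_le1.
Qed.

Lemma shifted_kernel_autoc a b t : 0 <= a < 1 -> 0 <= b < 1 ->
  \int[mu]_(x in `]0, 1[) (shifted_kernel a t x * shifted_kernel b t x) =
  autoc (Phi t) `|a - b|.
Proof.
move=> a01 b01; set p := Phi t; have p01 : 0 < p < 1 := Phi01 t.
pose e c x : R := (shift01 c x <= p)%R%:R.
(* At x = 1 - c the shifted point is 0, where [quantile] has its default value; this null set is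
   removed before the kernel is replaced by an indicator. *)
have kE c x : 0 <= c < 1 -> 0 < x < 1 -> x != 1 - c -> shifted_kernel c t x = p - e c x.
  move=> /andP[c0 c1] /andP[x0 x1] xc; rewrite /shifted_kernel /anova_kernel quantile_le//.
  rewrite /shift01; case: (ltP (c + x) 1) => cx; first by rewrite cx andbT ltr_wpDl.
  have : c + x - 1 != 0 by apply: contra xc => /eqP ?; apply/eqP; lra.
  by rewrite lt_def => ->/=; apply/andP; split; lra.
have me c : measurable_fun setT (e c : measurableTypeR R -> R).
  apply: (measurableT_comp (f := fun b : bool => b%:R : R)) => //.
  by apply: measurable_fun_ler => //; exact: measurable_shift01.
transitivity (\int[mu]_(x in `]0, 1[) ((p - e a x) * (p - e b x))).
  rewrite /Rintegral; congr fine; apply: ae_eq_integral => //.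
  - apply/measurable_EFinP; apply: measurable_funTS.
    by apply: measurable_funM; exact: measurable_shifted_kernel.
  - apply/measurable_EFinP; apply: measurable_funTS.
    by apply: measurable_funM; apply: measurable_funB.
  exists ([set 1 - a] `|` [set 1 - b]); split.
  - exact: measurableU.
  - by rewrite measureU0//; exact: lebesgue_measure_set1.
  move=> x /= nx; apply: contrapT => /not_orP[/eqP xa /eqP xb]; apply: nx.
  by rewrite in_itv/= => x01; rewrite !kE.
have [ia va] := Rintegral_shift01_le a01 p01.
have [ib vb] := Rintegral_shift01_le b01 p01.
have [iab vab] := Rintegral_shift01_le2 a01 b01 p01.
have iZ c : mu.-integrable `]0, 1[ (EFin \o e c) ->
    mu.-integrable `]0, 1[ (EFin \o (fun x => - p * e c x)).
  by move=> ic; have := integrableZl mB (- p) ic; apply: eq_integrable.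
rewrite (eq_Rintegral mu (g := fun x => p ^+ 2 + - p * e a x + - p * e b x + e a x * e b x)); last first.
  by move=> x _; ring.
have i1 : mu.-integrable `]0, 1[ (EFin \o (fun x => p ^+ 2 + - p * e a x)).
  by have := integrableD mB (cst_int (p ^+ 2)) (iZ _ ia); apply: eq_integrable.
have i2 : mu.-integrable `]0, 1[ (EFin \o (fun x => p ^+ 2 + - p * e a x + - p * e b x)).
  by have := integrableD mB i1 (iZ _ ib); apply: eq_integrable.
rewrite RintegralD// RintegralD//; last exact: iZ.
rewrite RintegralD//; last exact: iZ.
rewrite !RintegralZl// va vb vab Rintegral_cst//=.
have -> : fine (mu `]0, 1[) = 1 :> R.
  by rewrite lebesgue_measure_itv/= lte01 oppr0 adde0.
by ring.
Qed.

End shifted_indicator.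

(** * The squared averaged kernel and its integral over the shift *)

Section error_kernel.
Variables (R : realType) (s N : nat) (N_gt0 : (0 < N)%N) (z : s.-tuple nat).
Variables (alpha : R) (alpha2 : 2 < alpha).
Local Notation mu := (@lebesgue_measure R).
Local Notation leb := (lebesgue_tuple R).
Local Notation phi := (@phi R).
Local Notation Phi := (@Phi R).

Definition grid_shift (k : nat) (j : 'I_s) : R := ((k * tnth z j) %% N)%:R / N%:R.

Lemma grid_shift01 k j : 0 <= grid_shift k j < 1.
Proof.
by rewrite /grid_shift divr_ge0//= ltr_pdivrMr ?ltr0n// mul1r ltr_nat ltn_mod.
Qed.

Lemma tnth_lattice_node k (Delta : s.-tuple R) j : 0 < tnth Delta j < 1 ->
  tnth (lattice_node N z k Delta) j = quantile (shift01 (grid_shift k j) (tnth Delta j)).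
Proof.
move=> D01; rewrite tnth_mktuple -natrM -shift01_frac// ?grid_shift01//.
congr quantile; rewrite /grid_shift {1}(divn_eq (k * tnth z j) N) natrD natrM.
rewrite -[RHS](fracDn _ ((k * tnth z j) %/ N)); congr Defs.frac; field.
by rewrite pnatr_eq0 -lt0n.
Qed.

(** One coordinate of the product of two kernels divided by the weight: psi^-2 remains if the
    coordinate is in u, and phi phi / phi = phi otherwise. The indicator lets the shift range over
    the whole space. *)
Definition err_factor (b : bool) (c e t x : R) : R :=
  (if b then expR (alpha^-1 * t ^+ 2) * (shifted_kernel c t x * shifted_kernel e t x)
   else phi t) * ((0 < x < 1)%R%:R).

(* Expanded over pairs of nodes, so that Tonelli factorizes it over coordinates;
   err_kernel_in gives the closed form on the cube. *)
Definition err_kernel (v : s.-tuple bool) (t Delta : s.-tuple R) : R :=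
  \sum_(k < N) \sum_(l < N) N%:R ^- 2 *
    \prod_(j < s) err_factor (tnth v j) (grid_shift k j) (grid_shift l j)
                             (tnth t j) (tnth Delta j).

(** This is psi_u^2 phi_(-u), as psi^2 = exp(- t^2 / alpha). *)
Definition err_weight (v : s.-tuple bool) (t : s.-tuple R) : R :=
  \prod_(j < s) (if tnth v j then expR (- (alpha^-1 * tnth t j ^+ 2)) else phi (tnth t j)).

Lemma err_weight_gt0 v t : 0 < err_weight v t.
Proof. by apply: prodr_gt0 => j _; case: ifP => _; rewrite ?expR_gt0 ?phi_gt0. Qed.

Lemma err_kernel_in v t Delta : open_cube Delta ->
  err_kernel v t Delta =
  (N%:R^-1 * \sum_(k < N) anova_weight v t (lattice_node N z k Delta)) ^+ 2 / err_weight v t.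
Proof.
move=> D01; rewrite exprMn exprVn [X in _ * X / _]expr2 mulr_suml mulr_sumr mulr_suml.
apply: eq_bigr => k _; rewrite !mulr_sumr mulr_suml; apply: eq_bigr => l _.
rewrite -mulrA; congr (_ * _).
rewrite /anova_weight /err_weight -big_split/= -prodf_div; apply: eq_bigr => j _.
rewrite /err_factor (D01 j) mulr1 /anova_factor !tnth_lattice_node//; case: ifP => _.
  by rewrite expRN invrK mulrC.
by rewrite mulfK// gt_eqF// phi_gt0.
Qed.

Lemma err_kernel_out v t Delta : ~ open_cube Delta -> err_kernel v t Delta = 0.
Proof.
move=> /existsNP[j /negP /negbTE Dj].
rewrite /err_kernel big1// => k _; rewrite big1// => l _.
by rewrite (bigD1 j)//= /err_factor Dj mulr0 mul0r mulr0.
Qed.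

Lemma err_kernel_ge0 v t Delta : 0 <= err_kernel v t Delta.
Proof.
have [D01|D01] := pselect (open_cube Delta); last by rewrite err_kernel_out.
by rewrite err_kernel_in// divr_ge0 ?sqr_ge0// ltW// err_weight_gt0.
Qed.

Let alphaV : 0 < alpha^-1 < 2^-1.
Proof.
have a0 : 0 < alpha := lt_trans (ltr0Sn _ 1) alpha2.
by rewrite invr_gt0 a0 ltf_pV2 ?posrE.
Qed.

Lemma integrable_err_factor_t b c e x :
  mu.-integrable setT (EFin \o (fun t => err_factor b c e t x)).
Proof.
suff H : mu.-integrable setT (EFin \o (fun t => if b then expR (alpha^-1 * t ^+ 2) *
    (shifted_kernel c t x * shifted_kernel e t x) else phi t)).
  have := integrableZr measurableT ((0 < x < 1)%R%:R : R) H.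
  by apply: eq_integrable.
case: b; last exact: integrable_phi.
have := integrable_anova_factor true (quantile (shift01 c x)) alphaV.
apply: le_integrable => //.
  apply/measurable_EFinP; apply: measurable_funM; first exact: measurable_expR_sqr.
  by apply: measurable_funM; exact: measurable_anova_kernel.
move=> t _ /=; rewrite lee_fin !normrM ler_wpM2l// ler_piMr//.
exact: anova_kernel_norm_le1.
Qed.

Lemma integrable_err_kernel_t v Delta :
  (leb s).-integrable setT (EFin \o (fun t => err_kernel v t Delta)).
Proof.
apply: integrable_rsum => k; apply: integrable_rsum => l.
have [intp _] := prod_tnth (fun j : 'I_s => integrable_err_factor_t (tnth v j)
  (grid_shift k j) (grid_shift l j) (tnth Delta j)).
by have := integrableZl measurableT (N%:R ^- 2) intp; apply: eq_integrable.
Qed.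

Lemma err_factor_x b c e t : 0 <= c < 1 -> 0 <= e < 1 ->
  mu.-integrable setT (EFin \o err_factor b c e t) /\
  \int[mu]_x err_factor b c e t x =
    if b then autoc (Phi t) `|c - e| * expR (alpha^-1 * t ^+ 2) else phi t.
Proof.
move=> c01 e01.
pose f x := if b then expR (alpha^-1 * t ^+ 2) * (shifted_kernel c t x * shifted_kernel e t x)
  else phi t.
have mB : measurable (`]0, 1[%classic : set (measurableTypeR R)) by exact: measurable_itv.
have E : err_factor b c e t = f \_ `]0, 1[.
  apply/funext => x; rewrite patchE /err_factor mem_setE in_itv/= -/(f x).
  by case: ifP => _; rewrite ?mulr1 ?mulr0.
have intf : mu.-integrable `]0, 1[ (EFin \o f).
  rewrite /f; case: b {f E}.
    have := integrableZl mB (expR (alpha^-1 * t ^+ 2)) (integrable_shifted_kernel c e t).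
    by apply: eq_integrable.
  have := integrableZl mB (phi t) (integrableS measurableT mB (@subsetT _ _) (integrable_indic_itv 0 1 true false)).
  apply: eq_integrable => // x; rewrite inE/= => x01 /=; rewrite indicE mem_set ?mule1 ?mulr1//=.
  by move: x01; rewrite !in_itv/= => /andP[x0 x1]; rewrite !ltW.
split; rewrite E.
  have := (integrable_mkcond _ mB).1 intf.
  by rewrite -restrict_EFin.
rewrite -Rintegral_mkcond /f; case: b {f E intf}.
  by rewrite RintegralZl//; [rewrite shifted_kernel_autoc// mulrC|exact: integrable_shifted_kernel].
have one : fine (mu `]0, 1[) = 1 :> R.
  by rewrite lebesgue_measure_itv/= lte01 oppr0 adde0.
by rewrite Rintegral_cst//= one mulr1.
Qed.

Definition shift_mean (v : s.-tuple bool) : R :=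
  \sum_(k < N) \sum_(l < N) N%:R ^- 2 *
    \prod_(j < s) (if tnth v j
      then theta (gauss_weight alpha) `|grid_shift k j - grid_shift l j| else 1).

Lemma measurable_err_kernel v :
  measurable_fun setT (fun p : s.-tuple R * s.-tuple R => err_kernel v p.2 p.1).
Proof.
have m1 (j : 'I_s) : measurable_fun setT (fun p : s.-tuple R * s.-tuple R => tnth p.1 j).
  exact: (measurableT_comp (measurable_tnthR j) measurable_fst).
have m2 (j : 'I_s) : measurable_fun setT (fun p : s.-tuple R * s.-tuple R => tnth p.2 j).
  exact: (measurableT_comp (measurable_tnthR j) measurable_snd).
have mb (f : s.-tuple R * s.-tuple R -> bool) : measurable_fun setT f ->
    measurable_fun setT (fun p => (f p)%:R : R).
  by move=> mf; apply: (measurableT_comp (f := fun b : bool => b%:R : R)).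
have mk c j : measurable_fun setT
    (fun p : s.-tuple R * s.-tuple R => shifted_kernel c (tnth p.2 j) (tnth p.1 j)).
  apply: measurable_funB.
    apply: (measurableT_comp (f := Phi)); last exact: m2.
    by apply: continuous_measurable_fun; exact: continuous_Phi.
  apply: mb; apply: measurable_fun_ler; last exact: m2.
  apply: (measurableT_comp (f := fun x => quantile (shift01 c x))); last exact: m1.
  exact: measurable_quantile_shift01.
apply: measurable_sum => k; apply: measurable_sum => l; apply: measurable_funM => //.
apply: measurable_prod => j _; apply: measurable_funM.
  case: (tnth v j).
    apply: measurable_funM; last by apply: measurable_funM; exact: mk.
    apply: measurableT_comp; first exact: measurable_expR.
    by apply: measurable_funM => //; apply: measurable_funX; exact: m2.
  apply: (measurableT_comp (f := phi)); last exact: m2.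
  by apply: continuous_measurable_fun; exact: continuous_phi.
apply: mb; apply: measurable_and; exact: measurable_fun_ltr.
Qed.

(** By Tonelli the shift is integrated first, which turns each factor in u into the autocovariance
    at Phi t; integration over t then gives theta. *)
Lemma integral_err_kernel v :
  (\int[leb s]_Delta \int[leb s]_t (err_kernel v t Delta)%:E = (shift_mean v)%:E)%E.
Proof.
pose F (p : s.-tuple R * s.-tuple R) := (err_kernel v p.2 p.1)%:E.
have mF : measurable_fun setT F by apply/measurable_EFinP; exact: measurable_err_kernel.
have F0 p : (0 <= F p)%E by rewrite lee_fin err_kernel_ge0.
rewrite [LHS](@fubini_tonelli _ _ _ _ _ (leb s) (leb s) F mF F0) /F /=.
pose h b k l (j : 'I_s) t : R := if b then
  autoc (Phi t) `|grid_shift k j - grid_shift l j| * expR (alpha^-1 * t ^+ 2) else phi t.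
have inner t : (\int[leb s]_Delta (err_kernel v t Delta)%:E =
    (\sum_(k < N) \sum_(l < N) N%:R ^- 2 * \prod_(j < s) h (tnth v j) k l j (tnth t j))%:E)%E.
  have P k l := prod_tnth (fun j : 'I_s => (err_factor_x (tnth v j) (tnth t j)
      (grid_shift01 k j) (grid_shift01 l j)).1).
  have iP k l : (leb s).-integrable setT (EFin \o (fun Delta : s.-tuple R => N%:R ^- 2 *
    \prod_(j < s) err_factor (tnth v j) (grid_shift k j) (grid_shift l j) (tnth t j) (tnth Delta j))).
    by have := integrableZl measurableT (N%:R ^- 2) (P k l).1; apply: eq_integrable.
  have iK : (leb s).-integrable setT (EFin \o err_kernel v t).
    by apply: integrable_rsum => k; apply: integrable_rsum => l.
  rewrite -[LHS]fineK; last exact: (integrable_fin_num measurableT iK).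
  rewrite -/(Rintegral (leb s) setT (err_kernel v t)); congr EFin.
  rewrite /err_kernel Rintegral_sum => [|k]; last by apply: integrable_rsum => l.
  apply: eq_bigr => k _; rewrite Rintegral_sum//; apply: eq_bigr => l _.
  rewrite RintegralZl//; last exact: (P k l).1.
  congr (_ * _); rewrite (P k l).2; apply: eq_bigr => j _.
  by have [_ ->] := err_factor_x (tnth v j) (tnth t j) (grid_shift01 k j) (grid_shift01 l j).
under eq_integral => t _ do rewrite inner.
have ih b k l j : mu.-integrable setT (EFin \o h b k l j).
  rewrite /h; case: b; last exact: integrable_phi.
  apply: integrable_theta => //; rewrite normr_ge0/= ler_norml.
  by have := grid_shift01 k j; have := grid_shift01 l j; lra.
have P k l := prod_tnth (fun j : 'I_s => ih (tnth v j) k l j).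
have iP k l : (leb s).-integrable setT (EFin \o (fun t : s.-tuple R => N%:R ^- 2 *
    \prod_(j < s) h (tnth v j) k l j (tnth t j))).
  by have := integrableZl measurableT (N%:R ^- 2) (P k l).1; apply: eq_integrable.
rewrite -[LHS]fineK; last first.
  have iK : (leb s).-integrable setT (EFin \o (fun t : s.-tuple R =>
      \sum_(k < N) \sum_(l < N) N%:R ^- 2 * \prod_(j < s) h (tnth v j) k l j (tnth t j))).
    by apply: integrable_rsum => k; apply: integrable_rsum => l.
  exact: (integrable_fin_num measurableT iK).
congr EFin; rewrite -/(Rintegral (leb s) setT _).
rewrite Rintegral_sum => [|k]; last by apply: integrable_rsum => l.
apply: eq_bigr => k _; rewrite Rintegral_sum//; apply: eq_bigr => l _.
rewrite RintegralZl//; last exact: (P k l).1.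
congr (_ * _); rewrite (P k l).2; apply: eq_bigr => j _; rewrite /h.
case: ifP => _; first by rewrite thetaE.
exact: Rintegral_phi.
Qed.

End error_kernel.

(** * From pairs of nodes to single nodes *)

Section shift_mean.
Variables (R : realType) (s N : nat) (N_gt0 : (0 < N)%N) (z : s.-tuple nat).
Variables (alpha : R) (alpha2 : 2 < alpha).
Local Notation psi := (gauss_weight alpha).
Let ah := dft N (fun m => theta psi (m%:R / N%:R)).

Definition tuple_set (v : s.-tuple bool) : {set 'I_s} := [set j | tnth v j]%SET.

Let tg (m : nat) : R := theta_grid N ah m.

Let tg_modn m : tg (m %% N) = tg m.
Proof.
rewrite /tg /theta_grid; apply: eq_bigr => h _.
by rewrite -cosm_modn// modnMmr cosm_modn.
Qed.

(** The distance of two grid points is the residue of (k - l) z_j over N or its reflection, and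
    theta does not see the reflection. [k + N - l] keeps the difference a natural number. *)
Let theta_shift (k l : 'I_N) j :
  theta psi `|grid_shift R N z k j - grid_shift R N z l j| = tg ((k + N - l) * tnth z j).
Proof.
rewrite /tg -(@theta_gridE R psi N N_gt0 (theta_refl alpha2)) frac_ratio//.
rewrite /grid_shift -mulrBl; set x := (k * tnth z j)%N; set y := (l * tnth z j)%N.
have N0 : N%:R != 0 :> R by rewrite pnatr_eq0 -lt0n.
have xN : (x %% N < N)%N by rewrite ltn_mod.
have yN : (y %% N < N)%N by rewrite ltn_mod.
have E : ((k + N - l) * tnth z j = x %% N + (N - y %% N) %[mod N])%N.
  apply/eqP; rewrite -(eqn_modDr y); apply/eqP.
  have -> : ((k + N - l) * tnth z j + y = x + tnth z j * N)%N.
    rewrite /x /y mulnBl mulnDl subnK; last first.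
      by rewrite -mulnDl leq_mul2r (leq_trans (ltnW (ltn_ord l)) (leq_addl _ _)) orbT.
    by rewrite (mulnC N).
  have -> : (x %% N + (N - y %% N) + y = x %% N + (y %/ N).+1 * N)%N.
    have := divn_eq y N; move: (y %/ N)%N (y %% N)%N yN => q r rN ye.
    by rewrite [in LHS]ye mulSn; move: (q * N)%N (x %% N)%N => a b; lia.
  by rewrite ![(_ + _ * N)%N]addnC !modnMDl modn_mod.
rewrite E; move: xN yN; move: (x %% N)%N (y %% N)%N => a b aN bN.
have [ba|ab] := leqP b a.
  have -> : ((a + (N - b)) %% N = a - b)%N.
    rewrite (_ : (_ + _ = (a - b) + 1 * N)%N); last by lia.
    by rewrite addnC modnMDl modn_small//; lia.
  by rewrite natrB// ger0_norm// divr_ge0// subr_ge0 ler_nat.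
rewrite modn_small; last by lia.
rewrite natrD natrB; last by lia.
rewrite ltr0_norm; last first.
  by rewrite pmulr_llt0 ?invr_gt0 ?ltr0n// subr_lt0 ltr_nat.
rewrite -[LHS](theta_refl alpha2); congr theta; field.
exact: N0.
Qed.

Lemma sum_periodic (F : nat -> R) c : (forall m, F (m %% N)%N = F m) ->
  \sum_(k < N) F (k + c)%N = \sum_(k < N) F k.
Proof.
move=> FN; elim: c => [|c IH]; first by apply: eq_bigr => k _; rewrite addn0.
rewrite -IH; case: N N_gt0 FN => // N' _ FN'.
rewrite big_ord_recr [RHS]big_ord_recl/= addrC; congr (_ + _).
  by rewrite -FN' addnS -addSn addnC modnDr FN' add0n.
by apply: eq_bigr => k _; rewrite /bump/= add1n addnS addSn.
Qed.

(** The nodes of a lattice rule form a group, so for fixed l the differences k - l run through all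
    residues and the double mean collapses. *)
Lemma shift_mean_grid v : shift_mean N z alpha v =
  grid_mean N ah [seq tnth z j | j <- enum (tuple_set v)].
Proof.
have N0 : N%:R != 0 :> R by rewrite pnatr_eq0 -lt0n.
pose F m := \prod_(x <- [seq tnth z j | j <- enum (tuple_set v)]) tg (m * x).
have FN m : F (m %% N)%N = F m.
  by apply: eq_bigr => x _; rewrite -tg_modn modnMml tg_modn.
rewrite /shift_mean exchange_big/=.
transitivity (\sum_(l < N) N%:R ^- 2 * \sum_(k < N) F k).
  apply: eq_bigr => l _; rewrite -mulr_sumr; congr (_ * _).
  rewrite -(@sum_periodic F (N - l)%N FN); apply: eq_bigr => k _.
  rewrite /F big_map big_enum/= big_mkcond [RHS]big_mkcond/=.
  apply: eq_bigr => j _; rewrite inE; case: ifP => // _.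
  by rewrite theta_shift addnBA// ltnW.
by rewrite sumr_const card_ord -[LHS]mulr_natl /grid_mean -/tg; field.
Qed.

End shift_mean.

(** * Mean square error bounded by the criterion of the construction *)

Section lattice_error.
Variables (R : realType) (s : nat) (G : s.-tuple R -> R) (B M alpha : R).
Hypothesis B_gt0 : 0 < B.
Hypothesis M_gt0 : 0 < M.
Hypothesis M_lt : M < 4^-1.
Hypothesis G_diff : has_mixed_partials G.
Hypothesis G_bound : forall (u : {set 'I_s}) (z : s.-tuple R),
  `|mixed_partial u G z| <= B * expR (M * \sum_(j < s) tnth z j ^+ 2).
Hypothesis alpha2 : 2 < alpha.
Hypothesis alphaM : 2 * M < alpha^-1.
Local Notation mu := (@lebesgue_measure R).
Local Notation leb := (lebesgue_tuple R).

Let g (v : s.-tuple bool) := mixed_partial (tuple_set v) G.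

Let mg v : measurable_fun setT (g v).
Proof. exact: measurable_mixed_partial. Qed.

Let M01 : 0 < M < 2^-1.
Proof. by rewrite M_gt0 (lt_trans M_lt)// ltf_pV2 ?posrE// ltr_nat. Qed.

Let M201 : 0 < 2 * M < 2^-1.
Proof. by have M4 := M_lt; rewrite mulr_gt0//=; lra. Qed.

Let rep x : G x =
  \sum_(v : s.-tuple bool) \int[leb s]_t (g v t * anova_weight v t x).
Proof.
have -> : G x = g [tuple of nseq s false] x.
  rewrite /g (_ : tuple_set _ = finset.set0) ?mixed_partial0//.
  by apply/setP => j; rewrite !inE (tnth_nth false) /= nth_nseq ltn_ord.
apply: (anova_representation M01 mg (fun v => G_bound (tuple_set v))).
move=> v j t vj; have ju i : i \in tuple_set v -> (j < i)%N.
  by rewrite inE ltnNge => vi; apply/negP => /vj; rewrite vi.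
split; first exact: (G_diff ju).
rewrite /g (_ : tuple_set (upd v j true) = (j |: tuple_set v)%SET) ?mixed_partial_setU1//.
by apply/setP => i; rewrite !inE tnth_upd; case: eqP.
Qed.

(** Coordinates in u need 2 M < 1 / alpha, the others need 2 M < 1 / 2, which is the condition M < 1
    / 4. *)
Let integrable_sqr v :
  (leb s).-integrable setT (EFin \o (fun t => g v t ^+ 2 * err_weight alpha v t)).
Proof.
pose f (b : bool) (t : R) := expR (2 * M * t ^+ 2) *
  (if b then expR (- (alpha^-1 * t ^+ 2)) else phi t).
have fi b : mu.-integrable setT (EFin \o f b).
  rewrite /f; case: b; last exact: (integrable_anova_factor false 0 M201).
  have c0 : 0 < alpha^-1 - 2 * M by rewrite subr_gt0.
  have := integrable_expR_sqr c0; apply: eq_integrable => // t _ /=.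
  by rewrite -expRD; congr (expR _)%:E; ring.
have [intp _] := prod_tnth (fun j : 'I_s => fi (tnth v j)).
apply: le_integrable (integrableZl measurableT (B ^+ 2) intp) => //.
  apply/measurable_EFinP; apply: measurable_funM; first by apply: measurable_funX; exact: mg.
  apply: measurable_prod => j _; case: (tnth v j).
    apply: measurableT_comp; first exact: measurable_expR.
    apply: measurableT_comp => //; apply: measurable_funM => //.
    by apply: measurable_funX; exact: measurable_tnthR.
  apply: (measurableT_comp (f := @phi R)); last exact: measurable_tnthR.
  by apply: continuous_measurable_fun; exact: continuous_phi.
move=> t _ /=; have w0 := err_weight_gt0 alpha v t.
rewrite lee_fin big_split/= -/(err_weight alpha v t) -expR_sum_sqr mulrA.
rewrite [leLHS]normrM [leRHS]normrM ler_wpM2r//; set S := \sum_(j < s) _.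
rewrite ger0_norm ?sqr_ge0// ger0_norm; last by rewrite mulr_ge0 ?sqr_ge0 ?expR_ge0.
rewrite (_ : expR (2 * M * S) = expR (M * S) ^+ 2); last by rewrite -expRM_natl mulrA.
rewrite -exprMn -(real_normK (num_real (g v t))).
rewrite ler_sqr ?nnegrE ?mulr_ge0 ?expR_ge0 ?(ltW B_gt0)//.
exact: G_bound.
Qed.

(* The added 1 only makes the moment positive. *)
Definition error_moment (v : s.-tuple bool) : R :=
  \int[leb s]_t (mixed_partial (tuple_set v) G t ^+ 2 * err_weight alpha v t) + 1.
Local Notation P := error_moment.

Let P_gt0 v : 0 < P v.
Proof.
apply: ltr_wpDl => //; apply: Rintegral_ge0 => t _.
by rewrite mulr_ge0 ?sqr_ge0// ltW// err_weight_gt0.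
Qed.

Section fixed_rule.
Variables (N : nat) (N_gt0 : (0 < N)%N) (z : s.-tuple nat).

Let zero_v : s.-tuple bool := [tuple of nseq s false].

(** The term of the empty set is the same at every node and equals I(G), so it cancels. The
    cardinality comes from Cauchy-Schwarz for the finite sum over the remaining sets. *)
Let err_le Delta : open_cube Delta ->
  (Iphi G - lattice_rule N z G Delta) ^+ 2 <=
  #|[pred v : s.-tuple bool | v != zero_v]|%:R *
    \sum_(v : s.-tuple bool | v != zero_v) P v *
      \int[leb s]_t err_kernel N z alpha v t Delta.
Proof.
move=> D01.
have N0 : N%:R != 0 :> R by rewrite pnatr_eq0 -lt0n.
pose x k := lattice_node N z k Delta.
pose h v t := N%:R^-1 * \sum_(k < N) anova_weight v t (x k).
have ia v k : (leb s).-integrable setT (EFin \o (fun t => g v t * anova_weight v t (x k))).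
  exact: (integrable_anova_term v (x k) M01 (mg v) (G_bound (tuple_set v))).
have isum v : (leb s).-integrable setT
    (EFin \o (fun t => \sum_(k < N) g v t * anova_weight v t (x k))).
  by apply: integrable_rsum => k.
have hE v t : g v t * h v t = N%:R^-1 * \sum_(k < N) g v t * anova_weight v t (x k).
  by rewrite /h mulrCA mulr_sumr.
have ih v : (leb s).-integrable setT (EFin \o (fun t => g v t * h v t)).
  have := integrableZl measurableT N%:R^-1 (isum v).
  by apply: eq_integrable => // t _ /=; rewrite hE.
have ruleE : lattice_rule N z G Delta = \sum_v \int[leb s]_t (g v t * h v t).
  rewrite /lattice_rule.
  under eq_bigr => k _ do rewrite rep.
  rewrite exchange_big/= mulr_sumr; apply: eq_bigr => v _.
  transitivity (\int[leb s]_t (N%:R^-1 * \sum_(k < N) g v t * anova_weight v t (x k))).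
    by rewrite RintegralZl// Rintegral_sum.
  by apply: eq_Rintegral => t _; rewrite hE.
have I0 : \int[leb s]_t (g zero_v t * h zero_v t) = Iphi G.
  apply: eq_Rintegral => t _; rewrite /g (_ : tuple_set _ = finset.set0); last first.
    by apply/setP => j; rewrite !inE (tnth_nth false) /= nth_nseq ltn_ord.
  rewrite mixed_partial0; congr (_ * _); rewrite /h.
  rewrite (eq_bigr (fun=> prodf (@phi R) t)) => [|k _].
    by rewrite sumr_const card_ord -[prodf _ t *+ N]mulr_natl mulrA mulVf// mul1r.
  apply: eq_bigr => j _; rewrite (tnth_nth false) /= nth_nseq ltn_ord.
  by [].
rewrite ruleE (bigD1 zero_v)//= I0 opprD addrA subrr add0r sqrrN.
apply: le_trans (sqr_sum_le _ _) _; rewrite ler_wpM2l//.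
apply: ler_sum => v _.
have kE t : err_kernel N z alpha v t Delta = h v t ^+ 2 / err_weight alpha v t.
  by rewrite err_kernel_in.
have -> : \int[leb s]_t err_kernel N z alpha v t Delta =
    \int[leb s]_t (h v t ^+ 2 / err_weight alpha v t).
  by apply: eq_Rintegral => t _; rewrite kE.
apply: sqr_Rintegral_le => //.
- by move=> t; exact: err_weight_gt0.
- have := integrable_err_kernel_t N z alpha2 v Delta.
  by apply: eq_integrable => // t _ /=; rewrite kE.
- by rewrite /error_moment lerDl.
Qed.

(** A stand-in that agrees with the node on the open cube and is measurable on the whole space. *)
Let node' k (Delta : s.-tuple R) : s.-tuple R :=
  [tuple quantile (shift01 (grid_shift R N z k j) (tnth Delta j)) | j < s].

Let node'E k Delta : open_cube Delta -> lattice_node N z k Delta = node' k Delta.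
Proof.
move=> D01; apply: eq_from_tnth => j.
by rewrite tnth_lattice_node// tnth_mktuple.
Qed.

Let mnode' k : measurable_fun setT (node' k).
Proof.
apply/measurable_fun_tnthP => j.
rewrite (_ : _ \o _ = (fun x => quantile (shift01 (grid_shift R N z k j) x)) \o
    (fun z => tnth z j)).
  by apply: measurableT_comp; [exact: measurable_quantile_shift01|exact: measurable_tnthR].
by apply/funext => Delta /=; rewrite tnth_mktuple.
Qed.

Let mcube : measurable (@open_cube R s).
Proof.
rewrite (_ : @open_cube R s =
    ~` \bigcup_(j : 'I_s) ((fun z : s.-tuple R => tnth z j) @^-1` ~` `]0, 1[)).
  apply: measurableC; apply: countable_bigcupT_measurable; first exact: countableP.
  move=> j; rewrite -[X in measurable X]setTI.
  by apply: measurable_tnthR => //; apply: measurableC; exact: measurable_itv.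
apply/seteqP; split => Delta /= D; first by move=> [j _] /=; rewrite in_itv/= D.
move=> j; apply/negPn/negP => Dj; apply: D; exists j => //=.
by rewrite in_itv/=; exact/negP.
Qed.

Lemma lattice_error_moment :
  (\int[leb s]_(Delta in @open_cube R s)
      (`|Iphi G - lattice_rule N z G Delta| ^+ 2)%:E <=
   (#|[pred v : s.-tuple bool | v != [tuple of nseq s false]]|%:R *
     \sum_(v : s.-tuple bool | v != [tuple of nseq s false])
       P v * shift_mean N z alpha v)%:E)%E.
Proof.
set c : R := _%:R.
pose E Delta := (Iphi G - N%:R^-1 * \sum_(k < N) G (node' k Delta)) ^+ 2.
pose F v Delta := (\int[leb s]_t (err_kernel N z alpha v t Delta)%:E)%E.
have F0 v Delta : (0 <= F v Delta)%E.
  by apply: integral_ge0 => t _; rewrite lee_fin err_kernel_ge0.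
have FE v Delta : F v Delta = (\int[leb s]_t err_kernel N z alpha v t Delta)%:E.
  rewrite -[LHS]fineK//.
  exact: (integrable_fin_num measurableT (integrable_err_kernel_t N z alpha2 v Delta)).
have mF v : measurable_fun setT (F v).
  apply: (@measurable_fun_fubini_tonelli_F _ _ _ _ _ (leb s)
    (fun p : s.-tuple R * s.-tuple R => (err_kernel N z alpha v p.2 p.1)%:E)).
    by apply/measurable_EFinP; exact: measurable_err_kernel.
  by move=> p; rewrite lee_fin err_kernel_ge0.
pose r := [seq v <- index_enum (s.-tuple bool) | v != zero_v].
pose H Delta := (c%:E * \sum_(v <- r) (P v)%:E * F v Delta)%E.
have PF0 v Delta : (0 <= (P v)%:E * F v Delta)%E.
  by rewrite mule_ge0// lee_fin ltW.
have H0 Delta : (0 <= H Delta)%E by rewrite mule_ge0 ?lee_fin// sume_ge0.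
have mPF v : measurable_fun setT (fun Delta => (P v)%:E * F v Delta)%E.
  exact: measurable_funeM.
have mS : measurable_fun setT (fun Delta => \sum_(v <- r) (P v)%:E * F v Delta)%E.
  exact: emeasurable_sum.
have mH : measurable_fun setT H by exact: measurable_funeM.
have mE : measurable_fun setT E.
  apply: measurable_funX; apply: measurable_funB => //; apply: measurable_funM => //.
  apply: measurable_sum => k.
  by apply: measurableT_comp (mnode' k); exact: measurable_has_mixed_partials.
have -> : (\int[leb s]_(Delta in @open_cube R s)
      (`|Iphi G - lattice_rule N z G Delta| ^+ 2)%:E =
    \int[leb s]_(Delta in @open_cube R s) (E Delta)%:E)%E.
  apply: eq_integral => Delta; rewrite inE => D01; rewrite real_normK ?num_real//.
  rewrite /E /lattice_rule; under eq_bigr => k _ do rewrite node'E//.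
  by [].
apply: (@le_trans _ _ (\int[leb s]_(Delta in @open_cube R s) H Delta)%E).
  apply: ge0_le_integral => //.
  - by move=> Delta _; rewrite lee_fin sqr_ge0.
  - by apply/measurable_EFinP; exact: measurable_funS mE.
  - exact: measurable_funS mH.
  - move=> Delta D01; rewrite /H; under eq_bigr => v _ do rewrite FE -EFinM.
    rewrite /r big_filter sumEFin -EFinM lee_fin; apply: le_trans (err_le D01).
    rewrite /E /lattice_rule; under [in leRHS]eq_bigr => k _ do rewrite node'E//.
    by [].
(* Enlarging the domain loses nothing, since [err_kernel] vanishes off the cube. *)
apply: (@le_trans _ _ (\int[leb s]_Delta H Delta)%E).
  exact: ge0_subset_integral.
rewrite ge0_integralZl ?lee_fin//; last by move=> Delta _; exact: sume_ge0.
rewrite ge0_integral_sum// big_filter.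
under eq_bigr => v _.
  rewrite ge0_integralZl// ?lee_fin ?(ltW (P_gt0 v))//.
  rewrite (integral_err_kernel N_gt0 z alpha2) -EFinM.
  over.
by rewrite sumEFin -EFinM.
Qed.

End fixed_rule.

Lemma lattice_error_le : exists2 C : R, 0 <= C &
  forall (N : nat) (z : s.-tuple nat), (0 < N)%N ->
  (\int[leb s]_(Delta in @open_cube R s)
      (`|Iphi G - lattice_rule N z G Delta| ^+ 2)%:E <=
   (C * \sum_(u : {set 'I_s} | u != finset.set0)
     grid_mean N (dft N (fun m => theta (gauss_weight alpha) (m%:R / N%:R)))
       [seq tnth z j | j <- enum u])%:E)%E.
Proof.
set c : R := #|[pred v : s.-tuple bool | v != [tuple of nseq s false]]|%:R.
have SP : 0 <= \sum_v P v by apply: sumr_ge0 => v _; rewrite ltW.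
exists (c * \sum_v P v); first by rewrite mulr_ge0.
move=> N z N_gt0; apply: le_trans (lattice_error_moment N_gt0 z) _.
rewrite lee_fin -mulrA ler_wpM2l// mulr_sumr.
have tb : bijective (@tuple_set s).
  exists (fun u : {set 'I_s} => [tuple j \in u | j < s]) => [v|u].
    by apply: eq_from_tnth => j; rewrite tnth_mktuple inE.
  by apply/setP => j; rewrite inE tnth_mktuple.
rewrite [leRHS](reindex (@tuple_set s)) /=; last exact: onW_bij.
rewrite [leRHS](eq_bigl (fun v => v != [tuple of nseq s false])); last first.
  move=> v; rewrite -(inj_eq (bij_inj tb)); congr (_ != _).
  by apply/esym/setP => j; rewrite !inE (tnth_nth false) /= nth_nseq ltn_ord.
apply: ler_sum => v _; rewrite -(shift_mean_grid N_gt0 z alpha2).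
apply: ler_wpM2r; last by rewrite (bigD1 v)//= lerDl sumr_ge0// => w _; rewrite ltW.
rewrite -lee_fin -(integral_err_kernel N_gt0 z alpha2 v).
by apply: integral_ge0 => D _; apply: integral_ge0 => t _; rewrite lee_fin err_kernel_ge0.
Qed.

End lattice_error.

(** * Membership in the function space *)

Section norm_finite.
Variables (R : realType) (s : nat).
Local Notation mu := (@lebesgue_measure R).
Local Notation leb := (lebesgue_tuple R).
Local Notation phi := (@phi R).
Implicit Types u : {set 'I_s}.

Lemma glue_sum u (x : #|u|.-tuple R) (y : #|~: u|.-tuple R) (h : R -> R) :
  \sum_(j < s) h (tnth (Defs.glue x y) j) =
  \sum_(i < #|u|) h (tnth x i) + \sum_(i < #|~: u|) h (tnth y i).
Proof.
have E (w : {set 'I_s}) (t : #|w|.-tuple R) :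
    \sum_(j in w) h (nth 0 t (index j (enum w))) = \sum_(i < #|w|) h (tnth t i).
  rewrite big_enum_val; apply: eq_bigr => i _; rewrite (tnth_nth 0); congr (h (nth _ _ _)).
  by rewrite (enum_val_nth (enum_default i)) index_uniq ?enum_uniq// -cardE.
rewrite (bigID (mem u))/= -!E; congr (_ + _).
  by apply: eq_bigr => j ju; rewrite tnth_mktuple ju.
by apply: eq_big => [j|j ju]; rewrite ?inE// tnth_mktuple (negbTE ju).
Qed.

Lemma measurable_glue u : measurable_fun setT
  (fun p : #|u|.-tuple R * #|~: u|.-tuple R => Defs.glue p.1 p.2).
Proof.
apply/measurable_fun_tnthP => j.
have nthE (w : {set 'I_s}) (jw : j \in w) : exists i : 'I_#|w|,
    forall t : #|w|.-tuple R, nth 0 t (index j (enum w)) = tnth t i.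
  have iw : (index j (enum w) < #|w|)%N by rewrite cardE index_mem mem_enum.
  by exists (Ordinal iw) => t; rewrite (tnth_nth 0).
have [ju|ju] := boolP (j \in u).
  have [i iE] := nthE u ju.
  rewrite (_ : _ \o _ = (fun t : #|u|.-tuple R => tnth t i) \o fst).
    exact: (measurableT_comp (measurable_tnthR i) measurable_fst).
  by apply/funext => p /=; rewrite tnth_mktuple ju iE.
have jc : j \in (~: u)%SET by rewrite inE.
have [i iE] := nthE _ jc.
rewrite (_ : _ \o _ = (fun t : #|~: u|.-tuple R => tnth t i) \o snd).
  exact: (measurableT_comp (measurable_tnthR i) measurable_snd).
by apply/funext => p /=; rewrite tnth_mktuple (negbTE ju) iE.
Qed.

Variables (G : s.-tuple R -> R) (B M alpha : R).
Hypothesis B_gt0 : 0 < B.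
Hypothesis M_gt0 : 0 < M.
Hypothesis M_lt : M < 4^-1.
Hypothesis G_diff : has_mixed_partials G.
Hypothesis G_bound : forall u (z : s.-tuple R),
  `|mixed_partial u G z| <= B * expR (M * \sum_(j < s) tnth z j ^+ 2).
Hypothesis alphaM : 2 * M < alpha^-1.

Let M01 : 0 < M < 2^-1.
Proof. by rewrite M_gt0 (lt_trans M_lt)// ltf_pV2 ?posrE// ltr_nat. Qed.

Lemma measurable_inner_integrand u : measurable_fun setT
  (fun p : #|u|.-tuple R * #|~: u|.-tuple R => inner_integrand G p.1 p.2).
Proof.
apply: measurable_funM.
  by apply: measurableT_comp; [exact: measurable_mixed_partial|exact: measurable_glue].
apply: measurable_prod => j _; apply: (measurableT_comp (f := phi)).
  by apply: continuous_measurable_fun; exact: continuous_phi.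
exact: (measurableT_comp (measurable_tnthR j) measurable_snd).
Qed.

Let bnd n (y : n.-tuple R) : R := \prod_(j < n) (expR (M * tnth y j ^+ 2) * phi (tnth y j)).

Let integrable_bnd n : (leb n).-integrable setT (EFin \o @bnd n).
Proof.
by have [] := prod_tnth (fun j : 'I_n => integrable_anova_factor false 0 M01).
Qed.

Let inner_le u (x : #|u|.-tuple R) (y : #|~: u|.-tuple R) :
  `|inner_integrand G x y| <= B * expR (M * \sum_(j < #|u|) tnth x j ^+ 2) * bnd y.
Proof.
have p0 : 0 <= prodf phi y by apply: prodr_ge0 => j _; rewrite ltW// phi_gt0.
rewrite /inner_integrand normrM (ger0_norm p0).
apply: le_trans (ler_wpM2r p0 (G_bound _ _)) _.
rewrite (glue_sum x y (fun t => t ^+ 2)) mulrDr expRD (expR_sum_sqr M y).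
by rewrite /bnd big_split/= !mulrA.
Qed.

Lemma integrable_inner_integrand u (x : #|u|.-tuple R) :
  (leb #|~: u|).-integrable setT (fun y => (inner_integrand G x y)%:E).
Proof.
apply: le_integrable (integrableZl measurableT
  (B * expR (M * \sum_(j < #|u|) tnth x j ^+ 2)) (integrable_bnd #|~: u|)) => //.
  apply/measurable_EFinP.
  apply: (measurableT_comp (f := fun p : #|u|.-tuple R * #|~: u|.-tuple R =>
    inner_integrand G p.1 p.2) (g := fun y => (x, y))).
    exact: measurable_inner_integrand.
  by move=> _ Y mY; exact: (measurable_pair1 x measurableT mY).
by move=> y _ /=; rewrite lee_fin (le_trans (inner_le x y))// ler_norm.
Qed.

Let measurable_inner_integral u :
  measurable_fun setT (fun x : #|u|.-tuple R => inner_integral G x).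
Proof.
pose f (p : #|u|.-tuple R * #|~: u|.-tuple R) := (inner_integrand G p.1 p.2)%:E.
have mf : measurable_fun setT f by apply/measurable_EFinP; exact: measurable_inner_integrand.
have -> : (fun x : #|u|.-tuple R => inner_integral G x) = (fun x =>
    \int[leb #|~: u|]_y (f^\+)%E (x, y) - \int[leb #|~: u|]_y (f^\-)%E (x, y))%E.
  apply/funext => x; rewrite /inner_integral [LHS]integralE.
  by congr (_ - _)%E; apply: eq_integral => y _; rewrite ?funeposE ?funenegE.
apply: emeasurable_funB.
  by apply: measurable_fun_fubini_tonelli_F => //; exact: measurable_funepos.
by apply: measurable_fun_fubini_tonelli_F => //; exact: measurable_funeneg.
Qed.

Let inner_integral_le u (x : #|u|.-tuple R) :
  (inner_integral G x ^+ 2 <=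
   ((B * \int[leb #|~: u|]_y bnd y) ^+ 2 * expR (2 * M * \sum_(j < #|u|) tnth x j ^+ 2))%:E)%E.
Proof.
have ii := integrable_inner_integrand x.
have -> : inner_integral G x = (\int[leb #|~: u|]_y inner_integrand G x y)%:E.
  by rewrite [RHS]fineK//; exact: (integrable_fin_num measurableT ii).
rewrite -EFin_expe lee_fin -(real_normK (num_real _)).
set S := \sum_(j < _) _.
rewrite (_ : expR (2 * M * S) = expR (M * S) ^+ 2); last by rewrite -expRM_natl mulrA.
rewrite -exprMn.
have I0 : 0 <= \int[leb #|~: u|]_y bnd y.
  by apply: Rintegral_ge0 => y _; apply: prodr_ge0 => j _; rewrite mulr_ge0 ?expR_ge0// ltW// phi_gt0.
rewrite ler_sqr ?nnegrE ?mulr_ge0 ?expR_ge0 ?(ltW B_gt0)//.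
apply: le_trans (le_normr_Rintegral measurableT ii) _.
rewrite mulrAC -RintegralZl//.
apply: le_Rintegral => //; first exact: integrable_norm.
have := integrableZl measurableT (B * expR (M * S)) (integrable_bnd #|~: u|).
by apply: eq_integrable.
Qed.

(** Averaging over the coordinates outside u leaves a bound by a constant times exp(M |x|^2); its
    square times psi_u^2 is controlled by exp((2 M - 1 / alpha) |x|^2), which is integrable. *)
Lemma inF_exp_bound (gamma : {set 'I_s} -> R) :
  (forall u, 0 < gamma u) -> inF gamma (gauss_weight alpha) G.
Proof.
move=> gamma_gt0; split => //.
- by move=> u; exact: measurable_mixed_partial.
- by move=> u; apply: aeW => x; exact: integrable_inner_integrand.
rewrite /sqnormF; apply: lte_sum_pinfty => u _.
apply: lte_mul_pinfty => //; first by rewrite lee_fin invr_ge0 ltW.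
have a0 : 0 < alpha by rewrite -invr_gt0 (lt_trans _ alphaM)// mulr_gt0.
have c0 : 0 < alpha^-1 - 2 * M by rewrite subr_gt0.
have [intp _] := prod_tnth (fun j : 'I_#|u| => integrable_expR_sqr c0).
have := integrableZl measurableT ((B * \int[leb #|~: u|]_y bnd y) ^+ 2) intp.
move=> /integrableP[mF]; apply: le_lt_trans.
apply: ge0_le_integral => //.
- by move=> x _; rewrite mule_ge0// ?lee_fin ?sqr_ge0// sqre_ge0.
- apply: emeasurable_funM.
    by under eq_fun do rewrite expe2; apply: emeasurable_funM; exact: measurable_inner_integral.
  apply/measurable_EFinP; apply: measurable_funX; apply: measurable_prod => j _.
  apply: (measurableT_comp (f := gauss_weight alpha)); last exact: measurable_tnthR.
  apply: measurableT_comp; first exact: measurable_expR.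
  by apply: measurableT_comp => //; apply: measurable_funM => //; exact: measurable_funX.
- exact: measurableT_comp.
- move=> x _ /=.
  apply: le_trans (lee_wpmul2r _ (inner_integral_le x)) _; first by rewrite lee_fin sqr_ge0.
  rewrite -EFinM lee_fin; apply: le_trans (ler_norm _).
  rewrite -[leLHS]mulrA ler_wpM2l ?sqr_ge0//.
  rewrite expR_sum_sqr /prodf -prodrXl -big_split/=.
  rewrite le_eqVlt; apply/orP; left; apply/eqP; apply: eq_bigr => j _.
  rewrite /gauss_weight -expRM_natl -expRD; congr expR.
  by field; rewrite gt_eqF.
Qed.

End norm_finite.

(** * Rate of convergence *)

Section convergence_rate.
Variables (R : realType) (s : nat) (gamma : {set 'I_s} -> R).
Hypothesis gamma_gt0 : forall u, 0 < gamma u.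

(** The error bound carries no weights whereas the criterion does; since the terms are nonnegative,
    the sum of all 1 / gamma_u converts one into the other. The exponent combines the totient bound
    N^(1 - d) with the power 1 / lam. *)
Lemma cbc_grid_mean_rate (alpha eta a lam d : R) :
  2 < alpha -> 0 < eta < 2^-1 -> 0 < a < 1 -> alpha^-1 < eta * a ->
  0 < lam <= 1 -> 1 < (2 - 2 * eta) * lam -> 0 < d ->
  exists2 D : R, 0 <= D & forall (N : nat) (z : s.-tuple nat), (0 < N)%N ->
    cbc_vector gamma (gauss_weight alpha) N z ->
    \sum_(u : {set 'I_s} | u != finset.set0)
      grid_mean N (dft N (fun m => theta (gauss_weight alpha) (m%:R / N%:R)))
        [seq tnth z j | j <- enum u] <= D * N%:R `^ (- ((1 - d) / lam)).
Proof.
move=> alpha2 eta2 a1 alphaV lam1 taulam d0.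
have [c c0 cN] := totient_ge d0.
have [l0 l1] := andP lam1.
set tau := 2 - 2 * eta.
pose A : R := 5 * tail_cst a `^ (2 * eta) *
  \int[lebesgue_measure]_t expR (- (eta * a - alpha^-1) * t ^+ 2).
pose K : R := \sum_(u : {set 'I_s}) gamma u `^ lam *
  (2 * (A `^ lam * (1 + 2 * (tau * lam / (tau * lam - 1))))) ^+ #|u|.
have K0 : 0 <= K.
  have t1 : 0 <= tau * lam / (tau * lam - 1) by rewrite divr_ge0//; move: taulam; rewrite -/tau; lra.
  apply: sumr_ge0 => u _; rewrite mulr_ge0 ?powR_ge0// exprn_ge0//.
  by rewrite !mulr_ge0 ?powR_ge0// addr_ge0// mulr_ge0.
have S0 : 0 <= \sum_u (gamma u)^-1 by apply: sumr_ge0 => u _; rewrite invr_ge0 ltW.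
exists ((\sum_u (gamma u)^-1) * (s%:R * (K / c) `^ lam^-1)).
  by rewrite !mulr_ge0 ?powR_ge0.
move=> N z N_gt0 zP.
have ah_bd h : (h < N)%N ->
    0 <= dft N (fun m => theta (gauss_weight alpha) (m%:R / N%:R)) h <=
    A * (cdist N h)%:R `^ (- tau).
  by move=> hN; rewrite dft_theta_ge0//= dft_theta_le.
have gm0 u := @grid_mean_ge0 R N N_gt0 _ tau A lam ah_bd lam1 taulam [seq tnth z j | j <- enum (u : {set 'I_s})].
have := @cbc_esh_sum_le R s gamma _ N N_gt0 gamma_gt0 (theta_refl alpha2) tau A lam
  ah_bd lam1 taulam z s zP (leqnn s).
rewrite -/K /esh_sqr => esh_le.
apply: (@le_trans _ _ ((\sum_u (gamma u)^-1) *
    \sum_(u : {set 'I_s} | (u != finset.set0) && [forall i in u, (i < s)%N])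
      gamma u * grid_mean N (dft N (fun m => theta (gauss_weight alpha) (m%:R / N%:R)))
        [seq tnth z j | j <- enum u])).
  rewrite [X in _ <= _ * X](eq_bigl (fun u => u != finset.set0)); last first.
    by move=> u; rewrite andb_idr// => _; apply/forall_inP => i _.
  rewrite mulr_sumr; apply: ler_sum => u _.
  rewrite mulrA ler_peMl// -(mulVf (lt0r_neq0 (gamma_gt0 u))) ler_wpM2r ?(ltW (gamma_gt0 u))//.
  by rewrite (bigD1 u)//= lerDl sumr_ge0// => w _; rewrite invr_ge0 ltW.
rewrite -mulrA ler_wpM2l//; apply: le_trans esh_le _.
rewrite -mulrA ler_wpM2l//.
have N0 : 0 < N%:R :> R by rewrite ltr0n.
have T0 : 0 < (totient N)%:R :> R by rewrite ltr0n totient_gt0.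
have -> : N%:R `^ (- ((1 - d) / lam)) = (N%:R `^ (1 - d))^-1 `^ lam^-1 :> R.
  by rewrite -powRN -powRrM mulNr.
rewrite -powRM ?divr_ge0 ?invr_ge0 ?powR_ge0 ?(ltW c0)//.
apply: ge0_ler_powR.
- by rewrite invr_ge0 ltW.
- by rewrite nnegrE divr_ge0// ltW.
- by rewrite nnegrE mulr_ge0 ?divr_ge0 ?invr_ge0 ?powR_ge0 ?(ltW c0).
rewrite -mulrA -invfM ler_wpM2l// lef_pV2 ?posrE ?mulr_gt0 ?powR_gt0//.
exact: cN.
Qed.

End convergence_rate.

Theorem theorem4p2 (R : realType) (s : nat) (s_gt0 : (0 < s)%N)
    (gamma : {set 'I_s} -> R) (gamma_gt0 : forall u, 0 < gamma u)
    (G : s.-tuple R -> R) (B M : R) (B_gt0 : 0 < B) (M_gt0 : 0 < M)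
    (M_lt : M < 4^-1)
    (G_diff : has_mixed_partials G)
    (G_bound : forall (u : {set 'I_s}) (z : s.-tuple R),
       `|mixed_partial u G z| <= B * expR (M * \sum_(j < s) tnth z j ^+ 2)) :
  forall eps : R, 0 < eps ->
  exists alpha : R,
    [/\ 2 < alpha,
        inF gamma (gauss_weight alpha) G &
        exists C : R, forall N : nat, (0 < N)%N ->
          (exists z : s.-tuple nat, cbc_vector gamma (gauss_weight alpha) N z) /\
          (forall z : s.-tuple nat, cbc_vector gamma (gauss_weight alpha) N z ->
             (rmse N z G <= (C * N%:R `^ (- 1 + 2 * M + eps))%:E)%E)].
Proof.
move=> eps eps0.
(* Reducing eps only strengthens the claim; the cap 1 / 2 - 2 M keeps [eta] below 1 / 2 and makes
   [rate] at least 1 / 2, which gives lam <= 1. *)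
pose e : R := Num.min eps (2^-1 - 2 * M).
have e0 : 0 < e by rewrite lt_min eps0/=; lra.
have e_eps : e <= eps by rewrite ge_min lexx.
have e_M : e <= 2^-1 - 2 * M by rewrite ge_min lexx orbT.
move: (e) e0 e_eps e_M => {}e e0 e_eps e_M.
(* [beta] is 1 / alpha. The increasing offsets e / 8, e / 4 and e / 2 leave room for 2 M < 1 / alpha
   < eta and for [rate] < 1 - eta. *)
pose beta : R := 2 * M + e / 8; pose eta : R := 2 * M + e / 4.
pose rate : R := 1 - 2 * M - e / 2.
have beta0 : 0 < beta by rewrite /beta; lra.
have eta0 : 0 < eta by rewrite /eta; lra.
have rate0 : 0 < rate by rewrite /rate; lra.
have alpha2 : 2 < beta^-1.
  by rewrite -[ltLHS]invrK ltf_pV2 ?posrE ?invr_gt0//; rewrite /beta; lra.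
have alphaM : 2 * M < beta^-1^-1 by rewrite invrK /beta; lra.
have eta2 : 0 < eta < 2^-1 by rewrite eta0 /eta; lra.
(* With this a, the product eta a is the midpoint of 1 / alpha and eta. *)
have a1 : 0 < (beta + eta) / (2 * eta) < 1.
  by rewrite divr_gt0 ?addr_gt0 ?mulr_gt0//= ltr_pdivrMr ?mulr_gt0//; rewrite /beta /eta; lra.
have aeta : beta^-1^-1 < eta * ((beta + eta) / (2 * eta)).
  rewrite invrK (_ : eta * _ = (beta + eta) / 2); last by field; rewrite gt_eqF.
  by rewrite /beta /eta; lra.
have lam1 : 0 < (2 * rate)^-1 <= 1.
  rewrite invr_gt0 mulr_gt0//= invf_le1 ?mulr_gt0//; rewrite /rate; lra.
have taulam : 1 < (2 - 2 * eta) * (2 * rate)^-1.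
  by rewrite ltr_pdivlMr ?mulr_gt0// /rate /eta; lra.
have d0 : 0 < e / 2 by rewrite divr_gt0.
have [D D0 DN] := cbc_grid_mean_rate gamma_gt0 alpha2 eta2 a1 aeta lam1 taulam d0.
have [C C0 CN] := lattice_error_le B_gt0 M_gt0 M_lt G_diff G_bound alpha2 alphaM.
exists beta^-1; split => //.
  exact: (inF_exp_bound B_gt0 M_gt0 M_lt).
exists (Num.sqrt (C * D)) => N N_gt0; split; first exact: cbc_vector_exists.
move=> z zP.
have N1 : 1 <= N%:R :> R by rewrite ler1n.
set p : R := -1 + 2 * M + eps.
have -> : Num.sqrt (C * D) * N%:R `^ p = Num.sqrt (C * D * N%:R `^ p ^+ 2).
  by rewrite [RHS]sqrtrM ?mulr_ge0// sqrtr_sqr ger0_norm ?powR_ge0.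
rewrite /rmse.
apply: (@le_trans _ _ (sqrte (C * D * N%:R `^ p ^+ 2)%:E)) => //.
rewrite lee_sqrt ?lee_fin ?mulr_ge0 ?sqr_ge0//.
apply: le_trans (CN N z N_gt0) _; rewrite lee_fin -mulrA ler_wpM2l//.
apply: le_trans (DN N z N_gt0 zP) _; rewrite ler_wpM2l//.
(* The exponent obtained is 2 rate (1 - e / 2), which is at least 2 (1 - 2 M - e). *)
rewrite -powR_mulrn ?powR_ge0// -powRrM; apply: ler_powR => //.
rewrite invrK /p /rate.
nra.
Qed.
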